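(* Let $\Gamma=\mathrm{PSL}_2(\mathbf{Z})$ act on real quadratic irrationalities by linear fractional transformations, and for a real quadratic irrationality $w$ let $w'$ denote its algebraic conjugate and $\mathrm{val}(w)\in\mathbf{C}$ the ''value'' of the elliptic modular function $j$ at $w$ (defined in the context). Then: 1) If $w$ and $w_1$ are real quadratic irrationalities that are $\Gamma$-equivalent (that is, $w_1=\frac{aw+b}{cw+d}$ for some $a,b,c,d\in\mathbf{Z}$ with $ad-bc=1$), then $\mathrm{val}(w)=\mathrm{val}(w_1)$. 2) For every real quadratic irrationality $w$, $\mathrm{val}(w)=\mathrm{val}(w')$. 3) For every real quadratic irrationality $w$, $\overline{\mathrm{val}(w)}=\mathrm{val}(-w')$, where the bar denotes complex conjugation.
   Context: Let $j(\tau)=q^{-1}+744+196884q+21493760q^2+\cdots$ ($q=e^{2\pi i\tau}$, $\tau$ in the upper half-plane $\mathfrak{H}$) be the classical elliptic modular function, which is holomorphic on $\mathfrak{H}$ and invariant under $\Gamma=\mathrm{PSL}_2(\mathbf{Z})$. Let $w$ be a real quadratic irrationality, i.e. a real irrational root of a quadratic polynomial with integer coefficients. Its discriminant $D=\mathrm{disc}(w)>0$ is $B^2-4AC$, where $Ax^2+Bx+C$ is an integer polynomial with $\gcd(A,B,C)=1$ having $w$ as a root; $w'$ is the other root (algebraic conjugate). Let $O_D$ be the quadratic order of discriminant $D$, let $U_D$ be the group of units of norm $1$ in $O_D$, and let $\varepsilon>1$ be the generator of the infinite cyclic part of $U_D$ (so $U_D=\{\pm\varepsilon^n: n\in\mathbf{Z}\}$).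 Let $\delta(w)\in\{1,-1\}$ be the sign of $w-w'$. For $0<\mathrm{Im}(u)<\pi$ the point $\frac{w-\delta(w)w'e^u}{1-\delta(w)e^u}$ lies in $\mathfrak{H}$, and the function $u\mapsto j\left(\frac{w-\delta(w)w'e^u}{1-\delta(w)e^u}\right)$ is holomorphic in this strip and invariant under $u\mapsto u+2\log\varepsilon$; hence it has a Fourier expansion $\sum_{n\in\mathbf{Z}}a_ne^{2\pi i n u/(2\log\varepsilon)}$. The value $\mathrm{val}(w)$ is defined as the constant term: $$\mathrm{val}(w):=a_0=\frac{1}{2\log\varepsilon}\int_{\sigma_0}^{\sigma_0+2\log\varepsilon} j\left(\frac{w-\delta(w)w'e^u}{1-\delta(w)e^u}\right)du,$$ where $\sigma_0$ is any complex number with $0<\mathrm{Im}(\sigma_0)<\pi$ and the integral is along the horizontal segment (it does not depend on the choice of $\sigma_0$). *)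

(* Defs.v *)
From Stdlib Require Import Reals ZArith Arith List ClassicalEpsilon.
From Coquelicot Require Import Coquelicot.
Open Scope R_scope.

(** ** The elliptic modular function *)

Definition Cexp (z : C) : C :=
  (exp (Re z) * cos (Im z), exp (Re z) * sin (Im z)).

(* Sum of a complex series, taken on real and imaginary parts. *)
Definition CSeries (a : nat -> C) : C :=
  (Series (fun n => Re (a n)), Series (fun n => Im (a n))).

(* The divisor sum sigma_k(n), for n >= 1. *)
Definition sigma (k n : nat) : nat :=
  list_sum (map (fun d => d ^ k)%nat
                (filter (fun d => (n mod d =? 0)%nat) (seq 1 n))).

Definition nome (tau : C) : C := Cexp (2 * PI * Ci * tau)%C.

(* Series are indexed from 0, hence the shift n |-> S n. *)
Definition divisor_series (k : nat) (tau : C) : C :=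
  CSeries (fun n => RtoC (INR (sigma k (S n))) * nome tau ^ (S n))%C.

Definition E4 (tau : C) : C := (1 + 240 * divisor_series 3 tau)%C.
Definition E6 (tau : C) : C := (1 - 504 * divisor_series 5 tau)%C.

(* j = E4^3 / Delta with 1728 Delta = E4^3 - E6^2, normalised so that
   j = 1/q + 744 + 196884 q + ... .  Only meaningful for Im tau > 0. *)
Definition j (tau : C) : C :=
  (1728 * E4 tau ^ 3 / (E4 tau ^ 3 - E6 tau ^ 2))%C.

(** ** Real quadratic irrationalities *)

Definition quad_root (A B C : Z) (x : R) : Prop :=
  IZR A * x ^ 2 + IZR B * x + IZR C = 0.

Definition irrational (x : R) : Prop :=
  forall p q : Z, q <> 0%Z -> x <> IZR p / IZR q.

Definition quad_irr (w : R) : Prop :=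
  irrational w /\
  exists A B C : Z, A <> 0%Z /\ quad_root A B C w.

(* For a quadratic irrationality w, the triple (A, B, C) is determined by w
   up to a common sign, so the choices below do not depend on it. *)
Definition primitive_poly (w : R) (A B C : Z) : Prop :=
  Z.gcd (Z.gcd A B) C = 1%Z /\ quad_root A B C w.

Definition disc (w : R) : Z :=
  epsilon (inhabits 0%Z) (fun D =>
    exists A B C : Z, primitive_poly w A B C /\ D = (B * B - 4 * A * C)%Z).

Definition conjugate (w : R) : R :=
  epsilon (inhabits 0) (fun w' =>
    w' <> w /\
    exists A B C : Z, primitive_poly w A B C /\ quad_root A B C w').

Definition delta (w : R) : R := sign (w - conjugate w).

(* Equivalence under PSL_2(Z); for irrational w, c w + d never vanishes. *)
Definition Gamma_equiv (w w1 : R) : Prop :=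
  exists a b c d : Z,
    (a * d - b * c = 1)%Z /\
    w1 = (IZR a * w + IZR b) / (IZR c * w + IZR d).

(** ** Units *)

(* Norm-one units of the order O_D = Z + Z (D + sqrt D)/2, for D > 0 not a
   square. *)
Definition norm_one_unit (D : Z) (x : R) : Prop :=
  exists a b : Z,
    x = IZR a + IZR b * ((IZR D + sqrt (IZR D)) / 2) /\
    x * (IZR a + IZR b * ((IZR D - sqrt (IZR D)) / 2)) = 1.

Definition fund_unit (D : Z) : R :=
  epsilon (inhabits 0) (fun e =>
    1 < e /\
    forall x : R, norm_one_unit D x <->
      exists n : Z, x = powerRZ e n \/ x = - powerRZ e n).

(** ** The value of j at w *)

Definition strip (s : C) : Prop := 0 < Im s < PI.

Definition geodesic (w : R) (u : C) : C :=
  ((w - delta w * conjugate w * Cexp u) / (1 - delta w * Cexp u))%C.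

(* The constant term, computed along the horizontal segment that starts at the
   base point s and is parametrised by u = s + t. *)
Definition val (s : C) (w : R) : C :=
  let L := 2 * ln (fund_unit (disc w)) in
  (/ RtoC L *
   RInt (V := C_R_CompleteNormedModule)
        (fun t : R => j (geodesic w (s + RtoC t))) 0 L)%C.

(* Main.v *)
(** E4 and E6 are multiples of the lattice sums of (m tau + n)^-4 and (m tau + n)^-6: the
    rational function of q = e^(2 pi i z) whose expansion is the sum of d^(k-1) q^d satisfies a
    duplication formula, and iterating it gives its partial fractions in z.  Exchanging the order
    of summation in the lattice sum gives modularity, hence the invariance of j under SL2(Z).

    Delta = E4^3 - E6^2 has no zero: |Delta| Im^6 is invariant and bounded, and a zero of Delta
    would make its supremum M satisfy M <= theta M with theta < 1 (Cauchy estimates on the line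
    Im = 1/2 against the points with Im >= 43/50).  So j is holomorphic.

    The fundamental unit (from Pell's equation) provides an automorph of w, which makes
    u |-> j(geodesic w u) periodic; for a periodic holomorphic function the integral over a
    period does not depend on the base point.  The three identities then follow from
    gamma (geodesic w u) = geodesic (gamma w) (u + real), geodesic w u = geodesic w' (i pi - u)
    and - conj (geodesic w u) = geodesic (- w') (- conj u). *)

Require Import Defs.
From Stdlib Require Import Reals ZArith.
From Coquelicot Require Import Coquelicot.
From Stdlib Require Import Lra Lia List Znumtheory ClassicalEpsilon.
Open Scope R_scope.

(** * Complex series *)

(** E4 and E6 are given only by their q-expansions, so modularity, non-vanishing of Delta and
    holomorphy of j must all be drawn from series. The kernel f(q) with coefficients d^(k-1)
    satisfies f(q) + f(-q) = 2^k f(q^2), because its even terms carry the factor 2^(k-1); this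
    relation takes the place of the cotangent expansion, and the value of f at q = -1 supplies the
    constant terms of E4 and E6 without zeta(4) or zeta(6) as powers of pi. The height 43/50 lies
    just below sqrt 3 / 2: finitely many inversions then reach it, with no fundamental domain, and
    it is far enough above 1/2 to make theta less than 1. No product formula for Delta enters.
    Holomorphy includes continuity of the derivative, so that an integral can be differentiated in
    its base point; this stands in for Cauchy's theorem. Each of the three identities moves the
    segment of integration, by a real translation or to a reflected segment run backwards;
    independence of the base point brings it back. *)

Lemma C_ext (z w : C) : Re z = Re w -> Im z = Im w -> z = w.
Proof. destruct z, w; simpl; intros; subst; reflexivity. Qed.

Lemma Rabs_Re_le (z : C) : Rabs (Re z) <= Cmod z.
Proof. eapply Rle_trans; [apply Rmax_l | apply Rmax_Cmod]. Qed.

Lemma Rabs_Im_le (z : C) : Rabs (Im z) <= Cmod z.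
Proof. eapply Rle_trans; [apply Rmax_r | apply Rmax_Cmod]. Qed.

Lemma Cmod_le_Re_Im (z : C) : Cmod z <= Rabs (Re z) + Rabs (Im z).
Proof.
  unfold Cmod. rewrite <- (sqrt_Rsqr (Rabs (Re z) + Rabs (Im z))).
  - apply sqrt_le_1_alt. unfold Rsqr, Re, Im.
    pose proof (Rabs_pos (fst z)); pose proof (Rabs_pos (snd z)).
    rewrite <- (pow2_abs (fst z)), <- (pow2_abs (snd z)). nra.
  - pose proof (Rabs_pos (Re z)); pose proof (Rabs_pos (Im z)); lra.
Qed.

Lemma Cmult_eq_reg_l (c z w : C) : c <> 0 -> (c * z = c * w)%C -> z = w.
Proof.
  intros Hc E. replace z with (/ c * (c * z))%C by (field; auto). rewrite E. field; auto.
Qed.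

Lemma Cinv_0 : (/ 0)%C = 0.
Proof. apply C_ext; simpl; unfold Rdiv; ring. Qed.

Lemma Cinv_mul (z w : C) : (/ (z * w) = / z * / w)%C.
Proof.
  destruct (Ceq_dec z 0) as [->|Hz]; [rewrite Cmult_0_l, Cinv_0; ring|].
  destruct (Ceq_dec w 0) as [->|Hw]; [rewrite Cmult_0_r, Cinv_0; ring|].
  field; auto.
Qed.

Lemma Cmod_sub_sym (z w : C) : Cmod (z - w) = Cmod (w - z).
Proof. rewrite <- Cmod_opp. f_equal. ring. Qed.

Lemma Cmod_sub_ge (z w : C) : Cmod z - Cmod w <= Cmod (z - w).
Proof.
  pose proof (Cmod_triangle (z - w) w) as H.
  replace (z - w + w)%C with z in H by ring. lra.
Qed.

Lemma Cmod_RtoC_nonneg (x : R) : 0 <= x -> Cmod x = x.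
Proof. intros. rewrite Cmod_R. apply Rabs_pos_eq; auto. Qed.

(** Componentwise, because [CSeries] splits a series in the same way; [clim_of_eps] and [clim_eps]
    translate to the modulus and back. *)
Definition clim (x : nat -> C) (l : C) : Prop :=
  is_lim_seq (fun n => Re (x n)) (Re l) /\ is_lim_seq (fun n => Im (x n)) (Im l).

Lemma clim_ext x y l : (forall n, x n = y n) -> clim x l -> clim y l.
Proof.
  intros E [H1 H2]; split; (eapply is_lim_seq_ext; [|eassumption]); intros n; cbv beta; rewrite E; auto.
Qed.

Lemma clim_ext_loc x y l :
  eventually (fun n => x n = y n) -> clim x l -> clim y l.
Proof.
  intros [N E] [H1 H2]; split; (eapply is_lim_seq_ext_loc; [|eassumption]); exists N; intros n Hn; cbv beta; rewrite E; auto.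
Qed.

Lemma clim_const (l : C) : clim (fun _ => l) l.
Proof. split; apply is_lim_seq_const. Qed.

Lemma clim_plus x y l m : clim x l -> clim y m -> clim (fun n => x n + y n)%C (l + m)%C.
Proof. intros [a b] [c d]; split; simpl; apply is_lim_seq_plus'; assumption. Qed.

Lemma clim_mult x y l m : clim x l -> clim y m -> clim (fun n => x n * y n)%C (l * m)%C.
Proof.
  intros [a b] [c d]; split; simpl.
  - apply is_lim_seq_minus'; apply is_lim_seq_mult'; assumption.
  - apply is_lim_seq_plus'; apply is_lim_seq_mult'; assumption.
Qed.

Lemma clim_scal (c : C) x l : clim x l -> clim (fun n => c * x n)%C (c * l)%C.
Proof. apply clim_mult, clim_const. Qed.

Lemma Cnorm_sq_nz (z : C) : z <> 0 -> fst z ^ 2 + snd z ^ 2 <> 0.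
Proof.
  intros H E. apply H. destruct z as [a b]; simpl in *.
  assert (a = 0) by nra. assert (b = 0) by nra. subst; reflexivity.
Qed.

Lemma clim_inv (x : nat -> C) (l : C) : l <> 0 -> clim x l -> clim (fun n => / x n)%C (/ l)%C.
Proof.
  intros Hl [a b]. pose proof (Cnorm_sq_nz l Hl) as Hn.
  assert (S : is_lim_seq (fun n => fst (x n) ^ 2 + snd (x n) ^ 2) (fst l ^ 2 + snd l ^ 2)).
  { apply is_lim_seq_plus'; simpl; (apply is_lim_seq_mult';
      [|apply is_lim_seq_mult'; [|apply is_lim_seq_const]]); assumption. }
  split; simpl Re; simpl Im; apply is_lim_seq_div'; auto.
  apply (is_lim_seq_opp _ (Im l)); exact b.
Qed.

Lemma clim_pow x l k : clim x l -> clim (fun n => x n ^ k)%C (l ^ k)%C.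
Proof.
  intros H. induction k; simpl; [apply clim_const | apply clim_mult; assumption].
Qed.

Lemma clim_unique x l m : clim x l -> clim x m -> l = m.
Proof.
  intros [a b] [c d]. apply C_ext.
  - apply is_lim_seq_unique in a; apply is_lim_seq_unique in c. congruence.
  - apply is_lim_seq_unique in b; apply is_lim_seq_unique in d. congruence.
Qed.

Lemma clim_of_eps x l :
  (forall eps, 0 < eps -> exists N, forall n, (N <= n)%nat -> Cmod (x n - l) <= eps) -> clim x l.
Proof.
  intros H; split; apply is_lim_seq_spec; intros eps; simpl;
  (destruct (H (eps / 2)) as [N HN]; [destruct eps; simpl; lra|]); exists N; intros n Hn;
  specialize (HN n Hn); destruct eps as [e He]; simpl in *.
  - pose proof (Rabs_Re_le (x n - l)) as P. simpl in P. unfold Rminus, Re in *; lra.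
  - pose proof (Rabs_Im_le (x n - l)) as P. simpl in P. unfold Rminus, Im in *; lra.
Qed.

Lemma clim_eps x l : clim x l ->
  forall eps, 0 < eps -> exists N, forall n, (N <= n)%nat -> Cmod (x n - l) <= eps.
Proof.
  intros [a b] eps He. apply is_lim_seq_spec in a; apply is_lim_seq_spec in b.
  assert (He' : 0 < eps / 2) by lra.
  destruct (a (mkposreal _ He')) as [N1 H1]; destruct (b (mkposreal _ He')) as [N2 H2].
  simpl in *.
  exists (max N1 N2); intros n Hn.
  specialize (H1 n ltac:(lia)); specialize (H2 n ltac:(lia)).
  pose proof (Cmod_le_Re_Im (x n - l)) as P. simpl in P.
  unfold Rminus, Re, Im in *; lra.
Qed.

Lemma clim_Cmod_le x l M : clim x l -> (forall n, Cmod (x n) <= M) -> Cmod l <= M.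
Proof.
  intros H HM. apply Rnot_lt_le; intros Hlt.
  destruct (clim_eps _ _ H ((Cmod l - M) / 2)) as [N HN]; [lra|].
  specialize (HN N (Nat.le_refl _)). specialize (HM N).
  pose proof (Cmod_sub_ge l (x N)). rewrite Cmod_sub_sym in H0. lra.
Qed.

Lemma clim_squeeze (x : nat -> C) l (u : nat -> R) :
  (forall n, Cmod (x n - l) <= u n) -> is_lim_seq u 0 -> clim x l.
Proof.
  intros H Hu. apply clim_of_eps. intros eps He.
  apply is_lim_seq_spec in Hu. destruct (Hu (mkposreal _ He)) as [N HN].
  exists N; intros n Hn. specialize (HN n Hn); simpl in HN. specialize (H n).
  rewrite Rminus_0_r in HN. pose proof (Rle_abs (u n)). lra.
Qed.

(** The upper bound is exclusive, so that splitting a sum needs no correction by one; [sum_f_R0] is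
    inclusive, hence the [S n] in [Re_csum] and [Im_csum]. *)
Fixpoint csum (a : nat -> C) (n : nat) : C :=
  match n with O => 0 | S m => (csum a m + a m)%C end.

Lemma csum_ext a b n : (forall k, (k < n)%nat -> a k = b k) -> csum a n = csum b n.
Proof. induction n; simpl; intros H; auto. rewrite IHn, H by auto. auto. Qed.

Lemma csum_scal c a n : csum (fun k => c * a k)%C n = (c * csum a n)%C.
Proof. induction n; simpl; [|rewrite IHn]; ring. Qed.

Lemma csum_plus a b n : csum (fun k => a k + b k)%C n = (csum a n + csum b n)%C.
Proof. induction n; simpl; [|rewrite IHn]; ring. Qed.

Lemma csum_split a n m : csum a (n + m) = (csum a n + csum (fun k => a (n + k)%nat) m)%C.
Proof.
  induction m; simpl; [rewrite Nat.add_0_r; ring|].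
  rewrite Nat.add_succ_r; simpl. rewrite IHm; ring.
Qed.

Lemma csum_incr_1 a n : csum a (S n) = (a 0%nat + csum (fun k => a (S k)) n)%C.
Proof. change (S n) with (1 + n)%nat. rewrite csum_split. simpl. ring. Qed.

Lemma Cmod_csum_le a (u : nat -> R) n :
  (forall k, (k < n)%nat -> Cmod (a k) <= u k) -> Cmod (csum a n) <= Re (csum (fun k => RtoC (u k)) n).
Proof.
  induction n; simpl; intros H; [rewrite Cmod_0; lra|].
  eapply Rle_trans; [apply Cmod_triangle|].
  apply Rplus_le_compat; [apply IHn; auto | apply H; lia].
Qed.

Lemma Re_csum a n : Re (csum a (S n)) = sum_f_R0 (fun k => Re (a k)) n.
Proof.
  induction n; [simpl; unfold Re, Im; ring|]. change (csum a (S (S n))) with (csum a (S n) + a (S n))%C.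
  simpl sum_f_R0. rewrite <- IHn. reflexivity.
Qed.

Lemma Im_csum a n : Im (csum a (S n)) = sum_f_R0 (fun k => Im (a k)) n.
Proof.
  induction n; [simpl; unfold Re, Im; ring|]. change (csum a (S (S n))) with (csum a (S n) + a (S n))%C.
  simpl sum_f_R0. rewrite <- IHn. reflexivity.
Qed.

(** [Series] is total and has a meaningless value on divergent series; absolute convergence is the
    condition carried along to manipulate [CSeries]. *)
Definition cabs (a : nat -> C) : Prop := ex_series (fun n => Cmod (a n)).

Lemma ex_series_le_nonneg (a b : nat -> R) :
  (forall n, 0 <= a n <= b n) -> ex_series b -> ex_series a.
Proof.
  intros H. apply (ex_series_le (K := R_AbsRing) (V := R_CompleteNormedModule)).
  intros n. unfold norm; simpl; unfold abs; simpl. rewrite Rabs_pos_eq; apply H.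
Qed.

Lemma cabs_le a (u : nat -> R) : (forall n, Cmod (a n) <= u n) -> ex_series u -> cabs a.
Proof. intros H. apply ex_series_le_nonneg. intros n; split; [apply Cmod_ge_0 | auto]. Qed.

Lemma cabs_Re a : cabs a -> ex_series (fun n => Re (a n)).
Proof.
  intros H. apply ex_series_Rabs. eapply ex_series_le_nonneg; [|exact H].
  intros n; split; [apply Rabs_pos | apply Rabs_Re_le].
Qed.

Lemma cabs_Im a : cabs a -> ex_series (fun n => Im (a n)).
Proof.
  intros H. apply ex_series_Rabs. eapply ex_series_le_nonneg; [|exact H].
  intros n; split; [apply Rabs_pos | apply Rabs_Im_le].
Qed.

Lemma cabs_ext a b : (forall n, a n = b n) -> cabs a -> cabs b.
Proof. intros E. apply ex_series_ext. intros n; rewrite E; auto. Qed.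

Lemma cabs_plus a b : cabs a -> cabs b -> cabs (fun n => a n + b n)%C.
Proof.
  intros Ha Hb. apply cabs_le with (u := fun n => Cmod (a n) + Cmod (b n)).
  - intros; apply Cmod_triangle.
  - apply (ex_series_plus (V := R_NormedModule)); assumption.
Qed.

Lemma ex_series_Rscal (c : R) (u : nat -> R) : ex_series u -> ex_series (fun n => c * u n).
Proof. apply (ex_series_scal (V := R_NormedModule)). Qed.

Lemma cabs_scal c a : cabs a -> cabs (fun n => c * a n)%C.
Proof.
  intros Ha. apply cabs_le with (u := fun n => Cmod c * Cmod (a n)).
  - intros; rewrite Cmod_mult; lra.
  - apply ex_series_Rscal; assumption.
Qed.

Lemma cabs_incr_n a n : cabs a -> cabs (fun k => a (n + k)%nat).
Proof. intros H. apply (ex_series_incr_n (fun k => Cmod (a k)) n) in H. exact H. Qed.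

Lemma cabs_decr_1 a : cabs (fun k => a (S k)) -> cabs a.
Proof. intros H. apply (ex_series_incr_1 (fun k => Cmod (a k))). exact H. Qed.

Lemma CSeries_ext a b : (forall n, a n = b n) -> CSeries a = CSeries b.
Proof.
  intros E; unfold CSeries; f_equal; apply Series_ext; intros n; rewrite E; auto.
Qed.

Lemma CSeries_plus a b : cabs a -> cabs b ->
  CSeries (fun n => a n + b n)%C = (CSeries a + CSeries b)%C.
Proof.
  intros Ha Hb. apply C_ext; simpl; apply Series_plus; auto using cabs_Re, cabs_Im.
Qed.

Lemma CSeries_scal c a : cabs a -> CSeries (fun n => c * a n)%C = (c * CSeries a)%C.
Proof.
  intros Ha. pose proof (cabs_Re a Ha). pose proof (cabs_Im a Ha).
  apply C_ext; simpl; rewrite <- !Series_scal_l.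
  - rewrite <- Series_minus; auto using ex_series_Rscal.
  - rewrite <- Series_plus; auto using ex_series_Rscal.
Qed.

Lemma CSeries_incr_1 a : cabs a -> CSeries a = (a 0%nat + CSeries (fun n => a (S n)))%C.
Proof.
  intros Ha. apply C_ext; simpl.
  - apply (Series_incr_1 (fun n => Re (a n))); auto using cabs_Re.
  - apply (Series_incr_1 (fun n => Im (a n))); auto using cabs_Im.
Qed.

Lemma CSeries_incr_n a n : cabs a -> CSeries a = (csum a n + CSeries (fun k => a (n + k)%nat))%C.
Proof.
  intros Ha. induction n; simpl; [ring_simplify; auto|].
  rewrite IHn, (CSeries_incr_1 (fun k => a (n + k)%nat)) by (apply cabs_incr_n; auto).
  rewrite Nat.add_0_r. rewrite Cplus_assoc. f_equal. apply CSeries_ext. intros; f_equal; lia.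
Qed.

Lemma clim_csum a : cabs a -> clim (csum a) (CSeries a).
Proof.
  intros Ha. pose proof (cabs_Re a Ha) as H1. pose proof (cabs_Im a Ha) as H2.
  apply Series_correct in H1, H2. split; apply is_lim_seq_incr_1.
  - eapply is_lim_seq_ext; [|exact H1]. intros n. simpl. rewrite sum_n_Reals. symmetry; apply Re_csum.
  - eapply is_lim_seq_ext; [|exact H2]. intros n. simpl. rewrite sum_n_Reals. symmetry; apply Im_csum.
Qed.

Lemma Series_zero (a : nat -> R) : (forall n, a n = 0) -> Series a = 0.
Proof.
  intros H. rewrite (Series_ext a (fun n => 0 * 0)) by (intros; rewrite H; ring).
  rewrite Series_scal_l. ring.
Qed.

Lemma Series_nonneg (u : nat -> R) : (forall n, 0 <= u n) -> ex_series u -> 0 <= Series u.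
Proof.
  intros H Hu. rewrite <- (Series_zero (fun _ => 0)) by auto.
  apply Series_le; auto. intros; split; auto; lra.
Qed.

Lemma sum_n_le_Series (u : nat -> R) n : (forall k, 0 <= u k) -> ex_series u ->
  Re (csum (fun k => RtoC (u k)) n) <= Series u.
Proof.
  intros Hp Hu. destruct n.
  - apply Series_nonneg; auto.
  - rewrite Re_csum. change (sum_f_R0 (fun k => Re (u k)) n) with (sum_f_R0 u n).
    rewrite (Series_incr_n u (S n)) by (auto; lia). simpl.
    assert (0 <= Series (fun k => u (S (n + k)))).
    { apply Series_nonneg; auto. apply (ex_series_incr_n u (S n)); auto. }
    lra.
Qed.

Lemma Cmod_csum_le_Series a (u : nat -> R) n :
  (forall k, Cmod (a k) <= u k) -> ex_series u -> Cmod (csum a n) <= Series u.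
Proof.
  intros H Hu. eapply Rle_trans; [apply Cmod_csum_le; intros; apply H|].
  apply sum_n_le_Series; auto. intros k. eapply Rle_trans; [apply Cmod_ge_0 | apply H].
Qed.

Lemma Cmod_CSeries_le a (u : nat -> R) :
  (forall k, Cmod (a k) <= u k) -> ex_series u -> Cmod (CSeries a) <= Series u.
Proof.
  intros H Hu. apply clim_Cmod_le with (x := csum a).
  - apply clim_csum. eapply cabs_le; eauto.
  - intros n. apply Cmod_csum_le_Series; auto.
Qed.

Lemma Series_tail_small (u : nat -> R) eps : ex_series u -> 0 < eps ->
  exists n, forall m, (n <= m)%nat -> Rabs (Series (fun k => u (m + k)%nat)) <= eps.
Proof.
  intros Hu He. assert (H : is_lim_seq (sum_n u) (Series u)) by exact (Series_correct _ Hu).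
  apply is_lim_seq_spec in H. destruct (H (mkposreal _ He)) as [N HN]. simpl in HN.
  exists (S N). intros m Hm. destruct m; [lia|].
  specialize (HN m ltac:(lia)). rewrite sum_n_Reals in HN.
  rewrite (Series_incr_n u (S m)) in HN by (auto; lia). simpl in HN.
  replace (sum_f_R0 u m - (sum_f_R0 u m + Series (fun k => u (S (m + k)))))
    with (- Series (fun k => u (S (m + k)))) in HN by ring.
  rewrite Rabs_Ropp in HN. simpl. lra.
Qed.

(** Tannery's theorem: the majorant makes the tails small uniformly in N, and the finitely many
    remaining terms converge one by one. *)
Lemma CSeries_dominated (a : nat -> nat -> C) (b : nat -> C) (u : nat -> R) :
  (forall N n, Cmod (a N n) <= u n) -> ex_series u ->
  (forall n, clim (fun N => a N n) (b n)) ->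
  clim (fun N => CSeries (a N)) (CSeries b).
Proof.
  intros Hd Hu Hl.
  assert (Hb : forall n, Cmod (b n) <= u n).
  { intros n. apply clim_Cmod_le with (x := fun N => a N n); auto. }
  apply clim_of_eps. intros eps He.
  destruct (Series_tail_small u (eps / 3) Hu) as [m Hm]; [lra|].
  specialize (Hm m (Nat.le_refl _)). pose proof (Rle_abs (Series (fun k => u (m + k)%nat))).
  assert (Hc : clim (fun N => csum (a N) m) (csum b m)).
  { clear - Hl. induction m; simpl; [apply clim_const | apply clim_plus; auto]. }
  destruct (clim_eps _ _ Hc (eps / 3)) as [N0 HN]; [lra|].
  exists N0. intros N HNN. specialize (HN N HNN).
  assert (Hu' : ex_series (fun k => u (m + k)%nat)) by (apply (ex_series_incr_n u m); auto).
  rewrite (CSeries_incr_n (a N) m), (CSeries_incr_n b m) by (eapply cabs_le; eauto).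
  pose proof (Cmod_CSeries_le (fun k => a N (m + k)%nat) _ (fun k => Hd N _) Hu') as B1.
  pose proof (Cmod_CSeries_le (fun k => b (m + k)%nat) _ (fun k => Hb _) Hu') as B2.
  set (A1 := CSeries (fun k => a N (m + k)%nat)) in *.
  set (A2 := CSeries (fun k => b (m + k)%nat)) in *.
  replace (csum (a N) m + A1 - (csum b m + A2))%C
    with ((csum (a N) m - csum b m) + (A1 + - A2))%C by ring.
  pose proof (Cmod_triangle (csum (a N) m - csum b m) (A1 + - A2)).
  pose proof (Cmod_triangle A1 (- A2)). rewrite Cmod_opp in *. lra.
Qed.

Lemma CSeries_csum (a : nat -> nat -> C) (u : nat -> nat -> R) N :
  (forall m n, Cmod (a m n) <= u m n) -> (forall m, ex_series (u m)) ->
  CSeries (fun n => csum (fun m => a m n) N) = csum (fun m => CSeries (a m)) N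
  /\ cabs (fun n => csum (fun m => a m n) N).
Proof.
  intros H Hu. induction N; simpl.
  - split.
    + unfold CSeries; simpl. rewrite !Series_zero by auto. reflexivity.
    + apply cabs_le with (u := fun _ => 0); [intros; rewrite Cmod_0; lra|].
      exists 0. apply is_series_Reals. intros eps He. exists 0%nat. intros n _.
      unfold R_dist. rewrite sum_eq_R0 by auto. rewrite Rminus_0_r, Rabs_R0. exact He.
  - destruct IHN as [E1 E2]. assert (cabs (a N)) by (eapply cabs_le; eauto).
    split; [rewrite CSeries_plus, E1; auto | apply cabs_plus; auto].
Qed.

(** A finite sum over m may be moved inside the series over n; the partial sums of the left side
    thus converge to both sides, the second limit by dominated convergence. A majorant of product
    form makes all bounds explicit, and later double series are estimated in that form. *)
Lemma CSeries_fubini (a : nat -> nat -> C) (u v : nat -> R) :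
  (forall m n, Cmod (a m n) <= u m * v n) -> ex_series u -> ex_series v ->
  (forall m, 0 <= u m) -> (forall n, 0 <= v n) ->
  CSeries (fun m => CSeries (a m)) = CSeries (fun n => CSeries (fun m => a m n)).
Proof.
  intros H Hu Hv Pu Pv.
  assert (Hr : forall m, ex_series (fun n => u m * v n)) by (intros; apply ex_series_Rscal; auto).
  apply clim_unique with (x := csum (fun m => CSeries (a m))).
  - apply clim_csum. apply cabs_le with (u := fun m => u m * Series v).
    + intros m. rewrite <- Series_scal_l. apply Cmod_CSeries_le; auto.
    + apply ex_series_ext with (a := fun m => Series v * u m); [intros; apply Rmult_comm|].
      apply ex_series_Rscal; auto.
  - apply clim_ext with (x := fun N => CSeries (fun n => csum (fun m => a m n) N)).
    { intros N. apply (CSeries_csum a (fun m n => u m * v n) N); auto. }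
    apply CSeries_dominated with (u := fun n => Series u * v n).
    + intros N n. rewrite Rmult_comm, <- Series_scal_l.
      apply Cmod_csum_le_Series; [|apply ex_series_Rscal; auto].
      intros k. rewrite Rmult_comm. auto.
    + apply ex_series_Rscal; auto.
    + intros n. apply clim_csum. apply cabs_le with (u := fun m => v n * u m);
        [intros; rewrite Rmult_comm; auto | apply ex_series_Rscal; auto].
Qed.

Definition cconv (a b : nat -> C) (n : nat) : C :=
  csum (fun k => a k * b (n - k)%nat)%C (S n).

Lemma cabs_cconv a b : cabs a -> cabs b -> cabs (cconv a b).
Proof.
  intros Ha Hb.
  apply cabs_le with (u := fun n => sum_f_R0 (fun k => Cmod (a k) * Cmod (b (n - k)%nat)) n).
  - intros n. unfold cconv.
    eapply Rle_trans; [apply Cmod_csum_le with (u := fun k => Cmod (a k) * Cmod (b (n - k)%nat));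
      intros; rewrite Cmod_mult; lra|].
    rewrite Re_csum. apply Req_le. reflexivity.
  - exists (Series (fun n => Cmod (a n)) * Series (fun n => Cmod (b n))).
    assert (Habs : forall c, cabs c -> ex_series (fun n => Rabs (Cmod (c n)))).
    { intros c Hc. eapply ex_series_ext; [|exact Hc].
      intros n; simpl. rewrite Rabs_pos_eq; auto using Cmod_ge_0. }
    apply (is_series_mult (fun n => Cmod (a n)) (fun n => Cmod (b n)));
      auto; apply Series_correct; assumption.
Qed.

(** The real theorem on Cauchy products is applied to the four pairs of real and imaginary parts. *)
Lemma CSeries_cconv a b : cabs a -> cabs b ->
  CSeries (cconv a b) = (CSeries a * CSeries b)%C.
Proof.
  intros Ha Hb.
  assert (RA : ex_series (fun n => Rabs (Re (a n)))) by (eapply ex_series_le_nonneg; [|exact Ha];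
    intros; split; [apply Rabs_pos | apply Rabs_Re_le]).
  assert (IA : ex_series (fun n => Rabs (Im (a n)))) by (eapply ex_series_le_nonneg; [|exact Ha];
    intros; split; [apply Rabs_pos | apply Rabs_Im_le]).
  assert (RB : ex_series (fun n => Rabs (Re (b n)))) by (eapply ex_series_le_nonneg; [|exact Hb];
    intros; split; [apply Rabs_pos | apply Rabs_Re_le]).
  assert (IB : ex_series (fun n => Rabs (Im (b n)))) by (eapply ex_series_le_nonneg; [|exact Hb];
    intros; split; [apply Rabs_pos | apply Rabs_Im_le]).
  pose proof (Series_correct _ (cabs_Re _ Ha)) as sra. pose proof (Series_correct _ (cabs_Im _ Ha)) as sia.
  pose proof (Series_correct _ (cabs_Re _ Hb)) as srb. pose proof (Series_correct _ (cabs_Im _ Hb)) as sib.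
  pose proof (is_series_mult _ _ _ _ sra srb RA RB) as P1.
  pose proof (is_series_mult _ _ _ _ sia sib IA IB) as P2.
  pose proof (is_series_mult _ _ _ _ sra sib RA IB) as P3.
  pose proof (is_series_mult _ _ _ _ sia srb IA RB) as P4.
  apply C_ext.
  - change (Re (CSeries (cconv a b))) with (Series (fun n => Re (cconv a b n))).
    apply is_series_unique.
    pose proof (is_series_minus _ _ _ _ P1 P2) as Q.
    eapply is_series_ext; [|exact Q]. intros n. unfold cconv. rewrite Re_csum.
    unfold minus, plus, opp; simpl.
    rewrite <- (Rminus_def (sum_f_R0 _ _)), <- minus_sum. apply sum_eq. intros; reflexivity.
  - change (Im (CSeries (cconv a b))) with (Series (fun n => Im (cconv a b n))).
    apply is_series_unique.
    pose proof (is_series_plus _ _ _ _ P3 P4) as Q.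
    eapply is_series_ext; [|exact Q]. intros n. unfold cconv. rewrite Im_csum.
    unfold plus; simpl. rewrite <- plus_sum. apply sum_eq. intros; reflexivity.
Qed.

Lemma cabs_geom (q : C) : Cmod q < 1 -> cabs (fun n => q ^ n)%C.
Proof.
  intros H. unfold cabs. apply ex_series_ext with (a := fun n => Cmod q ^ n).
  - intros; rewrite Cmod_pow; auto.
  - apply ex_series_geom. rewrite Rabs_pos_eq; auto using Cmod_ge_0.
Qed.

Lemma one_minus_nz (q : C) : Cmod q < 1 -> (1 - q)%C <> 0.
Proof.
  intros H E. assert (q = 1) by (rewrite <- (Cplus_0_r q), <- E; ring).
  subst q. rewrite Cmod_1 in H. lra.
Qed.

(** Splitting off the first term shows s = 1 + q s, which is solved for s. *)
Lemma CSeries_geom (q : C) : Cmod q < 1 -> CSeries (fun n => q ^ n)%C = (/ (1 - q))%C.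
Proof.
  intros H. pose proof (cabs_geom q H) as Ha.
  assert (E : CSeries (fun n => q ^ n)%C = (1 + q * CSeries (fun n => q ^ n))%C).
  { rewrite (CSeries_incr_1 _ Ha) at 1. simpl. rewrite CSeries_scal; auto. }
  pose proof (one_minus_nz q H). set (s := CSeries _) in *.
  replace s with ((s - q * s) / (1 - q))%C by (field; auto). rewrite E at 1. field; auto.
Qed.

(** * The exponential and bilateral series *)

Lemma exp_monotone (x y : R) : x <= y -> exp x <= exp y.
Proof. intros [H|H]; [left; apply exp_increasing; auto | subst; lra]. Qed.

Lemma Cexp_plus (z w : C) : Cexp (z + w) = (Cexp z * Cexp w)%C.
Proof.
  unfold Cexp, Re, Im. apply C_ext; unfold Re, Im; simpl; rewrite exp_plus; [rewrite cos_plus | rewrite sin_plus]; ring.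
Qed.

Lemma Cexp_0 : Cexp 0 = 1.
Proof. unfold Cexp; simpl. rewrite exp_0, cos_0, sin_0. apply C_ext; simpl; ring. Qed.

Lemma Cexp_nz (z : C) : Cexp z <> 0.
Proof.
  intros E. assert (H : (Cexp z * Cexp (- z))%C = 1).
  { rewrite <- Cexp_plus, <- Cexp_0. f_equal. ring. }
  rewrite E, Cmult_0_l in H. apply (f_equal Re) in H; simpl in H. lra.
Qed.

Lemma Cexp_opp (z : C) : Cexp (- z) = (/ Cexp z)%C.
Proof.
  apply Cmult_eq_reg_l with (Cexp z); [apply Cexp_nz|].
  rewrite <- Cexp_plus, Cinv_r by apply Cexp_nz. rewrite <- Cexp_0. f_equal; ring.
Qed.

Lemma Cmod_Cexp (z : C) : Cmod (Cexp z) = exp (Re z).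
Proof.
  unfold Cmod, Cexp; cbn [fst snd]. pose proof (sin2_cos2 (Im z)) as H. unfold Rsqr in H.
  transitivity (sqrt (Rsqr (exp (Re z)))); [|apply sqrt_Rsqr; left; apply exp_pos].
  f_equal. unfold Rsqr.
  transitivity (exp (Re z) * exp (Re z) * (sin (Im z) * sin (Im z) + cos (Im z) * cos (Im z))); [ring|].
  rewrite H; ring.
Qed.

Lemma Cexp_RtoC (x : R) : Cexp x = RtoC (exp x).
Proof. unfold Cexp, Re, Im; apply C_ext; unfold Re, Im; simpl; rewrite ?cos_0, ?sin_0; ring. Qed.

Lemma Cexp_iPI : Cexp (PI * Ci) = (- 1)%C.
Proof.
  unfold Cexp, Re, Im; apply C_ext; unfold Re, Im; simpl;
  replace (PI * 0 - 0 * 1) with 0 by ring; replace (PI * 1 + 0 * 0) with PI by ring;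
  rewrite exp_0, ?cos_PI, ?sin_PI; ring.
Qed.

Lemma Cexp_conj (z : C) : Cexp (Cconj z) = Cconj (Cexp z).
Proof.
  unfold Cexp, Re, Im; apply C_ext; unfold Re, Im; simpl; [rewrite cos_neg | rewrite sin_neg]; ring.
Qed.

Lemma nome_plus (z w : C) : nome (z + w) = (nome z * nome w)%C.
Proof. unfold nome. rewrite <- Cexp_plus. f_equal; ring. Qed.

Lemma nome_half : nome (/ 2) = (- 1)%C.
Proof. unfold nome. rewrite <- Cexp_iPI. f_equal. field. Qed.

Lemma C2_nz : (2 : C) <> 0.
Proof. intros H; apply (f_equal Re) in H; simpl in H; lra. Qed.

Lemma nome_1 : nome 1 = 1.
Proof.
  replace (RtoC 1) with (/ 2 + / 2)%C at 1 by (field; apply C2_nz).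
  rewrite nome_plus, nome_half. ring.
Qed.

Lemma nome_add_1 (z : C) : nome (z + 1) = nome z.
Proof. rewrite nome_plus, nome_1; ring. Qed.

Lemma nome_add_Z (z : C) (n : Z) : nome (z + IZR n) = nome z.
Proof.
  revert n; apply Z.peano_ind.
  - f_equal; ring.
  - intros n IH. rewrite succ_IZR, RtoC_plus, Cplus_assoc, nome_add_1; auto.
  - intros n IH. rewrite <- IH, <- nome_add_1. f_equal. unfold Z.pred.
    rewrite plus_IZR, RtoC_plus. apply C_ext; simpl; ring.
Qed.

Lemma nome_nz (z : C) : nome z <> 0.
Proof. apply Cexp_nz. Qed.

Lemma nome_INR_mult (n : nat) (z : C) : nome (INR n * z) = (nome z ^ n)%C.
Proof.
  induction n.
  - simpl INR. rewrite Cmult_0_l. unfold nome. rewrite Cmult_0_r. apply Cexp_0.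
  - rewrite S_INR, RtoC_plus. replace ((INR n + 1) * z)%C with (INR n * z + z)%C by ring.
    rewrite nome_plus, IHn. simpl; ring.
Qed.

Lemma Cmod_nome (z : C) : Cmod (nome z) = exp (- (2 * PI * Im z)).
Proof. unfold nome. rewrite Cmod_Cexp. f_equal. destruct z; simpl. ring. Qed.

Lemma Cmod_nome_lt_1 (z : C) : 0 < Im z -> Cmod (nome z) < 1.
Proof.
  intros H. rewrite Cmod_nome, <- exp_0. apply exp_increasing. pose proof PI_RGT_0. nra.
Qed.

Lemma Cmod_nome_le_1 (z : C) : 0 <= Im z -> Cmod (nome z) <= 1.
Proof.
  intros H. rewrite Cmod_nome, <- exp_0. apply exp_monotone. pose proof PI_RGT_0. nra.
Qed.

(** * Explicit bounds for exp near 0 and for 1 - q near q = 1 *)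

Lemma exp_minus_affine_le (a : R) : Rabs a <= / 2 -> 0 <= exp a - 1 - a <= 2 * a ^ 2.
Proof.
  intros H. apply Rabs_le_between in H. split.
  - pose proof (exp_ineq1_le a); lra.
  - pose proof (exp_ineq1_le (- a)) as P. rewrite exp_Ropp in P.
    pose proof (exp_pos a) as Q.
    (* This is exp (- a) >= 1 - a; dividing by 1 - a >= 1/2 gives the upper bound. *)
    assert (exp a * (1 - a) <= 1).
    { apply Rmult_le_reg_r with (/ exp a); [apply Rinv_0_lt_compat; auto|].
      replace (exp a * (1 - a) * / exp a) with (1 - a) by (field; lra). lra. }
    assert (exp a <= 1 / (1 - a)) by (apply Rle_div_r; lra).
    assert (1 / (1 - a) <= 1 + a + 2 * a ^ 2).
    { apply Rle_div_l; [lra|]. assert (0 <= a ^ 2 * (1 - 2 * a)); [|nra].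
      apply Rmult_le_pos; [apply pow2_ge_0 | lra]. }
    lra.
Qed.

Lemma one_minus_cos_le (b : R) : 0 <= 1 - cos b <= b ^ 2 / 2.
Proof.
  split; [pose proof (COS_bound b); lra|].
  replace b with (2 * (b / 2)) at 1 by field. rewrite cos_2a_sin.
  assert (sin (b / 2) ^ 2 <= (b / 2) ^ 2).
  { rewrite <- (pow2_abs (sin _)), <- (pow2_abs (b / 2)). apply pow_incr. split; [apply Rabs_pos|].
    destruct (Rle_lt_dec 0 (b / 2)) as [h|h].
    - rewrite (Rabs_pos_eq (b / 2)) by auto. apply Rabs_le.
      destruct h as [h|h]; [|rewrite <- h, sin_0; lra].
      destruct (Rle_lt_dec 1 (b / 2)); [pose proof (SIN_bound (b / 2)); lra|].
      pose proof (sin_lt_x _ h). pose proof PI2_1. pose proof (sin_gt_0 (b / 2)); lra.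
    - rewrite (Rabs_left (b / 2)) by auto. rewrite <- Rabs_Ropp, <- sin_neg. apply Rabs_le.
      assert (h' : 0 < - (b / 2)) by lra.
      destruct (Rle_lt_dec 1 (- (b / 2))); [pose proof (SIN_bound (- (b / 2))); lra|].
      pose proof (sin_lt_x _ h'). pose proof PI2_1. pose proof (sin_gt_0 (- (b / 2))); lra. }
  lra.
Qed.

Lemma sin_ge_cubic (b : R) : 0 <= b <= 4 -> b - b ^ 3 / 6 <= sin b.
Proof.
  intros H. pose proof (pre_sin_bound b 0) as P. unfold sin_approx, sin_term in P; simpl in P.
  destruct P as [P _]; try lra.
Qed.

Lemma sin_minus_id_le (b : R) : Rabs b <= 1 -> Rabs (sin b - b) <= b ^ 2.
Proof.
  assert (G : forall b, 0 <= b <= 1 -> Rabs (sin b - b) <= b ^ 2).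
  { intros c H. pose proof (sin_ge_cubic c). 
    assert (sin c <= c) by (destruct (Rle_lt_or_eq_dec 0 c); [lra| left; apply sin_lt_x; auto | subst; rewrite sin_0; lra]).
    apply Rabs_le. split; [|nra]. nra. }
  intros H. destruct (Rle_lt_dec 0 b).
  - apply G. rewrite Rabs_pos_eq in H; lra.
  - rewrite Rabs_left in H by lra. specialize (G (- b) ltac:(lra)). rewrite sin_neg in G.
    rewrite <- Rabs_Ropp. replace (- (sin b - b)) with (- sin b - - b) by ring.
    replace (b ^ 2) with ((- b) ^ 2) by ring. auto.
Qed.

(** For h = a + i b the real part is at most 2 a^2 + b^2 and the imaginary part at most 2 a^2 + 4
    b^2; 10 is a generous common constant. The bound serves both the derivative of [Cexp] and the
    limit of the kernels at their pole. *)
Lemma Cexp_minus_affine_le (h : C) : Cmod h <= / 2 -> Cmod (Cexp h - 1 - h) <= 10 * Cmod h ^ 2.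
Proof.
  intros H. destruct h as [a b].
  assert (Ha : Rabs a <= / 2) by (eapply Rle_trans; [apply (Rabs_Re_le (a, b))|auto]).
  assert (Hb : Rabs b <= / 2) by (eapply Rle_trans; [apply (Rabs_Im_le (a, b))|auto]).
  rewrite Cmod2_alt. simpl Re; simpl Im.
  eapply Rle_trans; [apply Cmod_le_Re_Im|]. unfold Cexp; simpl.
  pose proof (exp_minus_affine_le a Ha) as E. pose proof (one_minus_cos_le b) as K.
  pose proof (sin_minus_id_le b ltac:(lra)) as S.
  apply Rabs_le_between in S. apply Rabs_le_between in Ha. apply Rabs_le_between in Hb.
  assert (He : 0 < exp a <= 2) by (split; [apply exp_pos|nra]).
  assert (X1 : Rabs (exp a * cos b + - (1) + - a) <= 2 * a ^ 2 + b ^ 2).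
  { replace (exp a * cos b + - (1) + - a) with ((exp a - 1 - a) - exp a * (1 - cos b)) by ring.
    assert (0 <= exp a * (1 - cos b) <= 2 * (b ^ 2 / 2)) by (split; [apply Rmult_le_pos | apply Rmult_le_compat]; lra).
    apply Rabs_le; lra. }
  assert (X2 : Rabs (exp a * sin b + - 0 + - b) <= 2 * b ^ 2 + 2 * a ^ 2 + 2 * b ^ 2).
  { replace (exp a * sin b + - 0 + - b) with (exp a * (sin b - b) + b * (exp a - 1)) by ring.
    assert (Y1 : - (2 * b ^ 2) <= exp a * (sin b - b) <= 2 * b ^ 2).
    { apply Rabs_le_between. rewrite Rabs_mult, (Rabs_pos_eq (exp a)) by lra.
      apply Rmult_le_compat; try lra; [apply Rabs_pos | apply Rabs_le; lra]. }
    assert (Rabs (b * (exp a - 1)) <= 2 * a ^ 2 + 2 * b ^ 2).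
    { rewrite Rabs_mult. assert (Rabs (exp a - 1) <= 2 * Rabs a).
      { destruct (Rle_lt_dec 0 a).
        - rewrite !Rabs_pos_eq by lra. nra.
        - rewrite (Rabs_left a) by lra. apply Rabs_le; nra. }
      pose proof (Rabs_pos a); pose proof (Rabs_pos b). rewrite <- (pow2_abs a), <- (pow2_abs b).
      apply Rle_trans with (Rabs b * (2 * Rabs a)); [apply Rmult_le_compat_l; lra|].
      pose proof (pow2_ge_0 (Rabs a - Rabs b)). nra. }
    apply Rabs_le_between in H0. apply Rabs_le; lra. }
  nra.
Qed.

Lemma Cmod_sq_le (z : C) (r : R) : 0 <= r -> r ^ 2 <= fst z ^ 2 + snd z ^ 2 -> r <= Cmod z.
Proof.
  intros H E. unfold Cmod. rewrite <- (sqrt_Rsqr r) by auto. apply sqrt_le_1_alt. unfold Rsqr. nra.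
Qed.

Lemma nome_pair (x y : R) :
  nome (x, y) = (exp (- (2 * PI * y)) * cos (2 * PI * x), exp (- (2 * PI * y)) * sin (2 * PI * x)).
Proof.
  unfold nome, Cexp, Re, Im; apply C_ext; unfold Re, Im; simpl; f_equal; f_equal; ring.
Qed.

(** With r = |q| one has |1 - q|^2 = (1 - r)^2 + 4 r sin^2 (PI x); the first square controls y, the
    second x. This linear lower bound near the pole yields the summable majorant for the kernels. *)
Lemma one_minus_nome_ge (x y Y : R) : Rabs x <= / 2 -> 0 <= y <= Y ->
  exp (- (2 * PI * Y)) * Cmod (x, y) <= Cmod (1 - nome (x, y)).
Proof.
  intros Hx Hy. pose proof PI_RGT_0 as HPI. pose proof PI_4. pose proof PI2_1.
  set (rho := exp (- (2 * PI * Y))). set (r := exp (- (2 * PI * y))).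
  assert (Hr : rho <= r) by (apply exp_monotone; nra).
  assert (Hp : 0 < rho) by apply exp_pos.
  assert (Hr1 : r <= 1) by (unfold r; rewrite <- exp_0; apply exp_monotone; nra).
  assert (H1r : rho * y <= 1 - r).
  { pose proof (exp_ineq1_le (2 * PI * y)) as E. assert (r * exp (2 * PI * y) = 1).
    { unfold r. rewrite <- exp_plus, <- exp_0. f_equal; ring. }
    assert (r * (1 + 2 * PI * y) <= 1) by (rewrite <- H1; apply Rmult_le_compat_l; lra).
    assert (0 <= r * y) by (apply Rmult_le_pos; lra).
    assert (rho * y <= r * y) by (apply Rmult_le_compat_r; lra). nra. }
  assert (Hs : x ^ 2 <= sin (PI * x) ^ 2).
  (* For 0 <= s <= 2 the cubic bound gives sin s >= s / 3, and s = PI t is at least 3 t. *)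
  { assert (G : forall t, 0 <= t <= / 2 -> t <= sin (PI * t)).
    { intros t Ht. pose proof (sin_ge_cubic (PI * t)) as P.
      assert (0 <= PI * t <= 2) by nra. specialize (P ltac:(lra)).
      assert (3 * t <= PI * t) by (pose proof PI2_3_2; apply Rmult_le_compat_r; lra).
      set (s := PI * t) in *. clearbody s.
      assert (0 <= s * ((2 - s) * (2 + s))) by (repeat apply Rmult_le_pos; lra).
      assert (s ^ 3 <= 4 * s) by (replace (s ^ 3) with (4 * s - s * ((2 - s) * (2 + s))) by ring; lra).
      lra. }
    destruct (Rle_lt_dec 0 x).
    - apply pow_incr. split; auto. apply G. rewrite Rabs_pos_eq in Hx; lra.
    - rewrite Rabs_left in Hx by lra. specialize (G (- x) ltac:(lra)).
      replace (PI * - x) with (- (PI * x)) in G by ring. rewrite sin_neg in G.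
      replace (x ^ 2) with ((- x) ^ 2) by ring. replace (sin (PI * x) ^ 2) with ((- sin (PI * x)) ^ 2) by ring.
      apply pow_incr; lra. }
  apply Cmod_sq_le; [apply Rmult_le_pos; [lra | apply Cmod_ge_0]|].
  rewrite Rpow_mult_distr, Cmod2_alt, nome_pair. simpl Re; simpl Im. fold r.
  replace (2 * PI * x) with (2 * (PI * x)) by ring.
  match goal with |- _ <= ?lhs => assert (E : lhs = (1 - r) ^ 2 + 4 * r * sin (PI * x) ^ 2) end.
  { simpl. pose proof (sin2_cos2 (2 * (PI * x))) as Q. unfold Rsqr in Q.
    pose proof (cos_2a_sin (PI * x)) as Q2.
    set (c := cos (2 * (PI * x))) in *. set (s := sin (2 * (PI * x))) in *.
    replace (sin (PI * x) * (sin (PI * x) * 1)) with ((1 - c) / 2) by lra. nra. }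
  rewrite E.
  assert ((rho * y) ^ 2 <= (1 - r) ^ 2) by (apply pow_incr; split; [apply Rmult_le_pos; lra | auto]).
  assert (rho ^ 2 * x ^ 2 <= 4 * r * sin (PI * x) ^ 2).
  { apply Rmult_le_compat; auto; try apply pow2_ge_0. nra. }
  nra.
Qed.

(** Pairing n with -(n+1) meets every integer exactly once, and N pairs fill the window [-N, N). *)
Definition BSum (f : Z -> C) : C := CSeries (fun n => f (Z.of_nat n) + f (- Z.of_nat (S n))%Z)%C.

Definition babs (f : Z -> C) : Prop :=
  cabs (fun n => f (Z.of_nat n)) /\ cabs (fun n => f (- Z.of_nat (S n))%Z).

Lemma BSum_ext f g : (forall n, f n = g n) -> BSum f = BSum g.
Proof. intros E. apply CSeries_ext. intros n; rewrite !E; auto. Qed.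

Lemma babs_ext f g : (forall n, f n = g n) -> babs f -> babs g.
Proof. intros E [H1 H2]; split; [apply (cabs_ext _ _ (fun n => E _) H1) | apply (cabs_ext _ _ (fun n => E _) H2)]. Qed.

Lemma BSum_split f : babs f ->
  BSum f = (CSeries (fun n => f (Z.of_nat n)) + CSeries (fun n => f (- Z.of_nat (S n))%Z))%C.
Proof. intros [H1 H2]. apply CSeries_plus; auto. Qed.

Lemma BSum_scal (c : C) f : babs f -> BSum (fun n => c * f n)%C = (c * BSum f)%C.
Proof.
  intros [H1 H2]. unfold BSum. rewrite <- CSeries_scal by (apply cabs_plus; auto).
  apply CSeries_ext; intros; ring.
Qed.

Lemma babs_scal (c : C) f : babs f -> babs (fun n => c * f n)%C.
Proof. intros [H1 H2]; split; apply (cabs_scal c); auto. Qed.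

Lemma babs_flip f : babs f -> babs (fun n => f (- n)%Z).
Proof.
  intros [H1 H2]. split.
  - apply cabs_decr_1. exact H2.
  - apply (cabs_incr_n _ 1) in H1. eapply cabs_ext; [|exact H1]. intros n; simpl; f_equal.
Qed.

Lemma BSum_flip f : babs f -> BSum (fun n => f (- n)%Z) = BSum f.
Proof.
  intros H. pose proof (babs_flip f H) as H'. rewrite !BSum_split by auto.
  destruct H as [H1 H2]; destruct H' as [H3 H4].
  rewrite (CSeries_incr_1 _ H3), (CSeries_incr_1 _ H1). simpl. ring.
Qed.

Lemma babs_shift_1 f : babs f -> babs (fun n => f (n + 1)%Z).
Proof.
  intros [H1 H2]. split.
  - apply (cabs_incr_n _ 1) in H1. eapply cabs_ext; [|exact H1]. intros n. cbv beta. f_equal; lia.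
  - apply cabs_decr_1. eapply cabs_ext; [|exact H2]. intros n. cbv beta. f_equal; lia.
Qed.

Lemma BSum_shift_1 f : babs f -> BSum (fun n => f (n + 1)%Z) = BSum f.
Proof.
  intros H. pose proof (babs_shift_1 f H) as H'. rewrite !BSum_split by auto.
  destruct H as [H1 H2]; destruct H' as [H3 H4].
  rewrite (CSeries_incr_1 _ H4), (CSeries_incr_1 _ H1).
  rewrite (CSeries_ext (fun n => f (Z.of_nat n + 1)%Z) (fun n => f (Z.of_nat (S n)))) by (intros; f_equal; lia).
  rewrite (CSeries_ext (fun n => f (- Z.of_nat (S (S n)) + 1)%Z) (fun n => f (- Z.of_nat (S n))%Z)) by (intros; f_equal; lia).
  simpl. ring.
Qed.

(** Shifts by one are iterated; a negative shift is a positive one conjugated by n -> -n. *)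
Lemma BSum_shift f (m : Z) : babs f -> babs (fun n => f (n + m)%Z) /\ BSum (fun n => f (n + m)%Z) = BSum f.
Proof.
  assert (P : forall (k : nat) f, babs f ->
    babs (fun n => f (n + Z.of_nat k)%Z) /\ BSum (fun n => f (n + Z.of_nat k)%Z) = BSum f).
  { induction k; intros g Hg.
    - simpl. split; [eapply babs_ext; [|exact Hg] | apply BSum_ext]; intros; cbv beta; f_equal; lia.
    - destruct (IHk g Hg) as [A B]. pose proof (babs_shift_1 _ A) as A'. pose proof (BSum_shift_1 _ A) as B'.
      cbv beta in *. rewrite <- B, <- B'.
      split; [eapply babs_ext; [|exact A'] | apply BSum_ext]; intros; cbv beta; f_equal; lia. }
  intros H. destruct (Z_le_gt_dec 0 m).
  - specialize (P (Z.to_nat m) f H). rewrite Z2Nat.id in P; auto.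
  - pose proof (babs_flip _ H) as H'. specialize (P (Z.to_nat (- m)) _ H'). rewrite Z2Nat.id in P by lia.
    destruct P as [A B]. rewrite BSum_flip in B by auto. rewrite <- B.
    pose proof (babs_flip _ A) as A'. pose proof (BSum_flip _ A) as B'. cbv beta in *. rewrite <- B'.
    split; [eapply babs_ext; [|exact A'] | apply BSum_ext]; intros; cbv beta; f_equal; lia.
Qed.

(** * Partial fractions of the kernels *)

Lemma csum_rev f n : csum f n = csum (fun j => f (n - 1 - j)%nat) n.
Proof.
  induction n; [reflexivity|].
  change (csum f n + f n = csum (fun j => f (S n - 1 - j)%nat) (S n))%C.
  rewrite csum_incr_1, IHn, Cplus_comm. f_equal.
  - f_equal; lia.
  - apply csum_ext. intros; f_equal; lia.
Qed.

Lemma ex_series_zero (u : nat -> R) : (forall n, u n = 0) -> ex_series u.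
Proof.
  intros H. assert (G : ex_series (fun n => 0 * (/ 2) ^ n)).
  { apply ex_series_Rscal, ex_series_geom. rewrite Rabs_pos_eq; lra. }
  eapply ex_series_ext; [|exact G]. intros n; rewrite H; apply Rmult_0_l.
Qed.

(** Finite sums of growing length become series extended by zero, the form to which
    [CSeries_dominated] applies. *)
Lemma CSeries_finite f n :
  CSeries (fun j => if (j <? n)%nat then f j else 0) = csum f n.
Proof.
  assert (Z : forall k, (if (n + k <? n)%nat then f (n + k)%nat else RtoC 0) = 0).
  { intros k. destruct (Nat.ltb_spec (n + k) n); [lia | reflexivity]. }
  rewrite (CSeries_incr_n _ n).
  - rewrite (CSeries_ext _ _ Z).
    replace (CSeries (fun _ => RtoC 0)) with (RtoC 0)
      by (unfold CSeries; rewrite !Series_zero; auto).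
    rewrite Cplus_0_r. apply csum_ext. intros k Hk. destruct (Nat.ltb_spec k n); [reflexivity | lia].
  - apply (ex_series_incr_n (fun k => Cmod (if (k <? n)%nat then f k else RtoC 0)) n).
    apply ex_series_zero. intros k. rewrite Z. apply Cmod_0.
Qed.

(** Comparison with the telescoping series of 2 (1/(j+1) - 1/(j+2)). *)
Lemma ex_series_inv_sq : ex_series (fun j => / (INR j + 1) ^ 2).
Proof.
  apply ex_series_le_nonneg with (b := fun j => 2 * (/ (INR j + 1) - / (INR j + 2))).
  - intros n. pose proof (pos_INR n). split.
    + left; apply Rinv_0_lt_compat. apply pow_lt; lra.
    + apply Rmult_le_reg_r with ((INR n + 1) ^ 2 * (INR n + 2)); [apply Rmult_lt_0_compat; [apply pow_lt|]; lra|].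
      field_simplify; [nra| lra | lra].
  - apply ex_series_Rscal. exists 1. 
    apply (filterlim_ext (fun n => 1 - / (INR n + 2))).
    + intros n. induction n.
      * rewrite sum_O. simpl. field.
      * rewrite sum_Sn, <- IHn, S_INR. unfold plus; simpl. pose proof (pos_INR n). field. lra.
    + change (is_lim_seq (fun n => 1 - / (INR n + 2)) 1).
      replace (Finite 1) with (Finite (1 - 0)) by (f_equal; ring).
      apply is_lim_seq_minus'; [apply is_lim_seq_const|].
      replace (Finite 0) with (Rbar_inv p_infty) by reflexivity.
      apply is_lim_seq_inv; [|discriminate].
      eapply is_lim_seq_plus; [apply is_lim_seq_INR | apply is_lim_seq_const | reflexivity].
Qed.

Lemma Cmod_inv_pow_le (z : C) (c t : R) (k : nat) : (2 <= k)%nat -> 0 < c -> 1 <= t ->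
  c * t <= Cmod z -> Cmod (/ z ^ k) <= / c ^ k * / t ^ 2.
Proof.
  intros Hk Hc Ht H. assert (0 < c * t) by (apply Rmult_lt_0_compat; lra).
  assert (z <> 0) by (intros E; subst; rewrite Cmod_0 in H; lra).
  rewrite Cmod_inv by (apply Cpow_nz; auto). rewrite Cmod_pow, <- Rinv_mult.
  assert (0 < c ^ k) by (apply pow_lt; auto). assert (0 < t ^ 2) by (apply pow_lt; lra).
  apply Rinv_le_contravar; [apply Rmult_lt_0_compat; auto|].
  apply Rle_trans with ((c * t) ^ k); [|apply pow_incr; lra].
  rewrite Rpow_mult_distr. apply Rmult_le_compat_l; [lra|]. apply Rle_pow; lia || lra.
Qed.

Lemma babs_inv_pow (z : C) (c : R) (k : nat) : (2 <= k)%nat -> 0 < c ->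
  (forall n : Z, c * (1 + Rabs (IZR n)) <= Cmod (z + IZR n)) ->
  babs (fun n => / (z + IZR n) ^ k)%C.
Proof.
  intros Hk Hc H.
  assert (G : forall m j, Rabs (IZR m) = INR j \/ Rabs (IZR m) = INR j + 1 ->
    Cmod (/ (z + IZR m) ^ k) <= / c ^ k * / (INR j + 1) ^ 2).
  { intros m j E. pose proof (pos_INR j). apply Cmod_inv_pow_le; auto; try lra.
    eapply Rle_trans; [|apply H]. apply Rmult_le_compat_l; lra. }
  split; apply cabs_le with (u := fun j => / c ^ k * / (INR j + 1) ^ 2);
    try apply ex_series_Rscal, ex_series_inv_sq; intros j; apply G; pose proof (pos_INR j).
  - left. rewrite <- INR_IZR_INZ. apply Rabs_pos_eq; auto.
  - right. rewrite opp_IZR, Rabs_Ropp, <- INR_IZR_INZ, S_INR. apply Rabs_pos_eq; lra.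
Qed.

Lemma Rabs_IZR_ge_1 (n : Z) : n <> 0%Z -> 1 <= Rabs (IZR n).
Proof. intros H. rewrite <- abs_IZR. apply IZR_le. lia. Qed.

(** For n other than 0 and -1 the real part alone gives the constant 1/3, attained as a bound at n =
    -2; the two exceptional translates are non-zero and enter through the minimum, the second halved
    because 1 + |-1| = 2. *)
Lemma Cmod_add_Z_ge (z : C) : 0 <= Re z <= 1 -> (forall n : Z, (z + IZR n)%C <> 0) ->
  exists c, 0 < c /\ forall n : Z, c * (1 + Rabs (IZR n)) <= Cmod (z + IZR n).
Proof.
  intros Hx Hz. set (c := Rmin (/ 3) (Rmin (Cmod z) (Cmod (z + IZR (-1)) / 2))).
  assert (Hc1 : c <= / 3) by apply Rmin_l.
  assert (Hc2 : c <= Cmod z) by (eapply Rle_trans; [apply Rmin_r | apply Rmin_l]).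
  assert (Hc3 : c <= Cmod (z + IZR (-1)) / 2) by (eapply Rle_trans; [apply Rmin_r | apply Rmin_r]).
  exists c. split.
  { unfold c. apply Rmin_glb_lt; [lra|]. apply Rmin_glb_lt.
    - apply Cmod_gt_0. intros E. apply (Hz 0%Z). rewrite E; ring.
    - pose proof (proj1 (Cmod_gt_0 (z + IZR (-1))) (Hz _)). lra. }
  intros n. destruct (Z.eq_dec n 0) as [->|N0].
  { rewrite Rabs_R0, Cplus_0_r. lra. }
  destruct (Z.eq_dec n (-1)) as [->|N1].
  { replace (Rabs (-1)) with 1 by (rewrite Rabs_left; lra). lra. }
  apply Rle_trans with (Rabs (Re z + IZR n)).
  2: { apply (Rle_trans _ _ _ (Req_le _ _ eq_refl) (Rabs_Re_le (z + IZR n))). }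
  destruct (Z_lt_le_dec 0 n) as [h|h].
  - assert (1 <= IZR n) by (apply IZR_le; lia). rewrite !Rabs_pos_eq by lra. nra.
  - assert (IZR n <= -2) by (apply IZR_le; lia). rewrite !Rabs_left by lra. nra.
Qed.

Lemma babs_inv_pow_shift (z : C) (k : nat) : (2 <= k)%nat -> (forall n : Z, (z + IZR n)%C <> 0) ->
  babs (fun n => / (z + IZR n) ^ k)%C.
Proof.
  intros Hk Hz. set (m := up (Re z)). destruct (archimed (Re z)) as [A1 A2]. fold m in A1, A2.
  set (z0 := (z + IZR (1 - m))%C).
  assert (H0 : forall n, (z0 + IZR n = z + IZR (n + (1 - m)))%C).
  { intros n. unfold z0. rewrite plus_IZR, RtoC_plus. ring. }
  destruct (Cmod_add_Z_ge z0) as [c [Hc Hb]].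
  - unfold z0, Re, Cplus, RtoC. cbn [fst snd]. rewrite minus_IZR. unfold Re in *. lra.
  - intros n. rewrite H0. apply Hz.
  - pose proof (babs_inv_pow z0 c k Hk Hc Hb) as B.
    apply (BSum_shift _ (m - 1)) in B. destruct B as [B _].
    eapply babs_ext; [|exact B]. intros n. cbv beta. rewrite H0. do 5 f_equal. lia.
Qed.

(** The numerator stays abstract so that weights 4 and 6 share one partial fraction argument. *)
Definition kernel (P : C -> C) (k : nat) (q : C) : C := (P q / (1 - q) ^ k)%C.

Lemma nome_pow2_ne_1 (z : C) (j n : nat) : nome z <> 1 -> nome ((z + INR j) / 2 ^ n) <> 1.
Proof.
  intros H E. apply H.
  assert (T : ((2:C) ^ n)%C <> 0) by (apply Cpow_nz, C2_nz).
  transitivity (nome (z + IZR (Z.of_nat j))); [symmetry; apply nome_add_Z|].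
  rewrite <- INR_IZR_INZ.
  replace (z + INR j)%C with (INR (2 ^ n) * ((z + INR j) / 2 ^ n))%C.
  - rewrite nome_INR_mult, E. apply Cpow_1_l.
  - rewrite pow_INR. replace (INR 2) with 2 by (simpl; ring). rewrite RtoC_pow. field. auto.
Qed.

(** The arguments on the left are the 2^n-th roots of q. In the induction the indices j and j + 2^n
    differ by 1/2 in z, hence by a sign in q, and the duplication formula merges them. *)
Lemma kernel_distribution (P : C -> C) (k : nat) :
  (forall q, (q ^ 2)%C <> 1 -> (kernel P k q + kernel P k (- q))%C = (2 ^ k * kernel P k (q ^ 2))%C) ->
  forall z n, nome z <> 1 ->
  csum (fun j => kernel P k (nome ((z + INR j) / 2 ^ n))) (2 ^ n) = ((2 ^ k) ^ n * kernel P k (nome z))%C.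
Proof.
  intros Hd z n Hz. induction n.
  - simpl. rewrite !Cplus_0_l, Cmult_1_l. do 2 f_equal. field. 
  - assert (T : ((2:C) ^ n)%C <> 0) by (apply Cpow_nz, C2_nz).
    replace (2 ^ S n)%nat with (2 ^ n + 2 ^ n)%nat by (simpl; lia).
    rewrite csum_split, <- csum_plus.
    transitivity (csum (fun j => 2 ^ k * kernel P k (nome ((z + INR j) / 2 ^ n)))%C (2 ^ n)).
    + apply csum_ext. intros j Hj.
      assert (E2 : nome ((z + INR j) / 2 ^ n) = (nome ((z + INR j) / 2 ^ S n) ^ 2)%C).
      { rewrite <- nome_INR_mult. f_equal. replace (INR 2) with 2 by (simpl; ring).
        simpl. field. auto. }
      rewrite E2. rewrite <- Hd by (rewrite <- E2; apply nome_pow2_ne_1; auto).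
      f_equal. f_equal. rewrite plus_INR, pow_INR. replace (INR 2) with 2 by (simpl; ring).
      rewrite RtoC_plus, RtoC_pow.
      replace ((z + (2 ^ n + INR j)) / 2 ^ S n)%C with ((z + INR j) / 2 ^ S n + / 2)%C
        by (simpl; field; auto).
      rewrite nome_plus, nome_half. ring.
    + rewrite csum_scal, IHn. simpl. ring.
Qed.

Lemma INR_pow2 n : INR (2 ^ n) = 2 ^ n.
Proof. rewrite pow_INR. reflexivity. Qed.

Lemma is_lim_seq_inv_pow2 : is_lim_seq (fun n => (/ 2) ^ n) 0.
Proof. apply is_lim_seq_geom. rewrite Rabs_pos_eq; lra. Qed.

Lemma Cinv_pow2 n : (/ 2 ^ n)%C = RtoC ((/ 2) ^ n).
Proof. rewrite RtoC_pow, RtoC_inv, Cpow_inv; auto. apply C2_nz. Qed.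

Lemma Cexp_difference_quotient (h : C) :
  clim (fun n => 2 ^ n * (1 - Cexp (h / 2 ^ n)))%C (- h)%C.
Proof.
  assert (H0 : is_lim_seq (fun n => 10 * Cmod h ^ 2 * (/ 2) ^ n) 0).
  { replace (Finite 0) with (Finite (10 * Cmod h ^ 2 * 0)) by (f_equal; ring).
    apply is_lim_seq_mult'; [apply is_lim_seq_const | apply is_lim_seq_inv_pow2]. }
  assert (H1 : is_lim_seq (fun n => Cmod h * (/ 2) ^ n) 0).
  { replace (Finite 0) with (Finite (Cmod h * 0)) by (f_equal; ring).
    apply is_lim_seq_mult'; [apply is_lim_seq_const | apply is_lim_seq_inv_pow2]. }
  apply is_lim_seq_spec in H1. destruct (H1 (mkposreal (/ 2) ltac:(lra))) as [N HN]. cbn [pos] in HN.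
  apply clim_of_eps. intros eps He. apply is_lim_seq_spec in H0.
  destruct (H0 (mkposreal _ He)) as [N' HN']. cbn [pos] in HN'.
  exists (max N N'). intros n Hn. specialize (HN n ltac:(lia)). specialize (HN' n ltac:(lia)).
  assert (T : ((2:C) ^ n)%C <> 0) by (apply Cpow_nz, C2_nz).
  assert (P2 : 0 < (/ 2) ^ n) by (apply pow_lt; lra).
  assert (M : Cmod (h / 2 ^ n) = Cmod h * (/ 2) ^ n).
  { unfold Cdiv. rewrite Cinv_pow2, Cmod_mult, Cmod_RtoC_nonneg; lra. }
  rewrite Rminus_0_r in HN, HN'.
  pose proof (Cexp_minus_affine_le (h / 2 ^ n)) as E.
  assert (Cmod (h / 2 ^ n) <= / 2) by (rewrite M; pose proof (Rle_abs (Cmod h * (/ 2) ^ n)); lra).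
  specialize (E H). rewrite M in E.
  replace (2 ^ n * (1 - Cexp (h / 2 ^ n)) - - h)%C
    with (- (2 ^ n * (Cexp (h / 2 ^ n) - 1 - h / 2 ^ n)))%C by (field; auto).
  rewrite Cmod_opp, Cmod_mult, Cmod_pow, Cmod_RtoC_nonneg by lra.
  apply Rle_trans with (10 * Cmod h ^ 2 * (/ 2) ^ n); [|pose proof (Rle_abs (10 * Cmod h ^ 2 * (/ 2) ^ n)); lra].
  apply Rle_trans with (2 ^ n * (10 * (Cmod h * (/ 2) ^ n) ^ 2)).
  - apply Rmult_le_compat_l; [left; apply pow_lt; lra | auto].
  - apply Req_le. rewrite Rpow_mult_distr. replace (2 ^ n) with (/ (/ 2) ^ n); [field; lra|].
    rewrite <- pow_inv. f_equal; lra.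
Qed.

(** Since 1 - nome(z / 2^n) is asymptotic to -2 PI i z / 2^n, the pole of order k compensates the
    factor 2^(-kn). *)
Lemma kernel_limit (P : C -> C) (k : nat) (z : C) :
  (forall x, clim x 1 -> clim (fun n => P (x n)) (P 1)) -> z <> 0 ->
  clim (fun n => / (2 ^ k) ^ n * kernel P k (nome (z / 2 ^ n)))%C
       (P 1 / (- (2 * PI * Ci * z)) ^ k)%C.
Proof.
  intros HP Hz.
  assert (L : (- (2 * PI * Ci * z))%C <> 0).
  { intros E. apply Hz. apply Cmult_eq_reg_l with (- (2 * PI * Ci))%C.
    - intros F. apply (f_equal Im) in F. simpl in F. pose proof PI_RGT_0. lra.
    - rewrite Cmult_0_r, <- E. ring. }
  pose proof (Cexp_difference_quotient (2 * PI * Ci * z)) as D.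
  apply clim_ext with (x := fun n => (P (nome (z / 2 ^ n)) * / (2 ^ n * (1 - Cexp (2 * PI * Ci * z / 2 ^ n))) ^ k)%C).
  { intros n. unfold kernel, nome.
    replace (2 * PI * Ci * (z / 2 ^ n))%C with (2 * PI * Ci * z / 2 ^ n)%C by (unfold Cdiv; ring).
    set (e := Cexp _). rewrite Cpow_mult_l, <- !Cpow_mult_r, (Nat.mul_comm n k).
    unfold Cdiv. rewrite Cinv_mul. ring. }
  unfold Cdiv. apply clim_mult.
  - apply HP. unfold nome.
    apply clim_ext with (x := fun n => (1 - RtoC ((/ 2) ^ n) * (2 ^ n * (1 - Cexp (2 * PI * Ci * z / 2 ^ n))))%C).
    + intros n. rewrite <- Cinv_pow2.
      replace (2 * PI * Ci * (z * / 2 ^ n))%C with (2 * PI * Ci * z / 2 ^ n)%C by (unfold Cdiv; ring).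
      field. apply Cpow_nz, C2_nz.
    + assert (G : clim (fun n => 1 + - 1 * (RtoC ((/ 2) ^ n) * (2 ^ n * (1 - Cexp (2 * PI * Ci * z / 2 ^ n)))))%C
                       (1 + - 1 * (0 * - (2 * PI * Ci * z)))%C).
      { apply clim_plus; [apply clim_const|]. apply clim_scal. apply clim_mult; [|exact D].
        split; simpl; [apply is_lim_seq_inv_pow2 | apply is_lim_seq_const]. }
      replace (1 + - 1 * (0 * - (2 * PI * Ci * z)))%C with (RtoC 1) in G by ring.
      eapply clim_ext; [|exact G]. intros; cbv beta; ring.
  - apply clim_inv; [apply Cpow_nz; auto|]. apply clim_pow, D.
Qed.

(** A translation by 0 or -1 brings Re z into [-1/2, 1/2], where [one_minus_nome_ge] excludes q =
    1. *)
Lemma nome_ne_1 (z : C) : 0 <= Im z -> (forall n : Z, (z + IZR n)%C <> 0) ->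
  0 <= Re z <= 1 -> nome z <> 1.
Proof.
  intros Hy Hz Hx.
  assert (G : forall n : Z, Rabs (Re z + IZR n) <= / 2 -> nome z <> 1).
  { intros n Hn E. rewrite <- (nome_add_Z z n) in E.
    pose proof (one_minus_nome_ge (Re z + IZR n) (Im z) (Im z) Hn ltac:(lra)) as L.
    replace ((Re z + IZR n, Im z) : C) with (z + IZR n)%C in L
      by (apply C_ext; unfold Re, Im; simpl; ring).
    rewrite E in L. replace (1 - 1)%C with (RtoC 0) in L by ring. rewrite Cmod_0 in L.
    pose proof (proj1 (Cmod_gt_0 _) (Hz n)). pose proof (exp_pos (- (2 * PI * Im z))). nra. }
  destruct (Rle_lt_dec (Re z) (/ 2)).
  - apply (G 0%Z). rewrite Rabs_pos_eq; lra.
  - apply (G (-1)%Z). rewrite Rabs_left1; lra.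
Qed.

(** [one_minus_nome_ge] at w = (z + n) / 2^N costs only the factor exp (-2 PI Y), and 2^N |w| = |z +
    n|; the resulting bound is independent of N, as dominated convergence demands. *)
Lemma kernel_term_bound (P : C -> C) (k N : nat) (B c Y : R) (z : C) (n : Z) (t : R) :
  (2 <= k)%nat -> (forall q, Cmod q <= 1 -> Cmod (P q) <= B) -> 0 < c -> 1 <= t ->
  0 <= Im z <= Y -> Rabs (Re z + IZR n) <= / 2 * 2 ^ N -> c * t <= Cmod (z + IZR n) ->
  Cmod (/ (2 ^ k) ^ N * kernel P k (nome ((z + IZR n) / 2 ^ N))) <=
  B * (/ (exp (- (2 * PI * Y)) * c) ^ k * / t ^ 2).
Proof.
  intros Hk HB Hc Ht Hy Hx Hct.
  assert (T : ((2:C) ^ N)%C <> 0) by (apply Cpow_nz, C2_nz).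
  assert (T2 : 1 <= 2 ^ N) by (apply pow_R1_Rle; lra).
  set (w := ((z + IZR n) / 2 ^ N)%C).
  assert (Ew : w = ((Re z + IZR n) * / 2 ^ N, Im z * / 2 ^ N)).
  { unfold w, Cdiv. rewrite Cinv_pow2, pow_inv. apply C_ext; unfold Re, Im; simpl; ring. }
  assert (Hi : 0 < / 2 ^ N <= 1).
  { split; [apply Rinv_0_lt_compat; lra|]. rewrite <- Rinv_1. apply Rinv_le_contravar; lra. }
  assert (Hwx : Rabs ((Re z + IZR n) * / 2 ^ N) <= / 2).
  { rewrite Rabs_mult, (Rabs_pos_eq (/ _)) by lra.
    apply Rmult_le_reg_r with (2 ^ N); [lra|]. rewrite Rmult_assoc, Rinv_l by lra. lra. }
  assert (Hwy : 0 <= Im z * / 2 ^ N <= Y).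
  { split; [apply Rmult_le_pos; lra|]. apply Rle_trans with (Im z * 1); [apply Rmult_le_compat_l|]; lra. }
  pose proof (one_minus_nome_ge _ _ _ Hwx Hwy) as L. rewrite <- Ew in L.
  assert (Hn : Cmod (nome w) <= 1).
  { apply Cmod_nome_le_1. rewrite Ew. apply Hwy. }
  unfold kernel. unfold Cdiv at 1.
  replace (/ (2 ^ k) ^ N * (P (nome w) * / (1 - nome w) ^ k))%C
    with (P (nome w) * / (2 ^ N * (1 - nome w)) ^ k)%C.
  2: { rewrite Cpow_mult_l, <- !Cpow_mult_r, (Nat.mul_comm N k), Cinv_mul. ring. }
  rewrite Cmod_mult. apply Rmult_le_compat; auto using Cmod_ge_0.
  apply Cmod_inv_pow_le; auto.
  - apply Rmult_lt_0_compat; [apply exp_pos | auto].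
  - rewrite Cmod_mult, Cmod_pow, Cmod_RtoC_nonneg by lra.
    assert (M : Cmod w * 2 ^ N = Cmod (z + IZR n)).
    { rewrite <- (Cmod_RtoC_nonneg 2), <- Cmod_pow, <- Cmod_mult by lra. f_equal. unfold w. field. auto. }
    pose proof (exp_pos (- (2 * PI * Y))) as Hr. set (r := exp _) in *.
    apply Rle_trans with (2 ^ N * (r * Cmod w)); [|apply Rmult_le_compat_l; lra].
    replace (2 ^ N * (r * Cmod w)) with (r * (Cmod w * 2 ^ N)) by ring.
    rewrite M, Rmult_assoc. apply Rmult_le_compat_l; lra.
Qed.

(* The distribution relation of the kernel, written over the window of integers
   [-2^N, 2^N), tends to the bilateral series by dominated convergence. *)
Lemma kernel_partial_fractions (P : C -> C) (k : nat) (B : R) : (2 <= k)%nat ->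
  (forall q, (q ^ 2)%C <> 1 -> (kernel P k q + kernel P k (- q))%C = (2 ^ k * kernel P k (q ^ 2))%C) ->
  (forall q, Cmod q <= 1 -> Cmod (P q) <= B) ->
  (forall x, clim x 1 -> clim (fun n => P (x n)) (P 1)) ->
  forall z, 0 <= Im z -> (forall n : Z, (z + IZR n)%C <> 0) -> 0 <= Re z <= 1 ->
  kernel P k (nome z) = (P 1 / (- (2 * PI * Ci)) ^ k * BSum (fun n => / (z + IZR n) ^ k))%C.
Proof.
  intros Hk Hd HB HP z Hy Hz Hx.
  destruct (Cmod_add_Z_ge z Hx Hz) as [c [Hc Hcz]].
  pose proof (nome_ne_1 z Hy Hz Hx) as Hne.
  pose proof (babs_inv_pow z c k Hk Hc Hcz) as Hb.
  (* The level is [S N] because the window [-2^N, 2^N) has 2^(N+1) points. *)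
  set (T := fun N (n : Z) => (/ (2 ^ k) ^ S N * kernel P k (nome ((z + IZR n) / 2 ^ S N)))%C).
  set (a := fun N j => if (j <? 2 ^ N)%nat then (T N (Z.of_nat j) + T N (- Z.of_nat (S j))%Z)%C else 0).
  assert (H2k : forall N, (((2:C) ^ k) ^ S N)%C <> 0) by (intros; apply Cpow_nz, Cpow_nz, C2_nz).
  assert (Ea : forall N, CSeries (a N) = kernel P k (nome z)).
  { intros N. unfold a. rewrite (CSeries_finite (fun j => T N (Z.of_nat j) + T N (- Z.of_nat (S j))%Z)%C).
    pose proof (kernel_distribution P k Hd z (S N) Hne) as D.
    replace (2 ^ S N)%nat with (2 ^ N + 2 ^ N)%nat in D by (simpl; lia).
    (* The upper half of the indices is read backwards: 2^(N+1) - (j+1) stands for -(j+1), the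
       partner of j in [BSum]. *)
    rewrite csum_split in D. rewrite (csum_rev (fun j => kernel P k (nome ((z + INR (2 ^ N + j)) / 2 ^ S N)))) in D.
    rewrite <- csum_plus in D.
    apply Cmult_eq_reg_l with ((2 ^ k) ^ S N)%C; auto. rewrite <- D, <- csum_scal.
    apply csum_ext. intros j Hj. unfold T.
    transitivity (kernel P k (nome ((z + IZR (Z.of_nat j)) / 2 ^ S N)) +
                  kernel P k (nome ((z + IZR (- Z.of_nat (S j))) / 2 ^ S N)))%C.
    { field. auto. }
    rewrite <- INR_IZR_INZ. do 2 f_equal.
    (* Adding 1 to the argument adds 2^(N+1) to the index. *)
    rewrite <- nome_add_1. f_equal.
    rewrite opp_IZR, <- INR_IZR_INZ.
    assert (T2 : ((2:C) ^ S N)%C <> 0) by (apply Cpow_nz, C2_nz).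
    replace (INR (2 ^ N + (2 ^ N - 1 - j))) with (2 * 2 ^ N - INR (S j)).
    - replace (RtoC (2 * 2 ^ N - INR (S j))) with (2 ^ S N - INR (S j))%C.
      + rewrite RtoC_opp. field. auto.
      + rewrite RtoC_minus, RtoC_mult, RtoC_pow. reflexivity.
    - rewrite plus_INR, <- Nat.sub_add_distr, minus_INR by lia. rewrite INR_pow2.
      replace (1 + j)%nat with (S j) by lia. ring. }
  assert (Hrho := exp_pos (- (2 * PI * Im z))). set (rho := exp (- (2 * PI * Im z))) in *.
  assert (HB0 : 0 <= B) by (eapply Rle_trans; [apply Cmod_ge_0 | apply (HB 0); rewrite Cmod_0; lra]).
  assert (L : clim (fun N => CSeries (a N))
    (CSeries (fun j => P 1 / (- (2 * PI * Ci)) ^ k * (/ (z + IZR (Z.of_nat j)) ^ k + / (z + IZR (- Z.of_nat (S j))) ^ k)))%C).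
  { apply CSeries_dominated with (u := fun j => 2 * (B * / (rho * c) ^ k) * / (INR j + 1) ^ 2).
    - intros N j. pose proof (pos_INR j) as Hj.
      assert (Hu : 0 <= (B * / (rho * c) ^ k) * / (INR j + 1) ^ 2).
      { repeat apply Rmult_le_pos; auto; left; apply Rinv_0_lt_compat, pow_lt; [apply Rmult_lt_0_compat|]; lra. }
      unfold a. destruct (Nat.ltb_spec j (2 ^ N)) as [h|h]; [|rewrite Cmod_0; lra].
      assert (h' : INR (S j) <= 2 ^ N) by (rewrite <- INR_pow2; apply le_INR; lia).
      rewrite S_INR in h'.
      eapply Rle_trans; [apply Cmod_triangle|].
      replace (2 * (B * / (rho * c) ^ k) * / (INR j + 1) ^ 2)
        with (B * (/ (rho * c) ^ k * / (INR j + 1) ^ 2) + B * (/ (rho * c) ^ k * / (INR j + 1) ^ 2)) by ring.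
      apply Rplus_le_compat; unfold T, rho; apply kernel_term_bound; auto; try lra.
      + rewrite <- INR_IZR_INZ. simpl pow. rewrite Rabs_pos_eq; lra.
      + eapply Rle_trans; [|apply Hcz]. apply Rmult_le_compat_l; [lra|].
        rewrite <- INR_IZR_INZ, Rabs_pos_eq; lra.
      + rewrite opp_IZR, <- INR_IZR_INZ, S_INR. simpl pow. rewrite Rabs_left1; lra.
      + eapply Rle_trans; [|apply Hcz]. apply Rmult_le_compat_l; [lra|].
        rewrite opp_IZR, Rabs_Ropp, <- INR_IZR_INZ, S_INR, Rabs_pos_eq; lra.
    - apply ex_series_Rscal, ex_series_inv_sq.
    - intros j.
      assert (G : forall n : Z, clim (fun N => T N n) (P 1 / (- (2 * PI * Ci)) ^ k * / (z + IZR n) ^ k)%C).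
      { intros n. pose proof (kernel_limit P k (z + IZR n) HP (Hz n)) as [K1 K2].
        assert (K : clim (fun N => T N n) (P 1 / (- (2 * PI * Ci * (z + IZR n))) ^ k)%C).
        { split; [apply (is_lim_seq_incr_1 _ _) in K1 | apply (is_lim_seq_incr_1 _ _) in K2]; assumption. }
        replace (P 1 / (- (2 * PI * Ci)) ^ k * / (z + IZR n) ^ k)%C with (P 1 / (- (2 * PI * Ci * (z + IZR n))) ^ k)%C; auto.
        replace (- (2 * PI * Ci * (z + IZR n)))%C with (- (2 * PI * Ci) * (z + IZR n))%C by ring.
        rewrite Cpow_mult_l. unfold Cdiv. rewrite Cinv_mul. ring. }
      apply clim_ext_loc with (x := fun N => (T N (Z.of_nat j) + T N (- Z.of_nat (S j))%Z)%C).
      + exists j. intros N HN. unfold a. destruct (Nat.ltb_spec j (2 ^ N)) as [h|h]; auto.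
        pose proof (Nat.pow_gt_lin_r 2 N). lia.
      + rewrite Cmult_plus_distr_l. apply clim_plus; apply G. }
  assert (L' : clim (fun N => CSeries (a N)) (kernel P k (nome z))).
  { eapply clim_ext; [|apply clim_const]. intros N; cbv beta. symmetry; apply Ea. }
  rewrite (clim_unique _ _ _ L' L). unfold BSum. rewrite CSeries_scal; auto.
  destruct Hb as [B1 B2]. apply (cabs_plus _ _ B1 B2).
Qed.

(** Lipschitz's formula. Both sides are invariant under z -> z + 1, which removes the restriction on
    Re z. *)
Lemma kernel_lipschitz (P : C -> C) (k : nat) (B : R) : (2 <= k)%nat ->
  (forall q, (q ^ 2)%C <> 1 -> (kernel P k q + kernel P k (- q))%C = (2 ^ k * kernel P k (q ^ 2))%C) ->
  (forall q, Cmod q <= 1 -> Cmod (P q) <= B) ->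
  (forall x, clim x 1 -> clim (fun n => P (x n)) (P 1)) ->
  forall z, 0 <= Im z -> (forall n : Z, (z + IZR n)%C <> 0) ->
  kernel P k (nome z) = (P 1 / (- (2 * PI * Ci)) ^ k * BSum (fun n => / (z + IZR n) ^ k))%C.
Proof.
  intros Hk Hd HB HP z Hy Hz.
  set (m := up (Re z)). destruct (archimed (Re z)) as [A1 A2]. fold m in A1, A2.
  set (z0 := (z + IZR (1 - m))%C).
  assert (H0 : forall n, (z0 + IZR n = z + IZR (n + (1 - m)))%C).
  { intros n. unfold z0. rewrite plus_IZR, RtoC_plus. ring. }
  replace (nome z) with (nome z0) by apply nome_add_Z.
  rewrite (kernel_partial_fractions P k B); auto.
  - f_equal. destruct (BSum_shift _ (1 - m) (babs_inv_pow_shift z k Hk Hz)) as [_ E].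
    rewrite <- E. apply BSum_ext. intros n. rewrite H0. auto.
  - unfold z0, Im; simpl. unfold Im in Hy. lra.
  - intros n. rewrite H0. apply Hz.
  - unfold z0, Re, Cplus, RtoC. cbn [fst snd]. rewrite minus_IZR. unfold Re in *. lra.
Qed.

(** * Kernels and Lambert series *)

(** D'Alembert's ratio test requires non-zero terms, so r = 0 is treated apart. *)
Lemma ex_series_poly_geom (k : nat) (r : R) : 0 <= r < 1 ->
  ex_series (fun n => (INR n + 1) ^ k * r ^ n).
Proof.
  intros [Hr0 Hr1]. destruct Hr0 as [Hr0|<-].
  - apply ex_series_Rabs, ex_series_DAlembert with (k := r); auto.
    + intros n. pose proof (pos_INR n). apply Rmult_integral_contrapositive_currified; apply pow_nonzero; lra.
    + apply is_lim_seq_ext with (u := fun n => (1 + / (INR n + 1)) ^ k * r).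
      { intros n. pose proof (pos_INR n).
        assert (0 < (INR n + 1) ^ k) by (apply pow_lt; lra). assert (0 < r ^ n) by (apply pow_lt; lra).
        rewrite S_INR. replace (INR n + 1 + 1) with ((1 + / (INR n + 1)) * (INR n + 1)) by (field; lra).
        rewrite Rpow_mult_distr. change (r ^ S n) with (r * r ^ n).
        replace ((1 + / (INR n + 1)) ^ k * (INR n + 1) ^ k * (r * r ^ n) / ((INR n + 1) ^ k * r ^ n))
          with ((1 + / (INR n + 1)) ^ k * r) by (field; lra).
        rewrite Rabs_pos_eq; auto. apply Rmult_le_pos; [|lra]. apply pow_le.
        assert (0 < / (INR n + 1)) by (apply Rinv_0_lt_compat; lra). lra. }
      replace (Finite r) with (Finite ((1 + 0) ^ k * r)) by (f_equal; rewrite Rplus_0_r, pow1; ring).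
      assert (L : is_lim_seq (fun n => 1 + / (INR n + 1)) (1 + 0)).
      { apply is_lim_seq_plus'; [apply is_lim_seq_const|].
        replace (Finite 0) with (Rbar_inv p_infty) by reflexivity.
        apply is_lim_seq_inv; [|discriminate].
        eapply is_lim_seq_plus; [apply is_lim_seq_INR | apply is_lim_seq_const | reflexivity]. }
      apply is_lim_seq_mult'; [|apply is_lim_seq_const].
      clear - L. induction k; simpl; [apply is_lim_seq_const | apply is_lim_seq_mult'; auto].
  - apply (ex_series_incr_1 (fun n => (INR n + 1) ^ k * 0 ^ n)).
    apply ex_series_zero. intros n. simpl. ring.
Qed.

Lemma cabs_power_weighted (k : nat) (q : C) : Cmod q < 1 -> cabs (fun d => INR d ^ k * q ^ d)%C.
Proof.
  intros H. apply cabs_le with (u := fun n => (INR n + 1) ^ k * Cmod q ^ n).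
  - intros n. pose proof (pos_INR n). rewrite Cmod_mult, !Cmod_pow, Cmod_RtoC_nonneg by auto.
    apply Rmult_le_compat_r; [apply pow_le, Cmod_ge_0 | apply pow_incr; lra].
  - apply ex_series_poly_geom. split; [apply Cmod_ge_0 | auto].
Qed.

Definition power_series (k : nat) (q : C) : C := CSeries (fun d => INR d ^ k * q ^ d)%C.

Lemma power_series_0 (q : C) : Cmod q < 1 -> power_series 0 q = (/ (1 - q))%C.
Proof.
  intros H. rewrite <- CSeries_geom by auto. apply CSeries_ext. intros; simpl; ring.
Qed.

(* [c] lists the binomial coefficients: the shift d -> d + 1 turns the series
   into a linear combination of the series of smaller degree. *)
Lemma power_series_step (k : nat) (c : list R) (q : C) : Cmod q < 1 ->
  (forall x : R, (x + 1) ^ S k = Re (csum (fun i => nth i c 0 * x ^ i)%C (S (S k)))) ->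
  power_series (S k) q = (q * csum (fun i => nth i c 0 * power_series i q) (S (S k)))%C.
Proof.
  intros H Hc. unfold power_series at 1.
  pose proof (cabs_power_weighted (S k) q H) as Ha.
  rewrite (CSeries_incr_1 _ Ha). simpl INR at 1. rewrite Cpow_S, Cmult_0_l, Cmult_0_l, Cplus_0_l.
  assert (Q : forall i, cabs (fun d => nth i c 0 * (INR d ^ i * q ^ d))%C).
  { intros i. apply (cabs_scal (nth i c 0)), cabs_power_weighted; auto. }
  assert (E : csum (fun i => nth i c 0 * power_series i q)%C (S (S k)) =
    csum (fun i => CSeries (fun d => nth i c 0 * (INR d ^ i * q ^ d))%C) (S (S k))).
  { apply csum_ext. intros i _. symmetry. apply CSeries_scal, cabs_power_weighted; auto. }
  rewrite E.
  destruct (CSeries_csum (fun i d => nth i c 0 * (INR d ^ i * q ^ d))%C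
    (fun i d => Cmod (nth i c 0 * (INR d ^ i * q ^ d))) (S (S k)) (fun _ _ => Rle_refl _) Q) as [E' Hs].
  rewrite <- E', <- CSeries_scal by exact Hs.
  apply CSeries_ext. intros d. rewrite <- RtoC_pow, S_INR, Hc.
  set (N := S (S k)). rewrite Cpow_S.
  transitivity (q * (q ^ d * Re (csum (fun i => nth i c 0 * INR d ^ i)%C N)))%C; [ring|]. f_equal.
  clear. induction N; [simpl; ring|].
  change (csum (fun i => nth i c 0 * INR d ^ i)%C (S N)) with
    (csum (fun i => nth i c 0 * INR d ^ i)%C N + nth N c 0 * INR d ^ N)%C.
  change (csum (fun i => nth i c 0 * (INR d ^ i * q ^ d))%C (S N)) with
    (csum (fun i => nth i c 0 * (INR d ^ i * q ^ d))%C N + nth N c 0 * (INR d ^ N * q ^ d))%C.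
  rewrite <- IHN. rewrite <- RtoC_pow, <- RtoC_mult.
  set (s := csum _ N). 
  replace (Re (s + (nth N c 0 * INR d ^ N)%R)) with (Re s + nth N c 0 * INR d ^ N) by reflexivity.
  rewrite RtoC_plus, !RtoC_mult. ring.
Qed.

(** The second factors here and in [eisenstein6_poly] are the Eulerian polynomials of degree 2 and
    4, the numerators in the generating functions of d^3 and d^5. *)
Definition eisenstein4_poly (q : C) : C := (q * (1 + 4 * q + q ^ 2))%C.
Definition eisenstein6_poly (q : C) : C := (q * (1 + 26 * q + 66 * q ^ 2 + 26 * q ^ 3 + q ^ 4))%C.

Lemma power_series_kernels (q : C) : Cmod q < 1 ->
  power_series 3 q = kernel eisenstein4_poly 4 q /\ power_series 5 q = kernel eisenstein6_poly 6 q.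
Proof.
  intros H. pose proof (one_minus_nz q H) as Hq.
  pose proof (power_series_0 q H) as S0.
  pose proof (power_series_step 0 (1 :: 1 :: nil) q H ltac:(intros; simpl; ring)) as S1.
  pose proof (power_series_step 1 (1 :: 2 :: 1 :: nil) q H ltac:(intros; simpl; ring)) as S2.
  pose proof (power_series_step 2 (1 :: 3 :: 3 :: 1 :: nil) q H ltac:(intros; simpl; ring)) as S3.
  pose proof (power_series_step 3 (1 :: 4 :: 6 :: 4 :: 1 :: nil) q H ltac:(intros; simpl; ring)) as S4.
  pose proof (power_series_step 4 (1 :: 5 :: 10 :: 10 :: 5 :: 1 :: nil) q H ltac:(intros; simpl; ring)) as S5.
  cbn [csum nth] in S1, S2, S3, S4, S5.
  (* The last binomial coefficient is 1, so the series of top degree stands on both sides of its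
     recursion. *)
  assert (Solve : forall s A, s = (q * (A + 1 * s))%C -> s = (q * A / (1 - q))%C).
  { intros s A E. apply Cmult_eq_reg_l with (1 - q)%C; auto.
    replace ((1 - q) * s)%C with (s - q * s)%C by ring. rewrite E at 1. field. auto. }
  apply Solve in S1, S2, S3, S4, S5.
  rewrite S0 in S1, S2, S3, S4, S5. rewrite S1 in S2, S3, S4, S5.
  rewrite S2 in S3, S4, S5. rewrite S3 in S4, S5. rewrite S4 in S5.
  unfold kernel, eisenstein4_poly, eisenstein6_poly.
  split; [rewrite S3 | rewrite S5]; field; auto.
Qed.

Lemma C_of_R_nz (x : R) : x <> 0 -> RtoC x <> 0.
Proof. intros H E. apply H. apply (f_equal Re) in E. exact E. Qed.

Lemma Cone_minus_neq (q : C) : (q ^ 2)%C <> 1 -> (1 - q)%C <> 0 /\ (1 + q)%C <> 0 /\ (1 - q ^ 2)%C <> 0.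
Proof.
  intros H. assert (E : (1 - q ^ 2)%C <> 0).
  { intros E. apply H. replace (q ^ 2)%C with (1 - (1 - q ^ 2))%C by ring. rewrite E; ring. }
  replace (1 - q ^ 2)%C with ((1 - q) * (1 + q))%C in * by ring.
  repeat split; auto; intros F; apply E; rewrite F; ring.
Qed.

(** On the coefficients d^3 this says that twice the even part has coefficients 2 (2d)^3 = 2^4 d^3
    at q^(2d). It is needed up to |q| = 1, hence checked as an identity of rational functions. *)
Lemma eisenstein4_duplication (q : C) : (q ^ 2)%C <> 1 ->
  (kernel eisenstein4_poly 4 q + kernel eisenstein4_poly 4 (- q) =
   2 ^ 4 * kernel eisenstein4_poly 4 (q ^ 2))%C.
Proof.
  intros H. destruct (Cone_minus_neq q H) as [A [B D]]. unfold kernel, eisenstein4_poly.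
  replace (1 - - q)%C with (1 + q)%C by ring. field. auto.
Qed.

Lemma eisenstein6_duplication (q : C) : (q ^ 2)%C <> 1 ->
  (kernel eisenstein6_poly 6 q + kernel eisenstein6_poly 6 (- q) =
   2 ^ 6 * kernel eisenstein6_poly 6 (q ^ 2))%C.
Proof.
  intros H. destruct (Cone_minus_neq q H) as [A [B D]]. unfold kernel, eisenstein6_poly.
  replace (1 - - q)%C with (1 + q)%C by ring. field. auto.
Qed.

Lemma Cmod_mono_le (a : R) (q : C) (n : nat) : 0 <= a -> Cmod q <= 1 -> Cmod (a * q ^ n) <= a.
Proof.
  intros Ha Hq. rewrite Cmod_mult, Cmod_pow, Cmod_RtoC_nonneg by auto.
  rewrite <- (Rmult_1_r a) at 2. apply Rmult_le_compat_l; auto.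
  rewrite <- (pow1 n). apply pow_incr. split; [apply Cmod_ge_0 | auto].
Qed.

Lemma eisenstein4_poly_bound (q : C) : Cmod q <= 1 -> Cmod (eisenstein4_poly q) <= 6.
Proof.
  intros H.
  replace (eisenstein4_poly q) with (1 * q ^ 1 + 4 * q ^ 2 + 1 * q ^ 3)%C by (unfold eisenstein4_poly; ring).
  pose proof (Cmod_mono_le 1 q 1 ltac:(lra) H). pose proof (Cmod_mono_le 4 q 2 ltac:(lra) H).
  pose proof (Cmod_mono_le 1 q 3 ltac:(lra) H).
  repeat (eapply Rle_trans; [apply Cmod_triangle|]; apply Rle_trans with (5 + 1); [|lra]; apply Rplus_le_compat; auto).
  eapply Rle_trans; [apply Cmod_triangle|]. lra.
Qed.

Lemma eisenstein6_poly_bound (q : C) : Cmod q <= 1 -> Cmod (eisenstein6_poly q) <= 120.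
Proof.
  intros H.
  replace (eisenstein6_poly q) with (1 * q ^ 1 + (26 * q ^ 2 + (66 * q ^ 3 + (26 * q ^ 4 + 1 * q ^ 5))))%C
    by (unfold eisenstein6_poly; ring).
  pose proof (Cmod_mono_le 1 q 1 ltac:(lra) H). pose proof (Cmod_mono_le 26 q 2 ltac:(lra) H).
  pose proof (Cmod_mono_le 66 q 3 ltac:(lra) H). pose proof (Cmod_mono_le 26 q 4 ltac:(lra) H).
  pose proof (Cmod_mono_le 1 q 5 ltac:(lra) H).
  pose proof (Cmod_triangle (1 * q ^ 1) (26 * q ^ 2 + (66 * q ^ 3 + (26 * q ^ 4 + 1 * q ^ 5)))).
  pose proof (Cmod_triangle (26 * q ^ 2) (66 * q ^ 3 + (26 * q ^ 4 + 1 * q ^ 5))).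
  pose proof (Cmod_triangle (66 * q ^ 3) (26 * q ^ 4 + 1 * q ^ 5)).
  pose proof (Cmod_triangle (26 * q ^ 4) (1 * q ^ 5)). lra.
Qed.

Lemma eisenstein4_poly_lim x : clim x 1 -> clim (fun n => eisenstein4_poly (x n)) (eisenstein4_poly 1).
Proof.
  intros H. unfold eisenstein4_poly.
  apply clim_mult; [exact H|]. apply clim_plus; [|apply clim_pow; exact H].
  apply clim_plus; [apply clim_const | apply (clim_scal 4); exact H].
Qed.

Lemma eisenstein6_poly_lim x : clim x 1 -> clim (fun n => eisenstein6_poly (x n)) (eisenstein6_poly 1).
Proof.
  intros H. unfold eisenstein6_poly.
  apply clim_mult; [exact H|]. apply clim_plus; [|apply clim_pow; exact H].
  apply clim_plus; [|apply (clim_scal 26), clim_pow; exact H].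
  apply clim_plus; [|apply (clim_scal 66), clim_pow; exact H].
  apply clim_plus; [apply clim_const | apply (clim_scal 26); exact H].
Qed.

(** * Lambert series of the divisor sums *)

Lemma sigma_csum (k n : nat) :
  RtoC (INR (Defs.sigma k n)) = csum (fun d => if (n mod S d =? 0)%nat then INR (S d) ^ k else 0)%C n.
Proof.
  unfold Defs.sigma.
  assert (G : forall m, RtoC (INR (list_sum (map (fun d => d ^ k)%nat
     (filter (fun d => (n mod d =? 0)%nat) (seq 1 m))))) =
     csum (fun d => if (n mod S d =? 0)%nat then INR (S d) ^ k else 0)%C m).
  { induction m; [reflexivity|].
    rewrite seq_S, filter_app, map_app, list_sum_app, plus_INR, RtoC_plus, IHm.
    cbn [csum]. f_equal. change (1 + m)%nat with (S m). cbn [filter].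
    destruct (n mod S m =? 0)%nat; cbn [map list_sum fold_right].
    - rewrite Nat.add_0_r, pow_INR, RtoC_pow. reflexivity.
    - reflexivity. }
  apply G.
Qed.

(** With |q| = s^2, a power q^(md) is bounded by s^m s^d for m, d >= 1: the product form that
    [CSeries_fubini] asks for. *)
Lemma Cmod_sqrt_facts (q : C) : Cmod q < 1 ->
  exists s, 0 <= s < 1 /\ Cmod q = s * s.
Proof.
  intros H. pose proof (Cmod_ge_0 q). exists (sqrt (Cmod q)). repeat split.
  - apply sqrt_pos.
  - rewrite <- sqrt_1. apply sqrt_lt_1; lra.
  - symmetry. apply sqrt_def; auto.
Qed.

Lemma pow_antitone (s : R) (m n : nat) : 0 <= s < 1 -> (m <= n)%nat -> s ^ n <= s ^ m.
Proof.
  intros Hs H. replace n with (m + (n - m))%nat by lia. rewrite pow_add.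
  rewrite <- (Rmult_1_r (s ^ m)) at 2. apply Rmult_le_compat_l; [apply pow_le; lra|].
  rewrite <- (pow1 (n - m)). apply pow_incr; lra.
Qed.

(** Shifting the index by [S d] preserves divisibility, so the series f satisfies f = q^(d+1) +
    q^(d+1) f. *)
Lemma CSeries_multiples (q : C) (d : nat) : Cmod q < 1 ->
  CSeries (fun n => if (S n mod S d =? 0)%nat then (q ^ S n)%C else 0) = (q ^ S d / (1 - q ^ S d))%C.
Proof.
  intros H.
  assert (H' : Cmod (q ^ S d) < 1).
  { rewrite Cmod_pow. pose proof (Cmod_ge_0 q).
    apply Rle_lt_trans with (Cmod q ^ 1); [apply pow_antitone; [lra | lia] | simpl; lra]. }
  pose proof (one_minus_nz _ H') as Hnz.
  set (f := fun n => if (S n mod S d =? 0)%nat then (q ^ S n)%C else RtoC 0).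
  assert (Hf : cabs f).
  { apply cabs_le with (u := fun n => (INR n + 1) ^ 0 * Cmod q ^ n).
    - intros n. pose proof (Cmod_ge_0 q). unfold f. simpl (_ ^ 0). rewrite Rmult_1_l.
      destruct (_ =? _)%nat; [rewrite Cmod_pow; apply pow_antitone; [lra|lia] |
        rewrite Cmod_0; apply pow_le; auto].
    - apply ex_series_poly_geom. pose proof (Cmod_ge_0 q). lra. }
  assert (E : CSeries f = (q ^ S d + q ^ S d * CSeries f)%C).
  { rewrite (CSeries_incr_n f (S d) Hf) at 1. f_equal.
    - simpl csum. rewrite (csum_ext _ (fun _ => 0) d).
      + replace (csum (fun _ => RtoC 0) d) with (RtoC 0).
        * unfold f. rewrite Nat.Div0.mod_same. simpl. ring.
        * clear. induction d; simpl; [auto | rewrite <- IHd; ring].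
      + intros k Hk. unfold f. rewrite Nat.mod_small by lia. reflexivity.
    - rewrite <- CSeries_scal by auto. apply CSeries_ext. intros n. unfold f.
      replace (S (S d + n)) with (S n + 1 * S d)%nat by lia.
      rewrite Nat.Div0.mod_add. destruct (_ =? _)%nat; [|ring].
      rewrite Nat.mul_1_l, Cpow_add_r. ring. }
  fold f. apply Cmult_eq_reg_l with (1 - q ^ S d)%C; auto.
  replace ((1 - q ^ S d) * CSeries f)%C with (CSeries f - q ^ S d * CSeries f)%C by ring.
  rewrite E at 1. field. auto.
Qed.

(** The double sum over n and d | n is exchanged twice: first to put d outside, where the multiples
    of d form a geometric series, then to put the cofactor m outside. *)
Lemma lambert_series (k : nat) (q : C) : Cmod q < 1 ->
  CSeries (fun n => RtoC (INR (Defs.sigma k (S n))) * q ^ S n)%C =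
  CSeries (fun m => CSeries (fun d => INR (S d) ^ k * (q ^ S m) ^ S d))%C.
Proof.
  intros H. destruct (Cmod_sqrt_facts q H) as [s [Hs Es]].
  assert (Hs2 : forall i, 0 <= s ^ i) by (intros; apply pow_le; lra).
  assert (Hk : forall i, 0 <= (INR i + 1) ^ k) by (intros i; apply pow_le; pose proof (pos_INR i); lra).
  assert (Hck : forall d, Cmod (INR (S d) ^ k) = (INR d + 1) ^ k).
  { intros d. rewrite Cmod_pow, Cmod_RtoC_nonneg, S_INR by apply pos_INR. auto. }
  assert (Hmq : forall n, Cmod (q ^ n) = s ^ (n + n)).
  { intros n. rewrite Cmod_pow, Es, Rpow_mult_distr, <- pow_add. auto. }
  set (a := fun n d => if (S n mod S d =? 0)%nat then (INR (S d) ^ k * q ^ S n)%C else RtoC 0).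
  assert (Ha : forall n d, Cmod (a n d) <= s ^ n * ((INR d + 1) ^ k * s ^ d)).
  { intros n d. unfold a. destruct (Nat.eqb_spec (S n mod S d) 0) as [e|e].
    - assert (d <= n)%nat.
      { destruct (Nat.le_gt_cases (S d) (S n)); [lia|]. rewrite Nat.mod_small in e by lia. discriminate. }
      rewrite Cmod_mult, Hck, Hmq.
      replace (s ^ n * ((INR d + 1) ^ k * s ^ d)) with ((INR d + 1) ^ k * (s ^ (n + d))) by (rewrite pow_add; ring).
      apply Rmult_le_compat_l; auto. apply pow_antitone; auto; lia.
    - rewrite Cmod_0. repeat apply Rmult_le_pos; auto. }
  assert (Hu : ex_series (fun n => s ^ n)) by (apply ex_series_geom; rewrite Rabs_pos_eq; lra).
  assert (Hv : ex_series (fun d => (INR d + 1) ^ k * s ^ d)) by (apply ex_series_poly_geom; auto).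
  assert (Hv0 : forall d, 0 <= (INR d + 1) ^ k * s ^ d) by (intros; apply Rmult_le_pos; auto).
  transitivity (CSeries (fun n => CSeries (a n))).
  { apply CSeries_ext. intros n. rewrite sigma_csum, <- CSeries_finite.
    rewrite Cmult_comm, <- CSeries_scal.
    - apply CSeries_ext. intros d. unfold a. destruct (Nat.ltb_spec d (S n)).
      + destruct (_ =? _)%nat; ring.
      + rewrite Nat.mod_small by lia. simpl. ring.
    - apply cabs_le with (u := fun d => (INR d + 1) ^ k * (if (d <? S n)%nat then 1 else 0)).
      + intros d. destruct (_ <? _)%nat; [destruct (_ =? _)%nat|]; rewrite ?Hck, ?Cmod_0; specialize (Hk d); lra.
      + apply (ex_series_incr_n _ (S n)). apply ex_series_zero. intros d.
        destruct (Nat.ltb_spec (S n + d) (S n)); [lia|]. apply Rmult_0_r. }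
  rewrite (CSeries_fubini a (fun n => s ^ n) _ Ha); auto.
  transitivity (CSeries (fun d => CSeries (fun m => INR (S d) ^ k * (q ^ S m) ^ S d)%C)).
  { apply CSeries_ext. intros d.
    assert (Hq : Cmod (q ^ S d) < 1).
    { rewrite Cmod_pow. pose proof (Cmod_ge_0 q).
      apply Rle_lt_trans with (Cmod q ^ 1); [apply pow_antitone; [lra | lia] | simpl; lra]. }
    transitivity (INR (S d) ^ k * (q ^ S d / (1 - q ^ S d)))%C.
    - rewrite <- CSeries_multiples by auto. rewrite <- CSeries_scal.
      + apply CSeries_ext. intros n. unfold a. destruct (_ =? _)%nat; ring.
      + apply cabs_le with (u := fun n => s ^ n); auto. intros n. 
        destruct (_ =? _)%nat; [rewrite Hmq; apply pow_antitone; auto; lia | rewrite Cmod_0; auto].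
    - unfold Cdiv. rewrite <- CSeries_geom, <- CSeries_scal, <- CSeries_scal; auto using cabs_geom, cabs_scal.
      apply CSeries_ext. intros m. rewrite <- !Cpow_mult_r.
      replace (S m * S d)%nat with (S d + S d * m)%nat by lia. rewrite Cpow_add_r. ring. }
  symmetry. apply CSeries_fubini with (u := fun m => s ^ m) (v := fun d => (INR d + 1) ^ k * s ^ d); auto.
  intros m d. rewrite Cmod_mult, Hck, <- Cpow_mult_r, Hmq.
  replace (s ^ m * ((INR d + 1) ^ k * s ^ d)) with ((INR d + 1) ^ k * (s ^ (m + d))) by (rewrite pow_add; ring).
  apply Rmult_le_compat_l; auto. apply pow_antitone; auto; lia.
Qed.

(** * Lattice sums *)

Lemma csum_double (a : nat -> C) n :
  csum a (2 * n) = (csum (fun k => a (2 * k)%nat) n + csum (fun k => a (2 * k + 1)%nat) n)%C.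
Proof.
  induction n; [simpl; ring|].
  replace (2 * S n)%nat with (S (S (2 * n))) by lia. cbn [csum]. rewrite IHn.
  replace (2 * n + 1)%nat with (S (2 * n)) by lia. ring.
Qed.

Lemma CSeries_even_odd (a : nat -> C) : cabs a ->
  cabs (fun k => a (2 * k)%nat) -> cabs (fun k => a (2 * k + 1)%nat) ->
  CSeries a = (CSeries (fun k => a (2 * k)%nat) + CSeries (fun k => a (2 * k + 1)%nat))%C.
Proof.
  intros H H0 H1. apply clim_unique with (x := fun n => csum a (2 * n)).
  - destruct (clim_csum a H) as [A B].
    assert (F : filterlim (fun n => (2 * n)%nat) Hierarchy.eventually Hierarchy.eventually).
    { intros Q [N HN]. exists N. intros n Hn. apply HN. lia. }
    split; [apply (filterlim_comp _ _ _ _ _ _ _ _ F A) | apply (filterlim_comp _ _ _ _ _ _ _ _ F B)].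
  - eapply clim_ext; [intros n; symmetry; apply csum_double|].
    apply clim_plus; apply clim_csum; auto.
Qed.

Lemma BSum_even_odd (f : Z -> C) : babs f -> babs (fun n => f (2 * n)%Z) -> babs (fun n => f (2 * n + 1)%Z) ->
  BSum f = (BSum (fun n => f (2 * n)%Z) + BSum (fun n => f (2 * n + 1)%Z))%C.
Proof.
  intros H H0 H1. rewrite !BSum_split by auto.
  destruct H as [A B], H0 as [A0 B0], H1 as [A1 B1].
  rewrite (CSeries_even_odd _ A), (CSeries_even_odd _ B).
  - rewrite (CSeries_ext (fun k => f (Z.of_nat (2 * k))) (fun k => f (2 * Z.of_nat k)%Z)) by (intros; f_equal; lia).
    rewrite (CSeries_ext (fun k => f (Z.of_nat (2 * k + 1))) (fun k => f (2 * Z.of_nat k + 1)%Z)) by (intros; f_equal; lia).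
    rewrite (CSeries_ext (fun k => f (- Z.of_nat (S (2 * k)))%Z) (fun k => f (2 * - Z.of_nat (S k) + 1)%Z)) by (intros; f_equal; lia).
    rewrite (CSeries_ext (fun k => f (- Z.of_nat (S (2 * k + 1)))%Z) (fun k => f (2 * - Z.of_nat (S k))%Z)) by (intros; f_equal; lia).
    ring.
  - eapply cabs_ext; [|exact B1]. intros; cbv beta; f_equal; lia.
  - eapply cabs_ext; [|exact B0]. intros; cbv beta; f_equal; lia.
  - eapply cabs_ext; [|exact A0]. intros; cbv beta; f_equal; lia.
  - eapply cabs_ext; [|exact A1]. intros; cbv beta; f_equal; lia.
Qed.

Lemma babs_dominated (f : Z -> C) (u : nat -> R) :
  (forall n, Cmod (f n) <= u (Z.abs_nat n)) -> ex_series u -> babs f.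
Proof.
  intros H Hu. split.
  - apply cabs_le with (u := u); auto. intros n. specialize (H (Z.of_nat n)). rewrite Zabs2Nat.id in H. auto.
  - apply cabs_le with (u := fun n => u (S n)).
    + intros n. specialize (H (- Z.of_nat (S n))%Z).
      replace (Z.abs_nat (- Z.of_nat (S n))) with (S n) in H by lia. auto.
    + apply (ex_series_incr_1 u). auto.
Qed.

Lemma Cmod_BSum_le (f : Z -> C) (u : nat -> R) :
  (forall n, Cmod (f n) <= u (Z.abs_nat n)) -> ex_series u ->
  Cmod (BSum f) <= Series (fun n => u n + u (S n)).
Proof.
  intros H Hu. assert (Hu1 : ex_series (fun n => u (S n))) by (apply (ex_series_incr_1 u); auto).
  apply Cmod_CSeries_le; [|apply (ex_series_plus (V := R_NormedModule)); auto].
  intros n. eapply Rle_trans; [apply Cmod_triangle|]. apply Rplus_le_compat.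
  - specialize (H (Z.of_nat n)). rewrite Zabs2Nat.id in H. auto.
  - specialize (H (- Z.of_nat (S n))%Z).
    replace (Z.abs_nat (- Z.of_nat (S n))) with (S n) in H by lia. auto.
Qed.

Lemma BSum_fubini (a : Z -> Z -> C) (u v : nat -> R) :
  (forall m n, Cmod (a m n) <= u (Z.abs_nat m) * v (Z.abs_nat n)) ->
  (forall m, 0 <= u m) -> (forall n, 0 <= v n) -> ex_series u -> ex_series v ->
  BSum (fun m => BSum (a m)) = BSum (fun n => BSum (fun m => a m n)).
Proof.
  intros H Pu Pv Hu Hv.
  assert (Hu1 : ex_series (fun n => u (S n))) by (apply (ex_series_incr_1 u); auto).
  assert (Hv1 : ex_series (fun n => v (S n))) by (apply (ex_series_incr_1 v); auto).
  assert (Br : forall m, babs (a m)).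
  { intros m. apply babs_dominated with (u := fun n => u (Z.abs_nat m) * v n); auto.
    apply ex_series_Rscal; auto. }
  assert (Bc : forall n, babs (fun m => a m n)).
  { intros n. apply babs_dominated with (u := fun m => v (Z.abs_nat n) * u m).
    - intros; rewrite Rmult_comm; auto.
    - apply ex_series_Rscal; auto. }
  assert (cp : forall f, babs f -> cabs (fun n => f (Z.of_nat n) + f (- Z.of_nat (S n))%Z)%C).
  { intros f [A B]. apply cabs_plus; auto. }
  set (p := fun n => Z.of_nat n). set (q := fun n => (- Z.of_nat (S n))%Z).
  transitivity (CSeries (fun m => CSeries (fun n => (a (p m) (p n) + a (p m) (q n)) + (a (q m) (p n) + a (q m) (q n)))%C)).
  { apply CSeries_ext. intros m. symmetry. apply (CSeries_plus _ _ (cp _ (Br (p m))) (cp _ (Br (q m)))). }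
  rewrite (CSeries_fubini _ (fun m => u m + u (S m)) (fun n => v n + v (S n))).
  - apply CSeries_ext. intros n.
    transitivity (CSeries (fun m => (a (p m) (p n) + a (q m) (p n)) + (a (p m) (q n) + a (q m) (q n)))%C).
    + apply CSeries_ext; intros; ring.
    + apply (CSeries_plus _ _ (cp _ (Bc (p n))) (cp _ (Bc (q n)))).
  - intros m n.
    assert (ep : forall n, Z.abs_nat (p n) = n) by (intros; apply Zabs2Nat.id).
    assert (eq : forall n, Z.abs_nat (q n) = S n) by (intros; unfold q; lia).
    pose proof (H (p m) (p n)) as H1. pose proof (H (p m) (q n)) as H2.
    pose proof (H (q m) (p n)) as H3. pose proof (H (q m) (q n)) as H4.
    rewrite ?ep, ?eq in *.
    pose proof (Cmod_triangle (a (p m) (p n) + a (p m) (q n)) (a (q m) (p n) + a (q m) (q n))).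
    pose proof (Cmod_triangle (a (p m) (p n)) (a (p m) (q n))).
    pose proof (Cmod_triangle (a (q m) (p n)) (a (q m) (q n))). lra.
  - apply (ex_series_plus (V := R_NormedModule)); auto.
  - apply (ex_series_plus (V := R_NormedModule)); auto.
  - intros m. apply Rplus_le_le_0_compat; auto.
  - intros n. apply Rplus_le_le_0_compat; auto.
Qed.

(** Off the origin |m tau + n|^4 dominates (1 + m^2)(1 + n^2) up to a constant, which gives a
    majorant of product form for all k >= 4. *)
Definition lattice_weight (n : nat) : R := / (1 + INR n ^ 2).

Lemma lattice_weight_pos n : 0 < lattice_weight n.
Proof. apply Rinv_0_lt_compat. pose proof (pow2_ge_0 (INR n)). lra. Qed.

Lemma ex_series_lattice_weight : ex_series lattice_weight.
Proof.
  apply ex_series_le_nonneg with (b := fun n => 2 * / (INR n + 1) ^ 2).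
  - intros n. split; [left; apply lattice_weight_pos|]. pose proof (pos_INR n).
    replace (2 * / (INR n + 1) ^ 2) with (/ ((INR n + 1) ^ 2 / 2)) by (field; lra).
    apply Rinv_le_contravar.
    + assert (0 < (INR n + 1) ^ 2) by (apply pow_lt; lra). lra.
    + pose proof (pow2_ge_0 (INR n - 1)). nra.
  - apply ex_series_Rscal, ex_series_inv_sq.
Qed.

Lemma INR_Zabs_nat_sq (n : Z) : INR (Z.abs_nat n) ^ 2 = IZR n ^ 2.
Proof. rewrite INR_IZR_INZ, Zabs2Nat.id_abs, abs_IZR, pow2_abs. auto. Qed.

(** As the inverse of 0 is 0, the origin contributes nothing for k > 0 and the sum may run over all
    of Z^2. *)
Definition lattice_term (k : nat) (tau : C) (m n : Z) : C := (/ (IZR m * tau + IZR n) ^ k)%C.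

Lemma lattice_term_bound (k : nat) (tau : C) : (4 <= k)%nat -> 0 < Im tau ->
  exists K, 0 <= K /\ forall m n,
    Cmod (lattice_term k tau m n) <= K * lattice_weight (Z.abs_nat m) * lattice_weight (Z.abs_nat n).
Proof.
  intros Hk Hy. destruct tau as [x y]. simpl in Hy.
  (* From n^2 <= 2 (m x + n)^2 + 2 m^2 x^2 and m^2 = (m y)^2 / y^2. *)
  set (K0 := 2 + (1 + 2 * x ^ 2) / y ^ 2).
  assert (Hy2 : 0 < y ^ 2) by (apply pow_lt; auto).
  assert (HK0 : 2 <= K0).
  { unfold K0. assert (0 <= (1 + 2 * x ^ 2) / y ^ 2); [|lra].
    apply Rdiv_le_0_compat; auto. pose proof (pow2_ge_0 x); lra. }
  set (M := fun m n => (IZR m * x + IZR n) ^ 2 + (IZR m * y) ^ 2).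
  assert (HM : forall m n, Cmod (IZR m * (x, y) + IZR n) ^ 2 = M m n).
  { intros m n. rewrite Cmod2_alt. unfold M, Re, Im. simpl. ring. }
  assert (HL : forall m n, IZR m ^ 2 + IZR n ^ 2 <= K0 * M m n).
  { intros m n. unfold M, K0. set (a := IZR m) in *. set (b := IZR n) in *.
    assert (E : (1 + 2 * x ^ 2) / y ^ 2 * (a * y) ^ 2 = (1 + 2 * x ^ 2) * a ^ 2) by (field; lra).
    pose proof (pow2_ge_0 (2 * a * x + b)). 
    assert (0 <= (1 + 2 * x ^ 2) / y ^ 2 * (a * x + b) ^ 2).
    { apply Rmult_le_pos; [|apply pow2_ge_0]. apply Rdiv_le_0_compat; auto. pose proof (pow2_ge_0 x); lra. }
    pose proof (pow2_ge_0 (a * y)). nra. }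
  exists (4 * K0 ^ k). split; [apply Rmult_le_pos; [lra|apply pow_le; lra]|].
  intros m n. unfold lattice_term, lattice_weight. rewrite !INR_Zabs_nat_sq.
  set (a := IZR m) in *. set (b := IZR n) in *.
  assert (Wa : 0 < / (1 + a ^ 2)) by (apply Rinv_0_lt_compat; pose proof (pow2_ge_0 a); lra).
  assert (Wb : 0 < / (1 + b ^ 2)) by (apply Rinv_0_lt_compat; pose proof (pow2_ge_0 b); lra).
  assert (HKk : 0 < K0 ^ k) by (apply pow_lt; lra).
  set (w := (a * (x, y) + b)%C).
  assert (Hab : (m = 0 /\ n = 0)%Z \/ 1 <= a ^ 2 + b ^ 2).
  { destruct (Z.eq_dec m 0) as [Em|Em]; [destruct (Z.eq_dec n 0) as [En|En]; [left; auto|]|]; right.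
    - pose proof (Rabs_IZR_ge_1 n En) as G. fold b in G. rewrite <- (pow2_abs b).
      pose proof (pow2_ge_0 a). nra.
    - pose proof (Rabs_IZR_ge_1 m Em) as G. fold a in G. rewrite <- (pow2_abs a).
      pose proof (pow2_ge_0 b). nra. }
  destruct Hab as [[-> ->]|Hab].
  { replace w with (RtoC 0) by (unfold w, a, b; ring).
    replace ((0:C) ^ k)%C with (RtoC 0) by (destruct k; [lia | rewrite Cpow_S; ring]).
    rewrite Cinv_0, Cmod_0. repeat apply Rmult_le_pos; try lra. }
  assert (Hw : 0 < Cmod w ^ 2 /\ a ^ 2 + b ^ 2 <= K0 * Cmod w ^ 2).
  { unfold w, a, b. rewrite HM. pose proof (HL m n) as L. fold a b in L. split; auto.
    apply Rmult_lt_reg_l with K0; [lra|]. lra. }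
  destruct Hw as [Hw1 Hw2].
  assert (Hw0 : 0 < Cmod w).
  { destruct (Cmod_ge_0 w) as [h|h]; auto. rewrite <- h in Hw1. simpl in Hw1. lra. }
  assert (Wn : w <> 0) by (intros E; rewrite E, Cmod_0 in Hw0; lra).
  rewrite Cmod_inv, Cmod_pow by (apply Cpow_nz; auto).
  (* K0 >= 2 makes t >= 1 at every non-zero lattice point, so that t^4 <= t^k. *)
  set (t := K0 * Cmod w).
  assert (Ht2 : K0 * (a ^ 2 + b ^ 2) <= t ^ 2).
  { unfold t. replace ((K0 * Cmod w) ^ 2) with (K0 * (K0 * Cmod w ^ 2)) by ring.
    apply Rmult_le_compat_l; lra. }
  assert (Ht0 : 0 < t) by (apply Rmult_lt_0_compat; lra).
  assert (Ht : 1 <= t) by nra.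
  assert (Ht4 : (1 + a ^ 2) * (1 + b ^ 2) <= 4 * t ^ k).
  { apply Rle_trans with (4 * t ^ 4).
    - pose proof (pow2_ge_0 a); pose proof (pow2_ge_0 b).
      assert (S : a ^ 2 + b ^ 2 <= t ^ 2) by nra.
      replace (t ^ 4) with (t ^ 2 * t ^ 2) by ring.
      assert ((a ^ 2 + b ^ 2) * (a ^ 2 + b ^ 2) <= t ^ 2 * t ^ 2) by (apply Rmult_le_compat; lra).
      set (A := a ^ 2) in *. set (B := b ^ 2) in *. nra.
    - apply Rmult_le_compat_l; [lra|]. apply Rle_pow; auto. }
  unfold t in Ht4. rewrite Rpow_mult_distr in Ht4.
  assert (Hwk : 0 < Cmod w ^ k) by (apply pow_lt; auto).
  rewrite Rmult_assoc, <- Rinv_mult.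
  assert (Hp : 0 < (1 + a ^ 2) * (1 + b ^ 2)).
  { pose proof (pow2_ge_0 a); pose proof (pow2_ge_0 b). apply Rmult_lt_0_compat; lra. }
  apply Rmult_le_reg_r with (Cmod w ^ k * ((1 + a ^ 2) * (1 + b ^ 2))); [apply Rmult_lt_0_compat; auto|].
  replace (/ Cmod w ^ k * (Cmod w ^ k * ((1 + a ^ 2) * (1 + b ^ 2)))) with ((1 + a ^ 2) * (1 + b ^ 2)) by (field; lra).
  set (PP := (1 + a ^ 2) * (1 + b ^ 2)) in *.
  replace (4 * K0 ^ k * / PP * (Cmod w ^ k * PP)) with (4 * (K0 ^ k * Cmod w ^ k)) by (field; lra). lra.
Qed.

Definition lattice_sum (k : nat) (tau : C) : C := BSum (fun m => BSum (lattice_term k tau m)).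

Lemma lattice_sum_facts (k : nat) (tau : C) : (4 <= k)%nat -> 0 < Im tau ->
  (forall m, babs (lattice_term k tau m)) /\
  (forall n, babs (fun m => lattice_term k tau m n)) /\
  babs (fun m => BSum (lattice_term k tau m)) /\
  babs (fun n => BSum (fun m => lattice_term k tau m n)) /\
  lattice_sum k tau = BSum (fun n => BSum (fun m => lattice_term k tau m n)).
Proof.
  intros Hk Hy. destruct (lattice_term_bound k tau Hk Hy) as [K [HK HB]].
  pose proof ex_series_lattice_weight as Hw.
  assert (Br : forall m, babs (lattice_term k tau m)).
  { intros m. apply babs_dominated with (u := fun n => K * lattice_weight (Z.abs_nat m) * lattice_weight n); auto.
    apply ex_series_Rscal; auto. }
  assert (Bc : forall n, babs (fun m => lattice_term k tau m n)).
  { intros n. apply babs_dominated with (u := fun m => K * lattice_weight (Z.abs_nat n) * lattice_weight m).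
    - intros m. specialize (HB m n). lra.
    - apply ex_series_Rscal; auto. }
  set (W := Series (fun n => lattice_weight n + lattice_weight (S n))).
  assert (SW : forall c, Series (fun n => c * lattice_weight n + c * lattice_weight (S n)) = c * W).
  { intros c. unfold W. rewrite <- Series_scal_l. apply Series_ext. intros; ring. }
  split; [auto|]. split; [auto|]. split; [|split].
  - apply babs_dominated with (u := fun m => K * W * lattice_weight m); [|apply ex_series_Rscal; auto].
    intros m. replace (K * W * lattice_weight (Z.abs_nat m)) with (K * lattice_weight (Z.abs_nat m) * W) by ring.
    rewrite <- SW. apply (Cmod_BSum_le _ (fun n => K * lattice_weight (Z.abs_nat m) * lattice_weight n)); auto.
    apply ex_series_Rscal; auto.
  - apply babs_dominated with (u := fun m => K * W * lattice_weight m); [|apply ex_series_Rscal; auto].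
    intros n. replace (K * W * lattice_weight (Z.abs_nat n)) with (K * lattice_weight (Z.abs_nat n) * W) by ring.
    rewrite <- SW. apply (Cmod_BSum_le _ (fun m => K * lattice_weight (Z.abs_nat n) * lattice_weight m)).
    + intros m. specialize (HB m n). lra.
    + apply ex_series_Rscal; auto.
  - unfold lattice_sum. apply BSum_fubini with (u := fun m => K * lattice_weight m) (v := lattice_weight); auto.
    + intros m. pose proof (lattice_weight_pos m). apply Rmult_le_pos; lra.
    + intros n. left; apply lattice_weight_pos.
    + apply ex_series_Rscal; auto.
Qed.

Lemma Im_pos_nz (tau : C) : 0 < Im tau -> tau <> 0.
Proof. intros H E. rewrite E in H. simpl in H. lra. Qed.

Lemma Im_inv_opp_pos (tau : C) : 0 < Im tau -> 0 < Im (- / tau).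
Proof.
  intros H. destruct tau as [x y]; simpl in *. rewrite Rdiv_opp_l, Ropp_involutive.
  apply Rdiv_lt_0_compat; auto. pose proof (Rle_0_sqr x). unfold Rsqr in *. nra.
Qed.

(** Since m (-1/tau) + n = (n tau - m) / tau, inversion permutes the lattice by (m, n) -> (n, -m):
    an exchange of the two sums followed by a flip of one index. *)
Lemma lattice_sum_inversion (k : nat) (tau : C) : (4 <= k)%nat -> 0 < Im tau ->
  lattice_sum k (- / tau) = (tau ^ k * lattice_sum k tau)%C.
Proof.
  intros Hk Hy. pose proof (Im_pos_nz tau Hy) as Hn.
  destruct (lattice_sum_facts k tau Hk Hy) as [Br [Bc [BBr [BBc E]]]].
  rewrite E, <- BSum_scal by auto.
  rewrite <- (BSum_flip (fun n => tau ^ k * BSum (fun m => lattice_term k tau m n))%C)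
    by (apply babs_scal; auto).
  apply BSum_ext. intros m. rewrite <- BSum_scal by auto.
  apply BSum_ext. intros n. unfold lattice_term.
  replace (IZR m * - / tau + IZR n)%C with (/ tau * (IZR n * tau + IZR (- m)))%C.
  - rewrite Cpow_mult_l, Cinv_mul, Cpow_inv by auto. f_equal. field. apply Cpow_nz; auto.
  - rewrite opp_IZR, RtoC_opp. field. auto.
Qed.

(** * Eisenstein series as lattice sums *)

Definition admissible_kernel (P : C -> C) (k : nat) : Prop :=
  (forall q, (q ^ 2)%C <> 1 -> (kernel P k q + kernel P k (- q))%C = (2 ^ k * kernel P k (q ^ 2))%C) /\
  (exists B, forall q, Cmod q <= 1 -> Cmod (P q) <= B) /\
  (forall x, clim x 1 -> clim (fun n => P (x n)) (P 1)).

Lemma admissible_kernel4 : admissible_kernel eisenstein4_poly 4.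
Proof.
  split; [apply eisenstein4_duplication|].
  split; [exists 6; apply eisenstein4_poly_bound | apply eisenstein4_poly_lim].
Qed.

Lemma admissible_kernel6 : admissible_kernel eisenstein6_poly 6.
Proof.
  split; [apply eisenstein6_duplication|].
  split; [exists 120; apply eisenstein6_poly_bound | apply eisenstein6_poly_lim].
Qed.

(** For the two Eisenstein kernels P(1) is 3! and 5!, so this is (k-1)! / (-2 PI i)^k. *)
Definition kernel_const (P : C -> C) (k : nat) : C := (P 1 / (- (2 * PI * Ci)) ^ k)%C.

Lemma admissible_lipschitz (P : C -> C) (k : nat) (z : C) : admissible_kernel P k -> (2 <= k)%nat ->
  0 <= Im z -> (forall n : Z, (z + IZR n)%C <> 0) ->
  kernel P k (nome z) = (kernel_const P k * BSum (fun n => / (z + IZR n) ^ k))%C.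
Proof.
  intros [H1 [[B H2] H3]] Hk Hy Hz. apply (kernel_lipschitz P k B); auto.
Qed.

(** For even k > 0 this is 2 zeta(k): the term n = 0 is the inverse of 0. *)
Definition zeta_sum (k : nat) : C := BSum (fun n => / (RtoC (IZR n)) ^ k)%C.

Lemma half_integer_nz (n : Z) : (/ 2 + IZR n)%C <> 0.
Proof.
  intros E. assert (F : (1 + 2 * IZR n)%C = 0).
  { replace (1 + 2 * IZR n)%C with (2 * (/ 2 + IZR n))%C by (field; apply C2_nz). rewrite E; ring. }
  apply (f_equal Re) in F. unfold Re in F. simpl in F.
  assert (G : IZR (1 + 2 * n) = 0) by (rewrite plus_IZR, mult_IZR; lra).
  apply eq_IZR in G. lia.
Qed.

Lemma babs_inv_pow_Z (k : nat) : (2 <= k)%nat -> babs (fun n => / (RtoC (IZR n)) ^ k)%C.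
Proof.
  intros Hk.
  assert (G : forall n : Z, (1 <= Z.abs_nat n)%nat -> Cmod (/ (RtoC (IZR n)) ^ k) <= / 1 ^ k * / INR (Z.abs_nat n) ^ 2).
  { intros n Hn. apply Cmod_inv_pow_le; auto; [lra| |].
    - apply (le_INR 1); auto.
    - rewrite INR_IZR_INZ, Zabs2Nat.id_abs, abs_IZR, Cmod_R. lra. }
  assert (HS : ex_series (fun n => / 1 ^ k * / INR (S n) ^ 2)).
  { apply ex_series_Rscal. eapply ex_series_ext; [|exact ex_series_inv_sq].
    intros n. rewrite S_INR. auto. }
  split.
  - apply cabs_decr_1. apply cabs_le with (u := fun n => / 1 ^ k * / INR (S n) ^ 2); auto.
    intros n. specialize (G (Z.of_nat (S n))). rewrite Zabs2Nat.id in G. apply G. lia.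
  - apply cabs_le with (u := fun n => / 1 ^ k * / INR (S n) ^ 2); auto.
    intros n. specialize (G (- Z.of_nat (S n))%Z).
    replace (Z.abs_nat (- Z.of_nat (S n))) with (S n) in G by lia. apply G. lia.
Qed.

(** Lipschitz's formula at z = 1/2, where q = -1, evaluates the sum over half-integers; separating
    even and odd n in [zeta_sum] expresses that sum as (2^k - 1) times [zeta_sum]. The normalising
    constant thus comes out rational, with no value of zeta. *)
Lemma zeta_sum_kernel (P : C -> C) (k : nat) : admissible_kernel P k -> (2 <= k)%nat ->
  ((2 ^ k - 1) * (kernel_const P k * zeta_sum k))%C = kernel P k (- 1).
Proof.
  intros HP Hk.
  assert (T : ((2:C) ^ k)%C <> 0) by (apply Cpow_nz, C2_nz).
  assert (Hh : 0 <= Im (/ 2)) by (simpl; lra).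
  rewrite <- nome_half, (admissible_lipschitz P k _ HP Hk Hh half_integer_nz).
  pose proof (babs_inv_pow_Z k Hk) as B.
  pose proof (babs_inv_pow_shift (/ 2) k Hk half_integer_nz) as B'.
  assert (E0 : forall n, (/ 2 ^ k * / RtoC (IZR n) ^ k = / RtoC (IZR (2 * n)) ^ k)%C).
  { intros n. rewrite mult_IZR, RtoC_mult, Cpow_mult_l, Cinv_mul. auto. }
  assert (E1 : forall n, (/ 2 ^ k * / (/ 2 + IZR n) ^ k = / RtoC (IZR (2 * n + 1)) ^ k)%C).
  { intros n. rewrite <- Cinv_mul, <- Cpow_mult_l. do 2 f_equal.
    rewrite plus_IZR, mult_IZR, RtoC_plus, RtoC_mult. field. }
  assert (E : zeta_sum k = (/ 2 ^ k * zeta_sum k + / 2 ^ k * BSum (fun n => / (/ 2 + IZR n) ^ k))%C).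
  { unfold zeta_sum at 1. rewrite BSum_even_odd; auto.
    - rewrite <- (BSum_ext _ _ E0), <- (BSum_ext _ _ E1), !BSum_scal by auto. reflexivity.
    - apply (babs_ext _ _ E0), babs_scal; auto.
    - apply (babs_ext _ _ E1), babs_scal; auto. }
  set (X := zeta_sum k) in *. set (Y := BSum _) in *.
  replace ((2 ^ k - 1) * (kernel_const P k * X))%C with (kernel_const P k * (2 ^ k * X - X))%C by ring.
  f_equal. rewrite E at 1. field. auto.
Qed.

Lemma Z_mult_add_nz (m n : Z) (tau : C) : 0 < Im tau -> m <> 0%Z -> (IZR m * tau + IZR n)%C <> 0.
Proof.
  intros Hy Hm E. apply (f_equal Im) in E. unfold Im in *. simpl in E.
  assert (IZR m <> 0) by (apply not_0_IZR; auto).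
  assert (IZR m * snd tau = 0) by lra. apply Rmult_integral in H0. destruct H0; lra.
Qed.

(** The row m = 0 is [zeta_sum]; the row m > 0 is Lipschitz's formula at m tau, and these rows add
    up to the Lambert series; the row -m equals the row m because k is even, whence the factor 2. *)
Lemma lattice_sum_divisor_series (P : C -> C) (h : nat) (tau : C) :
  let k := (2 * h)%nat in
  admissible_kernel P k -> (4 <= k)%nat -> 0 < Im tau ->
  (forall q, Cmod q < 1 -> power_series (k - 1) q = kernel P k q) ->
  (kernel_const P k * lattice_sum k tau = kernel_const P k * zeta_sum k + 2 * divisor_series (k - 1) tau)%C.
Proof.
  intros k HP Hk Hy Hs. pose proof (Cmod_nome_lt_1 tau Hy) as Hq.
  destruct (lattice_sum_facts k tau Hk Hy) as [Br [_ [BB _]]].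
  set (G := fun m => BSum (lattice_term k tau m)) in *.
  assert (Gopp : forall m, G (- m)%Z = G m).
  { intros m. unfold G. rewrite <- (BSum_flip (lattice_term k tau m)) by auto.
    apply BSum_ext. intros n. unfold lattice_term. f_equal.
    replace (IZR (- m) * tau + IZR n)%C with (- 1 * (IZR m * tau + IZR (- n)))%C
      by (rewrite !opp_IZR, !RtoC_opp; ring).
    rewrite Cpow_mult_l. unfold k at 1. rewrite Cpow_mult_r.
    replace ((- 1) ^ 2)%C with (RtoC 1) by ring. rewrite Cpow_1_l. ring. }
  assert (G0 : G 0%Z = zeta_sum k).
  { apply BSum_ext. intros n. unfold lattice_term. do 2 f_equal. ring. }
  assert (GS : forall j, (kernel_const P k * G (Z.of_nat (S j)))%C =
            CSeries (fun d => INR (S d) ^ (k - 1) * (nome tau ^ S j) ^ S d)%C).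
  { intros j. pose proof (pos_INR j) as Pj.
    assert (Hq' : Cmod (nome tau ^ S j) < 1).
    { rewrite Cmod_pow. pose proof (Cmod_ge_0 (nome tau)).
      apply Rle_lt_trans with (Cmod (nome tau) ^ 1); [apply pow_antitone; [lra | lia] | simpl; lra]. }
    transitivity (kernel P k (nome (INR (S j) * tau))).
    - symmetry. rewrite (admissible_lipschitz P k _ HP).
      + f_equal. apply BSum_ext. intros n. unfold lattice_term. rewrite <- INR_IZR_INZ. auto.
      + lia.
      + rewrite S_INR. unfold Im in *. simpl. assert (0 <= INR j * snd tau) by (apply Rmult_le_pos; lra). lra.
      + intros n. rewrite INR_IZR_INZ. apply Z_mult_add_nz; auto. lia.
    - rewrite nome_INR_mult, <- Hs by auto. unfold power_series.
      rewrite CSeries_incr_1 by (apply cabs_power_weighted; auto).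
      (* The exponent k - 1 is positive, so the term d = 0 of [power_series] vanishes. *)
      replace (k - 1)%nat with (S (k - 2)) by lia. simpl INR at 1. rewrite Cpow_S. ring. }
  unfold lattice_sum. fold G. rewrite BSum_split by auto. destruct BB as [B1 B2].
  rewrite (CSeries_incr_1 _ B1). change (Z.of_nat 0) with 0%Z. rewrite G0.
  rewrite (CSeries_ext (fun n => G (- Z.of_nat (S n))%Z) (fun n => G (Z.of_nat (S n)))) by (intros; apply Gopp).
  assert (B3 : cabs (fun n => G (Z.of_nat (S n)))) by (apply (cabs_incr_n _ 1 B1)).
  assert (F : (kernel_const P k * CSeries (fun n => G (Z.of_nat (S n))))%C = divisor_series (k - 1) tau).
  { rewrite <- CSeries_scal by auto. rewrite (CSeries_ext _ _ GS).
    symmetry. apply lambert_series; auto. }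
  rewrite <- F. ring.
Qed.

(** The kernel is 1/8 at q = -1 and 2^4 - 1 = 15, so the constant term of the scaled lattice sum is
    1/120. *)
Lemma E4_lattice_sum (tau : C) : 0 < Im tau ->
  E4 tau = (120 * kernel_const eisenstein4_poly 4 * lattice_sum 4 tau)%C.
Proof.
  intros Hy. pose proof admissible_kernel4 as HP.
  pose proof (lattice_sum_divisor_series eisenstein4_poly 2 tau HP ltac:(lia) Hy) as E.
  change (2 * 2)%nat with 4%nat in E. change (4 - 1)%nat with 3%nat in E.
  specialize (E (fun q Hq => proj1 (power_series_kernels q Hq))).
  pose proof (zeta_sum_kernel _ _ HP ltac:(lia)) as Z.
  unfold E4. set (D := divisor_series 3 tau) in *. set (c := kernel_const _ _) in *.
  rewrite <- Cmult_assoc, E.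
  replace (kernel eisenstein4_poly 4 (- 1)) with (/ 8)%C in Z by (unfold kernel, eisenstein4_poly; field).
  replace (c * zeta_sum 4)%C with (/ 15 * ((2 ^ 4 - 1) * (c * zeta_sum 4)))%C by field.
  rewrite Z. field.
Qed.

(** The kernel is -1/4 at q = -1 and 2^6 - 1 = 63, so the constant term of the scaled lattice sum is
    -1/252. *)
Lemma E6_lattice_sum (tau : C) : 0 < Im tau ->
  E6 tau = (- 252 * kernel_const eisenstein6_poly 6 * lattice_sum 6 tau)%C.
Proof.
  intros Hy. pose proof admissible_kernel6 as HP.
  pose proof (lattice_sum_divisor_series eisenstein6_poly 3 tau HP ltac:(lia) Hy) as E.
  change (2 * 3)%nat with 6%nat in E. change (6 - 1)%nat with 5%nat in E.
  specialize (E (fun q Hq => proj2 (power_series_kernels q Hq))).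
  pose proof (zeta_sum_kernel _ _ HP ltac:(lia)) as Z.
  unfold E6. set (D := divisor_series 5 tau) in *. set (c := kernel_const _ _) in *.
  rewrite <- Cmult_assoc, E.
  replace (kernel eisenstein6_poly 6 (- 1)) with (- / 4)%C in Z by (unfold kernel, eisenstein6_poly; field).
  replace (c * zeta_sum 6)%C with (/ 63 * ((2 ^ 6 - 1) * (c * zeta_sum 6)))%C by field.
  rewrite Z. field.
Qed.

Lemma E4_inversion (tau : C) : 0 < Im tau -> E4 (- / tau) = (tau ^ 4 * E4 tau)%C.
Proof.
  intros H. rewrite !E4_lattice_sum, lattice_sum_inversion by (auto using Im_inv_opp_pos). ring.
Qed.

Lemma E6_inversion (tau : C) : 0 < Im tau -> E6 (- / tau) = (tau ^ 6 * E6 tau)%C.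
Proof.
  intros H. rewrite !E6_lattice_sum, lattice_sum_inversion by (auto using Im_inv_opp_pos || lia). ring.
Qed.

(** * The discriminant has no zeros *)

Definition pser (c : nat -> C) (q : C) : C := CSeries (fun n => c n * q ^ n)%C.

(** Here [disc] is the open unit disc; in [disc_coeff], [disc_norm] and [disc_tail] it is the
    discriminant. *)
Definition disc_summable (c : nat -> C) : Prop :=
  forall r, 0 <= r < 1 -> ex_series (fun n => Cmod (c n) * r ^ n).

Lemma cabs_pser c q : disc_summable c -> Cmod q < 1 -> cabs (fun n => c n * q ^ n)%C.
Proof.
  intros H Hq. apply cabs_le with (u := fun n => Cmod (c n) * Cmod q ^ n).
  - intros n. rewrite Cmod_mult, Cmod_pow. lra.
  - apply H. split; [apply Cmod_ge_0 | auto].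
Qed.

Lemma cabs_pser_r c r : disc_summable c -> 0 <= r < 1 -> cabs (fun n => c n * r ^ n)%C.
Proof. intros H Hr. apply cabs_pser; auto. rewrite Cmod_RtoC_nonneg; lra. Qed.

Lemma disc_summable_of_cabs c : (forall r : R, 0 <= r < 1 -> cabs (fun n => c n * r ^ n)%C) -> disc_summable c.
Proof.
  intros H r Hr. eapply ex_series_ext; [|exact (H r Hr)].
  intros n. cbv beta. rewrite Cmod_mult, Cmod_pow, Cmod_RtoC_nonneg; auto; lra.
Qed.

Lemma cconv_pow a b (q : C) n : (cconv a b n * q ^ n)%C = cconv (fun k => a k * q ^ k)%C (fun k => b k * q ^ k)%C n.
Proof.
  unfold cconv. rewrite Cmult_comm, <- csum_scal. apply csum_ext. intros k Hk.
  replace n with (k + (n - k))%nat at 1 by lia. rewrite Cpow_add_r. ring.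
Qed.

Lemma disc_summable_cconv a b : disc_summable a -> disc_summable b -> disc_summable (cconv a b).
Proof.
  intros Ha Hb. apply disc_summable_of_cabs. intros r Hr.
  eapply cabs_ext; [intros n; symmetry; apply cconv_pow|].
  apply cabs_cconv; apply cabs_pser_r; auto.
Qed.

Lemma pser_cconv a b q : disc_summable a -> disc_summable b -> Cmod q < 1 ->
  pser (cconv a b) q = (pser a q * pser b q)%C.
Proof.
  intros Ha Hb Hq. unfold pser. rewrite <- CSeries_cconv by (apply cabs_pser; auto).
  apply CSeries_ext. intros n; apply cconv_pow.
Qed.

Lemma disc_summable_minus a b : disc_summable a -> disc_summable b -> disc_summable (fun n => a n - b n)%C.
Proof.
  intros Ha Hb. apply disc_summable_of_cabs. intros r Hr.
  apply cabs_ext with (a := fun n => (a n * r ^ n + - 1 * (b n * r ^ n))%C); [intros; ring|].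
  apply cabs_plus; [|apply cabs_scal]; apply cabs_pser_r; auto.
Qed.

Lemma pser_minus a b q : disc_summable a -> disc_summable b -> Cmod q < 1 ->
  pser (fun n => a n - b n)%C q = (pser a q - pser b q)%C.
Proof.
  intros Ha Hb Hq. unfold pser.
  rewrite (CSeries_ext _ (fun n => (a n * q ^ n + - 1 * (b n * q ^ n))%C)) by (intros; ring).
  rewrite CSeries_plus, CSeries_scal; auto using cabs_pser, cabs_scal. ring.
Qed.

Lemma disc_summable_shift c : disc_summable c -> disc_summable (fun n => c (S n)).
Proof.
  intros H. apply disc_summable_of_cabs. intros r Hr. destruct Hr as [[Hr0|<-] Hr1].
  - pose proof (cabs_incr_n _ 1 (cabs_pser_r c r H ltac:(lra))) as A.
    apply (cabs_scal (/ r)) in A. eapply cabs_ext; [|exact A]. intros n. cbn beta.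
    change (1 + n)%nat with (S n). rewrite Cpow_S. field. apply C_of_R_nz. lra.
  - apply cabs_decr_1. unfold cabs. apply ex_series_zero. intros n. rewrite Cpow_S, Cmult_0_l, Cmult_0_r. apply Cmod_0.
Qed.

Lemma pser_incr_1 c q : disc_summable c -> Cmod q < 1 ->
  pser c q = (c 0%nat + q * pser (fun n => c (S n)) q)%C.
Proof.
  intros H Hq. unfold pser. rewrite (CSeries_incr_1 _ (cabs_pser c q H Hq)).
  rewrite <- CSeries_scal by (apply (cabs_pser (fun n => c (S n))); auto using disc_summable_shift).
  f_equal; [simpl; ring|]. apply CSeries_ext. intros n. simpl. ring.
Qed.

Lemma Cmod_csum_const_le (a : nat -> C) (M : R) n :
  (forall k, (k < n)%nat -> Cmod (a k) <= M) -> Cmod (csum a n) <= INR n * M.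
Proof.
  induction n; intros H.
  - simpl. rewrite Cmod_0. lra.
  - cbn [csum]. rewrite S_INR. eapply Rle_trans; [apply Cmod_triangle|].
    specialize (IHn ltac:(auto)). specialize (H n ltac:(lia)). lra.
Qed.

Lemma csum_geom (z : C) n : ((1 - z) * csum (fun j => z ^ j) n = 1 - z ^ n)%C.
Proof. induction n; [simpl; ring|]. cbn [csum]. rewrite Cmult_plus_distr_l, IHn. simpl. ring. Qed.

Lemma csum_single (a : nat -> C) (n N : nat) : (n < N)%nat ->
  (forall k, (k < N)%nat -> k <> n -> a k = 0) -> csum a N = a n.
Proof.
  intros Hn H. induction N; [lia|]. cbn [csum].
  destruct (Nat.eq_dec n N) as [->|E].
  - replace (csum a N) with (RtoC 0); [ring|]. symmetry.
    rewrite (csum_ext _ (fun _ => 0)) by (intros; apply H; lia).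
    clear. induction N; [reflexivity|]. cbn [csum]. rewrite IHN. ring.
  - rewrite IHN by (auto; lia). rewrite (H N) by lia. ring.
Qed.

(* Cauchy's estimate, by averaging over the N-th roots of unity, N -> infinity. *)
Lemma pser_coeff_bound (c : nat -> C) (y M : R) (n : nat) : disc_summable c -> 0 < y ->
  (forall x, Cmod (pser c (nome (x, y))) <= M) ->
  Cmod (c n) * exp (- (2 * PI * y)) ^ n <= M.
Proof.
  intros Hc Hy HM. set (r := exp (- (2 * PI * y))).
  assert (Hr : 0 < r < 1).
  { split; [apply exp_pos|]. unfold r. rewrite <- exp_0. apply exp_increasing.
    pose proof PI_RGT_0. nra. }
  assert (Hs : ex_series (fun m => Cmod (c m) * r ^ m)) by (apply Hc; lra).
  apply le_epsilon. intros eps He.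
  destruct (Series_tail_small _ eps Hs He) as [N0 HN0].
  set (N := (N0 + n + 1)%nat). specialize (HN0 N ltac:(unfold N; lia)).
  assert (HN : INR N <> 0) by (apply not_0_INR; unfold N; lia).
  assert (HNC : RtoC (INR N) <> 0) by (apply C_of_R_nz; auto).
  (* [A m] averages exp (2 PI i (m - n) j / N) over j: it is 1 at m = n, 0 at the other m < N, and
     of modulus at most 1 beyond. *)
  set (z := fun m : nat => nome ((IZR (Z.of_nat m - Z.of_nat n)) / INR N)).
  set (A := fun m => (/ INR N * csum (fun j => z m ^ j) N)%C).
  assert (Hz1 : forall m, Cmod (z m) = 1).
  { intros m. unfold z. rewrite Cmod_nome.
    replace (Im (IZR (Z.of_nat m - Z.of_nat n) / INR N)) with 0 by (simpl; field; auto).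
    rewrite Rmult_0_r, Ropp_0, exp_0. auto. }
  assert (HinvN : forall w, Cmod (/ INR N * w) = / INR N * Cmod w).
  { intros w. rewrite Cmod_mult, Cmod_inv, Cmod_RtoC_nonneg by (auto using pos_INR). auto. }
  assert (HA1 : forall m, Cmod (A m) <= 1).
  { intros m. unfold A. rewrite HinvN.
    apply Rmult_le_reg_l with (INR N); [apply lt_0_INR; unfold N; lia|].
    rewrite <- Rmult_assoc, Rinv_r, Rmult_1_l by auto. apply Cmod_csum_const_le.
    intros k _. rewrite Cmod_pow, Hz1, pow1. lra. }
  assert (HAn : A n = 1).
  { unfold A, z. rewrite Z.sub_diag. unfold Cdiv. rewrite Cmult_0_l.
    replace (nome 0) with (RtoC 1) by (unfold nome; rewrite Cmult_0_r, Cexp_0; auto).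
    assert (E : forall K, csum (fun j => (RtoC 1) ^ j)%C K = RtoC (INR K)).
    { induction K; [reflexivity|]. cbn [csum]. rewrite IHK, Cpow_1_l, S_INR, RtoC_plus. auto. }
    rewrite E. field. auto. }
  assert (HA0 : forall m, (m < N)%nat -> m <> n -> A m = 0).
  { intros m Hm Hmn. unfold A.
    assert (Hzn : z m <> 1).
    { assert (P : forall t : R, 0 < t < 1 -> nome t <> 1).
      { intros t Ht. apply nome_ne_1; simpl; try lra. intros k E. apply (f_equal Re) in E. simpl in E.
        assert (K1 : (-1 < k)%Z) by (apply lt_IZR; lra).
        assert (K2 : (k < 0)%Z) by (apply lt_IZR; lra). lia. }
      assert (INR_N : 0 < INR N) by (apply lt_0_INR; unfold N; lia).
      unfold z. destruct (Nat.lt_trichotomy m n) as [h|[h|h]]; [|contradiction|].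
      - rewrite <- nome_add_1.
        replace (IZR (Z.of_nat m - Z.of_nat n) / INR N + 1)%C with (RtoC (INR (m + N - n) / INR N)).
        + apply P. split; [apply Rdiv_lt_0_compat; auto; apply lt_0_INR; unfold N in *; lia|].
          apply Rlt_div_l; auto. rewrite Rmult_1_l. apply lt_INR. unfold N in *; lia.
        + rewrite minus_INR, plus_INR, minus_IZR, <- !INR_IZR_INZ by (unfold N; lia).
          rewrite RtoC_div, !RtoC_minus, RtoC_plus by auto. field. auto.
      - replace (IZR (Z.of_nat m - Z.of_nat n) / INR N)%C with (RtoC (INR (m - n) / INR N)).
        + apply P. split; [apply Rdiv_lt_0_compat; auto; apply lt_0_INR; unfold N in *; lia|].
          apply Rlt_div_l; auto. rewrite Rmult_1_l. apply lt_INR. unfold N in *; lia.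
        + rewrite minus_INR, minus_IZR, <- !INR_IZR_INZ by lia. rewrite RtoC_div by auto. auto. }
    assert (E : csum (fun j => z m ^ j)%C N = 0).
    { apply Cmult_eq_reg_l with (1 - z m)%C.
      - intros F. apply Hzn. replace (z m) with (1 - (1 - z m))%C by ring. rewrite F; ring.
      - rewrite csum_geom, Cmult_0_r. unfold z. rewrite <- nome_INR_mult.
        replace (INR N * (IZR (Z.of_nat m - Z.of_nat n) / INR N))%C
          with (0 + IZR (Z.of_nat m - Z.of_nat n))%C by (field; auto).
        rewrite nome_add_Z. unfold nome. rewrite Cmult_0_r, Cexp_0. ring. }
    rewrite E. ring. }
  set (x := fun j : nat => INR j / INR N).
  assert (Enome : forall j, nome (x j, y) = (r * nome (x j))%C).
  { intros j. replace ((x j, y) : C) with (x j + Ci * y)%C by (apply C_ext; simpl; ring).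
    rewrite nome_plus, Cmult_comm. f_equal. unfold nome, r. rewrite <- Cexp_RtoC. f_equal.
    apply C_ext; simpl; ring. }
  assert (Hq : forall j, Cmod (nome (x j, y)) < 1) by (intros; apply Cmod_nome_lt_1; auto).
  (* The factor of modulus 1 in front singles out the coefficient of index n when the average over j
     is taken. *)
  set (b := fun (j m : nat) => (nome (- (INR n * x j)) * (c m * nome (x j, y) ^ m))%C).
  assert (Hb : forall j m, Cmod (b j m) <= Cmod (c m) * r ^ m).
  { intros j m. unfold b. rewrite !Cmod_mult, Cmod_pow, !Cmod_nome. simpl Im. fold r.
    replace (- (2 * PI * - (INR n * 0 + 0 * x j))) with 0 by ring. rewrite exp_0. lra. }
  destruct (CSeries_csum b (fun j m => Cmod (c m) * r ^ m) N Hb (fun _ => Hs)) as [EE _].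
  assert (Avg : Cmod (/ INR N * csum (fun j => CSeries (b j)) N) <= M).
  { rewrite HinvN.
    apply Rmult_le_reg_l with (INR N); [apply lt_0_INR; unfold N; lia|].
    rewrite <- Rmult_assoc, Rinv_r, Rmult_1_l by auto. apply Cmod_csum_const_le.
    intros j _. unfold b. rewrite CSeries_scal by (apply cabs_pser; auto).
    rewrite Cmod_mult, Cmod_nome.
    replace (- (2 * PI * Im (- (INR n * x j)))) with 0 by (simpl; ring).
    rewrite exp_0, Rmult_1_l. apply HM. }
  rewrite <- EE in Avg.
  assert (Et : forall m, (/ INR N * csum (fun j => b j m) N = c m * r ^ m * A m)%C).
  { intros m. unfold A. replace (c m * r ^ m * (/ INR N * csum (fun j => z m ^ j) N))%C
      with (/ INR N * (c m * r ^ m * csum (fun j => z m ^ j) N))%C by ring.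
    f_equal. rewrite <- csum_scal. apply csum_ext. intros j _. unfold b.
    rewrite Enome, Cpow_mult_l, <- nome_INR_mult. unfold z. rewrite <- nome_INR_mult.
    rewrite <- !Cmult_assoc. rewrite (Cmult_comm (nome _)), <- !Cmult_assoc. do 2 f_equal.
    rewrite <- nome_plus. f_equal. unfold x. rewrite minus_IZR, <- !INR_IZR_INZ.
    rewrite RtoC_div, RtoC_minus by auto. field. auto. }
  assert (Hbs : cabs (fun m => csum (fun j => b j m) N)).
  { apply (CSeries_csum b (fun j m => Cmod (c m) * r ^ m) N Hb (fun _ => Hs)). }
  rewrite <- CSeries_scal in Avg by exact Hbs. rewrite (CSeries_ext _ _ Et) in Avg.
  assert (Hd : forall m, Cmod (c m * r ^ m * A m) <= Cmod (c m) * r ^ m).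
  { intros m. rewrite !Cmod_mult, Cmod_pow, Cmod_RtoC_nonneg by lra.
    rewrite <- (Rmult_1_r (Cmod (c m) * r ^ m)) at 2. apply Rmult_le_compat_l; auto.
    apply Rmult_le_pos; [apply Cmod_ge_0 | apply pow_le; lra]. }
  rewrite (CSeries_incr_n _ N) in Avg by (apply (cabs_le _ _ Hd Hs)).
  rewrite (csum_single _ n N) in Avg; [|unfold N; lia | intros k Hk Hkn; rewrite HA0 by auto; ring].
  rewrite HAn, Cmult_1_r in Avg.
  (* Indices beyond N may alias with n, but N was chosen to make this tail of the majorant at most
     eps. *)
  assert (Tl : Cmod (CSeries (fun k => (c (N + k)%nat * r ^ (N + k) * A (N + k)%nat)%C)) <= eps).
  { eapply Rle_trans; [apply (Cmod_CSeries_le _ (fun k => Cmod (c (N + k)%nat) * r ^ (N + k)))|].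
    - intros k. apply Hd.
    - apply (ex_series_incr_n (fun m => Cmod (c m) * r ^ m) N); auto.
    - eapply Rle_trans; [apply Rle_abs | exact HN0]. }
  set (t := CSeries (fun k => (c (N + k)%nat * r ^ (N + k) * A (N + k)%nat)%C)) in *.
  replace (Cmod (c n) * r ^ n) with (Cmod (c n * r ^ n)) by
    (rewrite Cmod_mult, Cmod_pow, Cmod_RtoC_nonneg; lra).
  pose proof (Cmod_sub_ge (c n * r ^ n) (- t)) as Q. rewrite Cmod_opp in Q.
  replace (c n * r ^ n - - t)%C with (c n * r ^ n + t)%C in Q by ring. lra.
Qed.

Lemma sigma_le (k n : nat) : INR (Defs.sigma k n) <= INR n * (INR n) ^ k.
Proof.
  rewrite <- (Cmod_RtoC_nonneg (INR (Defs.sigma k n))) by apply pos_INR.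
  rewrite sigma_csum. apply Cmod_csum_const_le. intros d Hd.
  destruct (_ =? _)%nat.
  - rewrite Cmod_pow, Cmod_RtoC_nonneg by apply pos_INR. apply pow_incr. split; [apply pos_INR | apply le_INR; lia].
  - rewrite Cmod_0. apply pow_le, pos_INR.
Qed.

Definition eisenstein_coeff (a : R) (k n : nat) : C :=
  match n with O => 1 | S _ => (a * INR (Defs.sigma k n))%R end.

Lemma disc_summable_eisenstein (a : R) (k : nat) : disc_summable (eisenstein_coeff a k).
Proof.
  intros r Hr. apply (ex_series_incr_1 (fun n => Cmod (eisenstein_coeff a k n) * r ^ n)).
  apply ex_series_le_nonneg with (b := fun n => Rabs a * ((INR n + 1) ^ S k * r ^ n)).
  - intros n. cbn [eisenstein_coeff]. rewrite Cmod_R, Rabs_mult, (Rabs_pos_eq (INR _)) by apply pos_INR.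
    assert (R1 : 0 <= r ^ S n <= r ^ n) by (split; [apply pow_le; lra | apply pow_antitone; [lra | lia]]).
    pose proof (pos_INR (Defs.sigma k (S n))) as P. pose proof (Rabs_pos a).
    split; [apply Rmult_le_pos; [apply Rmult_le_pos|]; tauto|].
    rewrite Rmult_assoc. apply Rmult_le_compat_l; auto. apply Rmult_le_compat; try lra.
    eapply Rle_trans; [apply sigma_le|]. rewrite S_INR. apply Req_le. reflexivity.
  - apply ex_series_Rscal, ex_series_poly_geom; auto.
Qed.

Lemma pser_eisenstein (a : R) (k : nat) (tau : C) : 0 < Im tau ->
  pser (eisenstein_coeff a k) (nome tau) = (1 + a * divisor_series k tau)%C.
Proof.
  intros Hy. pose proof (Cmod_nome_lt_1 tau Hy) as Hq. unfold pser.
  pose proof (cabs_pser _ _ (disc_summable_eisenstein a k) Hq) as Ha.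
  rewrite (CSeries_incr_1 _ Ha). f_equal; [simpl; ring|]. unfold divisor_series.
  destruct (Req_dec a 0) as [->|Hn].
  - rewrite Cmult_0_l. rewrite (CSeries_ext _ (fun _ => RtoC 0)).
    + unfold CSeries. rewrite !Series_zero; auto.
    + intros n. cbn [eisenstein_coeff]. rewrite RtoC_mult. ring.
  - rewrite <- CSeries_scal.
    + apply CSeries_ext. intros n. cbn [eisenstein_coeff]. rewrite RtoC_mult. ring.
    + apply (cabs_incr_n _ 1), (cabs_scal (/ a)) in Ha. eapply cabs_ext; [|exact Ha].
      intros n. cbn [eisenstein_coeff Nat.add]. rewrite RtoC_mult. field. apply C_of_R_nz; auto.
Qed.

(** * The q-expansion of the discriminant and its invariant norm *)

Definition E4_coeff : nat -> C := eisenstein_coeff 240 3.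
Definition E6_coeff : nat -> C := eisenstein_coeff (-504) 5.
Definition E4_cube_coeff : nat -> C := cconv E4_coeff (cconv E4_coeff E4_coeff).
Definition disc_coeff (n : nat) : C := (E4_cube_coeff n - cconv E6_coeff E6_coeff n)%C.

Definition discriminant (tau : C) : C := (E4 tau ^ 3 - E6 tau ^ 2)%C.

Lemma disc_summable_E4_cube : disc_summable E4_cube_coeff.
Proof. repeat apply disc_summable_cconv; apply disc_summable_eisenstein. Qed.

Lemma disc_summable_disc_coeff : disc_summable disc_coeff.
Proof.
  apply disc_summable_minus; [apply disc_summable_E4_cube|].
  apply disc_summable_cconv; apply disc_summable_eisenstein.
Qed.

Lemma E4_cube_pser (tau : C) : 0 < Im tau -> (E4 tau ^ 3)%C = pser E4_cube_coeff (nome tau).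
Proof.
  intros Hy. pose proof (Cmod_nome_lt_1 tau Hy) as Hq.
  pose proof (disc_summable_eisenstein 240 3) as S.
  unfold E4_cube_coeff, E4_coeff. rewrite !pser_cconv, pser_eisenstein by auto using disc_summable_cconv.
  unfold E4. ring.
Qed.

Lemma discriminant_pser (tau : C) : 0 < Im tau -> discriminant tau = pser disc_coeff (nome tau).
Proof.
  intros Hy. pose proof (Cmod_nome_lt_1 tau Hy) as Hq.
  pose proof (disc_summable_eisenstein (-504) 5) as S.
  unfold disc_coeff. rewrite pser_minus by auto using disc_summable_cconv, disc_summable_E4_cube.
  rewrite <- E4_cube_pser, pser_cconv by auto. unfold E6_coeff. rewrite pser_eisenstein by auto.
  unfold discriminant, E6. ring.
Qed.

Lemma disc_coeff_0 : disc_coeff 0 = 0.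
Proof. unfold disc_coeff, E4_cube_coeff, cconv; simpl. ring. Qed.

(** The value is 3 * 240 + 2 * 504; that it is non-zero excludes Delta = 0 identically. *)
Lemma disc_coeff_1 : disc_coeff 1 = 1728.
Proof.
  unfold disc_coeff, E4_cube_coeff, cconv, E4_coeff, E6_coeff, eisenstein_coeff. simpl.
  apply C_ext; simpl; ring.
Qed.

Lemma discriminant_add_Z (tau : C) (n : Z) : discriminant (tau + IZR n) = discriminant tau.
Proof. unfold discriminant, E4, E6, divisor_series. rewrite nome_add_Z. auto. Qed.

Lemma discriminant_inversion (tau : C) : 0 < Im tau ->
  discriminant (- / tau) = (tau ^ 12 * discriminant tau)%C.
Proof. intros H. unfold discriminant. rewrite E4_inversion, E6_inversion by auto. ring. Qed.

Definition disc_norm (tau : C) : R := Cmod (discriminant tau) * Im tau ^ 6.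

Lemma Im_add_Z (tau : C) (n : Z) : Im (tau + IZR n) = Im tau.
Proof. unfold Im; simpl; ring. Qed.

Lemma Im_opp_inv (tau : C) : Im (- / tau) = Im tau / Cmod tau ^ 2.
Proof. rewrite Cmod2_alt. unfold Im, Re; simpl. unfold Rdiv. ring. Qed.

Lemma disc_norm_add_Z (tau : C) (n : Z) : disc_norm (tau + IZR n) = disc_norm tau.
Proof. unfold disc_norm. rewrite discriminant_add_Z, Im_add_Z. auto. Qed.

Lemma disc_norm_inversion (tau : C) : 0 < Im tau -> disc_norm (- / tau) = disc_norm tau.
Proof.
  intros H. unfold disc_norm. rewrite discriminant_inversion, Im_opp_inv, Cmod_mult, Cmod_pow by auto.
  pose proof (proj1 (Cmod_gt_0 tau) (Im_pos_nz tau H)). field. lra.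
Qed.

Lemma translate_to_strip (x : R) : exists n : Z, Rabs (x + IZR n) <= / 2.
Proof.
  destruct (archimed (x + / 2)) as [A B]. exists (1 - up (x + / 2))%Z.
  rewrite minus_IZR. apply Rabs_le. lra.
Qed.

Lemma pow_unbounded (x K : R) : 0 < x -> exists n, K <= (1 + x) ^ n.
Proof.
  intros Hx. destruct (archimed (K / x)) as [A _].
  exists (Z.to_nat (up (K / x))).
  assert (B : forall n, 1 + INR n * x <= (1 + x) ^ n).
  { induction n; [simpl; lra|]. rewrite S_INR. simpl.
    pose proof (pos_INR n). assert (0 <= INR n * x * x) by (repeat apply Rmult_le_pos; lra).
    assert ((1 + x) * (1 + INR n * x) <= (1 + x) * (1 + x) ^ n) by (apply Rmult_le_compat_l; lra). lra. }
  specialize (B (Z.to_nat (up (K / x)))).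
  assert (K / x <= INR (Z.to_nat (up (K / x)))).
  { destruct (Z_le_gt_dec 0 (up (K / x))) as [h|h].
    - rewrite INR_IZR_INZ, Z2Nat.id by auto. lra.
    - assert (IZR (up (K / x)) <= 0) by (apply IZR_le; lia). pose proof (pos_INR (Z.to_nat (up (K / x)))). lra. }
  assert (K <= INR (Z.to_nat (up (K / x))) * x) by (apply Rle_div_l in H; auto). lra.
Qed.

(* A point with |Re| <= 1/2 and Im < 43/50 has |tau|^2 < 100/101, so each inversion
   raises the imaginary part by a fixed factor. *)
Lemma move_up (tau : C) : 0 < Im tau ->
  exists tau', 43 / 50 <= Im tau' /\ disc_norm tau' = disc_norm tau.
Proof.
  assert (G : forall n tau, 0 < Im tau -> 43 / 50 <= Im tau * (1 + / 100) ^ n ->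
    exists tau', 43 / 50 <= Im tau' /\ disc_norm tau' = disc_norm tau).
  { induction n; intros t Ht Hn.
    - exists t. split; auto. simpl in Hn. lra.
    - destruct (Rle_lt_dec (43 / 50) (Im t)) as [h|h]; [exists t; auto|].
      destruct (translate_to_strip (Re t)) as [m Hm]. set (t1 := (t + IZR m)%C).
      assert (I1 : Im t1 = Im t) by apply Im_add_Z.
      assert (R1 : Re t1 = Re t + IZR m) by (unfold t1, Re; simpl; ring).
      assert (I1p : 0 < Im t1) by lra.
      pose proof (proj1 (Cmod_gt_0 t1) (Im_pos_nz t1 I1p)) as C1.
      (* 1/4 + (43/50)^2 = 0.9896, just below 100/101. *)
      assert (N1 : Cmod t1 ^ 2 <= 100 / 101).
      { rewrite Cmod2_alt, R1, I1. rewrite <- (pow2_abs (Re t + IZR m)).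
        pose proof (Rabs_pos (Re t + IZR m)). nra. }
      assert (I2 : Im t * (1 + / 100) <= Im (- / t1)).
      { rewrite Im_opp_inv, I1. assert (Hp : 0 < Cmod t1 ^ 2) by (apply pow_lt; auto).
        apply (Rle_div_r _ _ _ Hp). nra. }
      destruct (IHn (- / t1)%C) as [t2 [A B]].
      + apply Im_inv_opp_pos; auto.
      + eapply Rle_trans; [exact Hn|]. simpl. rewrite <- Rmult_assoc. apply Rmult_le_compat_r; auto.
        apply pow_le; lra.
      + exists t2. split; auto. rewrite B, disc_norm_inversion by auto. apply disc_norm_add_Z. }
  intros H. destruct (pow_unbounded (/ 100) (43 / 50 / Im tau)) as [n Hn]; [lra|].
  apply (G n); auto. apply Rle_div_l in Hn; auto. lra.
Qed.

(** * Numerical bounds for pi, exp and the contraction factor *)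

Lemma PI_lt_3_2 : PI < 3.2.
Proof.
  apply Rnot_le_lt. intros H.
  (* If 1.6 <= PI / 2 then cos 1.6 >= 0, whereas the Taylor polynomial of degree 4, an upper bound,
     is negative at 1.6. *)
  pose proof (pre_cos_bound 1.6 0 ltac:(lra) ltac:(lra)) as [_ P].
  unfold cos_approx, cos_term in P. simpl in P.
  pose proof (cos_ge_0 1.6 ltac:(lra) ltac:(lra)). lra.
Qed.

Lemma PI_gt_3 : 3 < PI.
Proof. pose proof PI2_3_2. lra. Qed.

Lemma exp_pow_128 (x : R) : exp x = exp (x / 128) ^ 128.
Proof.
  assert (G : forall n t, exp (INR n * t) = exp t ^ n).
  { induction n; intros t.
    - rewrite Rmult_0_l. apply exp_0.
    - rewrite S_INR, Rmult_plus_distr_r, exp_plus, IHn, Rmult_1_l. simpl. ring. }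
  rewrite <- G. f_equal. replace (INR 128) with 128 by (rewrite INR_IZR_INZ; reflexivity). field.
Qed.

(** The tangent bound applied at x / 128 is sharp enough for all numerical estimates below, and its
    instances are rational arithmetic. *)
Lemma exp_ge_pow (x : R) : -1 <= x / 128 -> (1 + x / 128) ^ 128 <= exp x.
Proof.
  intros H. rewrite exp_pow_128. apply pow_incr. split; [lra | apply exp_ineq1_le].
Qed.

Lemma exp_1_ge : 2.7 <= exp 1.
Proof. eapply Rle_trans; [|apply exp_ge_pow; lra]. simpl. lra. Qed.

Lemma exp_ge_linear (x : R) : exp 1 * x <= exp x.
Proof.
  replace x with (1 + (x - 1)) at 2 by ring. rewrite exp_plus.
  apply Rmult_le_compat_l; [left; apply exp_pos|]. pose proof (exp_ineq1_le (x - 1)). lra.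
Qed.

(** The tangent of exp at 1 gives e t <= exp t; for t = PI y / 3, which is at least y, the sixth
    power of the right side is exp (2 PI y). *)
Lemma pow6_exp_le (y : R) : 0 <= y -> y ^ 6 * exp (- (2 * PI * y)) <= / 2.7 ^ 6.
Proof.
  intros Hy. pose proof PI_gt_3 as HP. pose proof exp_1_ge as He.
  assert (E : 2.7 * y <= exp (PI * y / 3)).
  { eapply Rle_trans; [|apply exp_ge_linear]. apply Rmult_le_compat; try lra.
    assert (3 * y <= PI * y) by (apply Rmult_le_compat_r; lra). lra. }
  assert (E6 : (2.7 * y) ^ 6 <= exp (2 * PI * y)).
  { replace (exp (2 * PI * y)) with (exp (PI * y / 3) ^ 6).
    - apply pow_incr. lra.
    - simpl. rewrite Rmult_1_r, <- !exp_plus. f_equal. field. }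
  rewrite exp_Ropp. pose proof (exp_pos (2 * PI * y)). set (X := exp (2 * PI * y)) in *.
  rewrite Rpow_mult_distr in E6. apply Rle_div_l; auto. rewrite Rmult_comm.
  apply Rmult_le_reg_l with (2.7 ^ 6); [apply pow_lt; lra|].
  rewrite <- Rmult_assoc, (Rmult_comm _ X), Rmult_assoc, Rinv_r by (apply pow_nonzero; lra). lra.
Qed.

(** The bounds 2.5 and 0.12 for the two exponentials, from 0.28 * 3.2 = 0.896 and 0.72 * 3 = 2.16,
    leave about 0.94. *)
Lemma theta_lt_1 : 128 * exp (0.28 * PI) / (1 - exp (- (0.72 * PI))) * / 2.7 ^ 6 < 1.
Proof.
  pose proof PI_gt_3 as P3. pose proof PI_lt_3_2 as P4.
  assert (A : exp (0.28 * PI) <= 2.5).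
  { apply Rle_trans with (exp 0.896); [apply exp_monotone; lra|].
    replace 0.896 with (- (- 0.896)) by lra. rewrite exp_Ropp.
    rewrite <- (Rinv_inv 2.5). apply Rinv_le_contravar; [lra|].
    eapply Rle_trans; [|apply exp_ge_pow; lra]. simpl. lra. }
  assert (B : exp (- (0.72 * PI)) <= 0.12).
  { apply Rle_trans with (exp (- (2.16))); [apply exp_monotone; lra|]. rewrite exp_Ropp.
    rewrite <- (Rinv_inv 0.12). apply Rinv_le_contravar; [lra|].
    eapply Rle_trans; [|apply exp_ge_pow; lra]. simpl. lra. }
  pose proof (exp_pos (0.28 * PI)).
  apply Rmult_lt_reg_r with (2.7 ^ 6); [apply pow_lt; lra|].
  rewrite Rmult_assoc, Rinv_l, Rmult_1_r by (apply pow_nonzero; lra).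
  apply Rlt_div_l; [lra|]. simpl. lra.
Qed.

(** * The contraction argument for Delta / q *)

Definition disc_tail (q : C) : C := pser (fun n => disc_coeff (S n)) q.

Lemma discriminant_tail (tau : C) : 0 < Im tau -> discriminant tau = (nome tau * disc_tail (nome tau))%C.
Proof.
  intros Hy. rewrite discriminant_pser by auto.
  rewrite pser_incr_1, disc_coeff_0; auto using disc_summable_disc_coeff, Cmod_nome_lt_1.
  unfold disc_tail. ring.
Qed.

Lemma Cmod_nome_le (tau : C) (c : R) : c <= Im tau -> Cmod (nome tau) <= exp (- (2 * PI * c)).
Proof. intros H. rewrite Cmod_nome. apply exp_monotone. pose proof PI_RGT_0. nra. Qed.

Lemma disc_norm_le_tail (tau : C) : 0 < Im tau ->
  disc_norm tau <= / 2.7 ^ 6 * Cmod (disc_tail (nome tau)).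
Proof.
  intros Hy. unfold disc_norm. rewrite discriminant_tail, Cmod_mult, Cmod_nome by auto.
  pose proof (pow6_exp_le (Im tau) ltac:(lra)) as P.
  pose proof (Cmod_ge_0 (disc_tail (nome tau))) as Q.
  apply (Rmult_le_compat_r _ _ _ Q) in P. lra.
Qed.

(** By [move_up] only Im >= 43/50 matters, where |q| stays below a fixed r < 1 and Delta / q is
    bounded by its series of moduli at r. *)
Lemma disc_norm_bounded : exists K, forall tau, 0 < Im tau -> disc_norm tau <= K.
Proof.
  set (r := exp (- (2 * PI * (43 / 50)))).
  assert (Hr : 0 <= r < 1).
  { split; [left; apply exp_pos|]. unfold r. rewrite <- exp_0. apply exp_increasing. pose proof PI_RGT_0. nra. }
  pose proof (disc_summable_shift _ disc_summable_disc_coeff r Hr) as S. cbv beta in S.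
  exists (/ 2.7 ^ 6 * Series (fun n => Cmod (disc_coeff (Datatypes.S n)) * r ^ n)).
  intros tau Hy. destruct (move_up tau Hy) as [t [Ht <-]].
  eapply Rle_trans; [apply disc_norm_le_tail; lra|].
  apply Rmult_le_compat_l; [left; apply Rinv_0_lt_compat, pow_lt; lra|].
  apply Cmod_CSeries_le; auto. intros n. rewrite Cmod_mult, Cmod_pow.
  apply Rmult_le_compat_l; [apply Cmod_ge_0|]. apply pow_incr.
  split; [apply Cmod_ge_0 | apply Cmod_nome_le; auto].
Qed.

(** On the line Im = 1/2 one has |q| = exp (- PI) and Im^6 = 1/64, so |Delta| <= 64 M there. *)
Lemma disc_coeff_bound (M : R) : (forall tau, 0 < Im tau -> disc_norm tau <= M) ->
  forall n, Cmod (disc_coeff n) * exp (- PI) ^ n <= 64 * M.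
Proof.
  intros HM n. replace (- PI) with (- (2 * PI * / 2)) by field.
  apply pser_coeff_bound; [apply disc_summable_disc_coeff | lra|].
  intros x. assert (Hy : 0 < Im (x, / 2)) by (simpl; lra).
  rewrite <- discriminant_pser by auto. specialize (HM (x, / 2) Hy).
  unfold disc_norm in HM. simpl Im in HM. lra.
Qed.

(* If the discriminant vanished at t0, then h = Delta / q would satisfy h(q) = h(q) - h(q0),
   and the coefficient bounds coming from the level Im = 1/2 would contract the supremum of
   |Delta| Im^6. *)
Lemma disc_norm_contraction (t0 : C) (M : R) : 43 / 50 <= Im t0 -> discriminant t0 = 0 ->
  (forall tau, 0 < Im tau -> disc_norm tau <= M) ->
  forall tau, 0 < Im tau ->
  disc_norm tau <= 128 * exp (0.28 * PI) / (1 - exp (- (0.72 * PI))) * / 2.7 ^ 6 * M.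
Proof.
  intros H0 HD HM tau Hy. destruct (move_up tau Hy) as [t [Ht <-]].
  assert (HM0 : 0 <= M).
  { eapply Rle_trans; [|apply (HM t); lra]. apply Rmult_le_pos; [apply Cmod_ge_0 | apply pow_le; lra]. }
  pose proof (disc_coeff_bound M HM) as HB.
  pose proof PI_gt_3 as HPI.
  (* r is |q| at height 1/2, and r x bounds |q| at heights from 43/50 on, since 2 * 43/50 = 1 +
     0.72. *)
  set (r := exp (- PI)) in *. set (x := exp (- (0.72 * PI))) in *.
  assert (Hr : 0 < r) by apply exp_pos.
  assert (Hx : 0 < x < 1).
  { split; [apply exp_pos|]. unfold x. rewrite <- exp_0. apply exp_increasing. lra. }
  assert (Hq : forall s, 43 / 50 <= Im s -> Cmod (nome s) <= r * x).
  { intros s Hs. eapply Rle_trans; [apply Cmod_nome_le; eauto|]. unfold r, x. rewrite <- exp_plus.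
    apply exp_monotone. lra. }
  assert (Er : exp (0.28 * PI) = x * / r).
  { unfold x, r. rewrite <- exp_Ropp, <- exp_plus. f_equal. lra. }
  rewrite Er. eapply Rle_trans; [apply disc_norm_le_tail; lra|].
  replace (128 * (x * / r) / (1 - x) * / 2.7 ^ 6 * M) with
    (/ 2.7 ^ 6 * (128 * M * x * / r * / (1 - x))) by (unfold Rdiv; ring).
  apply Rmult_le_compat_l; [left; apply Rinv_0_lt_compat, pow_lt; lra|].
  assert (Ht0 : disc_tail (nome t0) = 0).
  { apply Cmult_eq_reg_l with (nome t0); [apply nome_nz|].
    rewrite <- discriminant_tail by lra. rewrite HD. ring. }
  replace (disc_tail (nome t)) with (disc_tail (nome t) - disc_tail (nome t0))%C by (rewrite Ht0; ring).
  pose proof (disc_summable_shift _ disc_summable_disc_coeff) as S1.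
  pose proof (disc_summable_shift _ S1) as S2. cbv beta in S2.
  assert (Q1 : Cmod (nome t) < 1) by (apply Cmod_nome_lt_1; lra).
  assert (Q0 : Cmod (nome t0) < 1) by (apply Cmod_nome_lt_1; lra).
  unfold disc_tail. rewrite (pser_incr_1 _ _ S1 Q1), (pser_incr_1 _ _ S1 Q0).
  set (c2 := fun n => disc_coeff (S (S n))) in *.
  (* The coefficient [disc_coeff 1] cancels in the difference; of the rest, each of the two points
     contributes at most 64 M r^-(n+2) (r x)^(n+1), and 128 = 2 * 64. *)
  set (u := fun n => 128 * M * x * / r * x ^ n).
  assert (Hu : ex_series u).
  { apply (ex_series_Rscal (128 * M * x * / r) (fun n => x ^ n)). apply ex_series_geom.
    rewrite Rabs_pos_eq; lra. }
  assert (Su : Series u = 128 * M * x * / r * / (1 - x)).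
  { unfold u. rewrite Series_scal_l, Series_geom; auto. rewrite Rabs_pos_eq; lra. }
  rewrite <- Su.
  replace (disc_coeff 1 + nome t * pser c2 (nome t) - (disc_coeff 1 + nome t0 * pser c2 (nome t0)))%C
    with (CSeries (fun n => nome t * (c2 n * nome t ^ n) + - nome t0 * (c2 n * nome t0 ^ n)))%C.
  2: { rewrite CSeries_plus, !CSeries_scal by (try apply cabs_scal; apply cabs_pser; auto).
       unfold pser. ring. }
  apply Cmod_CSeries_le; auto. intros n.
  assert (Bn : Cmod (c2 n) * r ^ S (S n) <= 64 * M) by apply HB.
  assert (T : forall s, 43 / 50 <= Im s -> Cmod (nome s) ^ S n * Cmod (c2 n) <= 64 * M * x * / r * x ^ n).
  { intros s Hs. pose proof (Cmod_ge_0 (c2 n)) as P2.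
    apply Rle_trans with ((r * x) ^ S n * Cmod (c2 n)).
    - apply Rmult_le_compat_r; auto. apply pow_incr. split; [apply Cmod_ge_0 | auto].
    - rewrite Rpow_mult_distr.
      replace (r ^ S n * x ^ S n * Cmod (c2 n)) with (Cmod (c2 n) * r ^ S (S n) * (x ^ S n * / r)) by (simpl; field; lra).
      replace (64 * M * x * / r * x ^ n) with (64 * M * (x ^ S n * / r)) by (simpl; ring).
      apply Rmult_le_compat_r; auto. apply Rmult_le_pos; [apply pow_le; lra | left; apply Rinv_0_lt_compat; auto]. }
  eapply Rle_trans; [apply Cmod_triangle|].
  rewrite !Cmod_mult, Cmod_opp, !Cmod_pow.
  pose proof (T t Ht) as T1. pose proof (T t0 H0) as T0. simpl in T1, T0. unfold u. lra.
Qed.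

(** The contraction forces the supremum M to be at most 0; Cauchy's estimate then bounds the first
    coefficient, which is 1728, by 0. *)
Theorem discriminant_nz (tau : C) : 0 < Im tau -> discriminant tau <> 0.
Proof.
  intros Hy HD.
  destruct (completeness (fun x => exists t, 0 < Im t /\ x = disc_norm t)) as [M [HM1 HM2]].
  - destruct disc_norm_bounded as [K HK]. exists K. intros x [t [Ht ->]]. auto.
  - exists (disc_norm tau), tau. auto.
  - assert (HM : forall t, 0 < Im t -> disc_norm t <= M) by (intros t Ht; apply HM1; exists t; auto).
    destruct (move_up tau Hy) as [t0 [Ht0 E0]].
    assert (HD0 : discriminant t0 = 0).
    { apply Cmod_eq_0. unfold disc_norm in E0. rewrite HD, Cmod_0, Rmult_0_l in E0.
      apply Rmult_integral in E0. destruct E0 as [E0|E0]; auto.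
      assert (0 < Im t0 ^ 6) by (apply pow_lt; lra). lra. }
    pose proof (disc_norm_contraction t0 M Ht0 HD0 HM) as HC.
    pose proof theta_lt_1 as Hth. set (theta := _ * / 2.7 ^ 6) in *.
    assert (HM' : M <= theta * M) by (apply HM2; intros x [t [Ht ->]]; auto).
    assert (M <= 0) by nra.
    pose proof (disc_coeff_bound M HM 1) as B. rewrite disc_coeff_1, Cmod_RtoC_nonneg, pow_1 in B by lra.
    pose proof (exp_pos (- PI)). nra.
Qed.

(** * Invariance of j *)

Lemma j_add_Z (tau : C) (n : Z) : j (tau + IZR n) = j tau.
Proof. unfold j, E4, E6, divisor_series. rewrite nome_add_Z. auto. Qed.

Lemma j_inversion (tau : C) : 0 < Im tau -> j (- / tau) = j tau.
Proof.
  intros H. pose proof (discriminant_nz tau H) as D. unfold discriminant in D.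
  pose proof (Im_pos_nz tau H). unfold j. rewrite E4_inversion, E6_inversion by auto.
  replace ((tau ^ 4 * E4 tau) ^ 3 - (tau ^ 6 * E6 tau) ^ 2)%C
    with (tau ^ 12 * (E4 tau ^ 3 - E6 tau ^ 2))%C by ring.
  unfold Cdiv. rewrite Cinv_mul. replace (1728 * (tau ^ 4 * E4 tau) ^ 3 * (/ tau ^ 12 * / (E4 tau ^ 3 - E6 tau ^ 2)))%C
    with (1728 * E4 tau ^ 3 * / (E4 tau ^ 3 - E6 tau ^ 2) * (tau ^ 12 * / tau ^ 12))%C by ring.
  rewrite Cinv_r by (apply Cpow_nz; auto). ring.
Qed.

(* Euclid's algorithm on the bottom row. *)
Theorem j_SL2 (a b c d : Z) (tau : C) : (a * d - b * c = 1)%Z -> 0 < Im tau ->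
  j ((IZR a * tau + IZR b) / (IZR c * tau + IZR d)) = j tau.
Proof.
  remember (Z.abs_nat c) as n eqn:En. revert a b c d tau En.
  induction n as [n IH] using lt_wf_ind. intros a b c d tau En Hdet Hy.
  destruct (Z.eq_dec c 0) as [->|Hc].
  - assert (Had : (a * d = 1)%Z) by lia.
    apply Z.eq_mul_1 in Had as Ha. replace d with a in * by nia. clear IH Hdet.
    rewrite <- (j_add_Z tau (a * b)). f_equal. rewrite mult_IZR, RtoC_mult.
    destruct Ha as [->| ->]; try change (- (1))%Z with (-1)%Z; field; try (apply C_of_R_nz; lra).
  - set (m := (d / c)%Z). set (r := (d mod c)%Z).
    assert (Hd : d = (c * m + r)%Z) by (apply Z.div_mod; auto).
    assert (Hr : (Z.abs_nat r < n)%nat).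
    { subst n. unfold r. pose proof (Z.mod_pos_bound d c). pose proof (Z.mod_neg_bound d c). lia. }
    set (t1 := (tau + IZR m)%C).
    assert (Hy1 : 0 < Im t1) by (unfold t1; rewrite Im_add_Z; auto).
    set (t2 := (- / t1)%C).
    assert (Hy2 : 0 < Im t2) by (apply Im_inv_opp_pos; auto).
    (* In terms of -1 / (tau + m) the bottom row (c, d) becomes (r, -c), with |r| < |c|. *)
    assert (E : ((IZR a * tau + IZR b) / (IZR c * tau + IZR d) =
      (IZR (b - a * m) * t2 + IZR (- a)) / (IZR r * t2 + IZR (- c)))%C).
    { pose proof (Im_pos_nz t1 Hy1) as N1.
      assert (Et : tau = (t1 - IZR m)%C) by (unfold t1; ring).
      replace (IZR a * tau + IZR b)%C with (- t1 * (IZR (b - a * m) * t2 + IZR (- a)))%C.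
      - replace (IZR c * tau + IZR d)%C with (- t1 * (IZR r * t2 + IZR (- c)))%C.
        + unfold Cdiv. rewrite Cinv_mul.
          set (X := (IZR (b - a * m) * t2 + IZR (- a))%C). set (Y := (IZR r * t2 + IZR (- c))%C).
          replace (- t1 * X * (/ - t1 * / Y))%C with (- t1 * / - t1 * (X * / Y))%C by ring.
          rewrite Cinv_r; [ring|]. intros F. apply N1. rewrite <- (Cmult_1_l t1).
          replace (1 * t1)%C with (- - t1)%C by ring. rewrite F. ring.
        + rewrite Et, Hd. unfold t2. rewrite opp_IZR, plus_IZR, mult_IZR, RtoC_opp, RtoC_plus, RtoC_mult. field. auto.
      - rewrite Et. unfold t2. rewrite opp_IZR, minus_IZR, mult_IZR, RtoC_opp, RtoC_minus, RtoC_mult. field. auto. }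
    rewrite E. rewrite (IH _ Hr _ _ _ _ t2 eq_refl); auto.
    + unfold t2. rewrite j_inversion by auto. apply j_add_Z.
    + rewrite Hd in Hdet. lia.
Qed.

(** The q-expansions have real coefficients, and tau -> - conj tau conjugates q. *)
Lemma j_conj (tau : C) : j (- Cconj tau) = Cconj (j tau).
Proof.
  assert (HN : nome (- Cconj tau) = Cconj (nome tau)).
  { unfold nome. rewrite <- Cexp_conj. f_equal. apply C_ext; destruct tau; simpl; ring. }
  assert (HR : forall x : R, Cconj x = x) by (intros; apply C_ext; simpl; ring).
  assert (HD : forall k, divisor_series k (- Cconj tau) = Cconj (divisor_series k tau)).
  { intros k. unfold divisor_series. rewrite HN.
    transitivity (CSeries (fun n => Cconj (RtoC (INR (Defs.sigma k (S n))) * nome tau ^ S n))).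
    - apply CSeries_ext. intros n. rewrite Cmult_conj, Cpow_conj, HR. auto.
    - unfold CSeries. apply C_ext; [reflexivity|]. apply Series_opp. }
  assert (HI : forall z, Cconj (/ z) = (/ Cconj z)%C).
  { intros z. destruct (Ceq_dec z 0) as [->|Hz]; [|apply Cinv_conj; auto].
    rewrite Cinv_0, HR, Cinv_0. auto. }
  unfold j, E4, E6. rewrite !HD. unfold Cdiv.
  rewrite !Cmult_conj, HI, Cminus_conj, !Cpow_conj, Cminus_conj, !Cplus_conj, !Cmult_conj, !HR. auto.
Qed.

(** * Holomorphic functions *)

Definition ccont (f : C -> C) (z : C) : Prop :=
  forall x, clim x z -> clim (fun n => f (x n)) (f z).

(** A counterexample at each scale (1/2)^n would form, by choice, a sequence contradicting
    sequential continuity. *)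
Lemma ccont_eps f z : ccont f z ->
  forall eps, 0 < eps -> exists del, 0 < del /\ forall w, Cmod (w - z) < del -> Cmod (f w - f z) < eps.
Proof.
  intros H eps He.
  destruct (classic (exists del, 0 < del /\ forall w, Cmod (w - z) < del -> Cmod (f w - f z) < eps)) as [G|G]; auto.
  exfalso.
  assert (B : forall n : nat, exists w, Cmod (w - z) < (/ 2) ^ n /\ eps <= Cmod (f w - f z)).
  { intros n. apply NNPP. intros N. apply G. exists ((/ 2) ^ n). split; [apply pow_lt; lra|].
    intros w Hw. apply Rnot_le_lt. intros Hle. apply N. exists w; auto. }
  set (x := fun n => proj1_sig (constructive_indefinite_description _ (B n))).
  assert (Hx : forall n, Cmod (x n - z) < (/ 2) ^ n /\ eps <= Cmod (f (x n) - f z)).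
  { intros n. unfold x. destruct (constructive_indefinite_description _ (B n)). auto. }
  assert (L : clim x z).
  { apply clim_squeeze with (u := fun n => (/ 2) ^ n); [|apply is_lim_seq_inv_pow2].
    intros n. left. apply Hx. }
  destruct (clim_eps _ _ (H x L) (eps / 2)) as [N HN]; [lra|].
  specialize (HN N (Nat.le_refl _)). destruct (Hx N). lra.
Qed.

(* Caratheodory's form of complex differentiability: the difference quotient extends
   continuously. *)
Definition is_cderiv (f : C -> C) (z d : C) : Prop :=
  exists phi, (forall h, (f (z + h) - f z = phi h * h)%C) /\ ccont phi 0 /\ phi 0 = d.

Lemma clim_zero_diff x z : clim x z -> clim (fun n => x n - z)%C 0.
Proof.
  intros H. replace (RtoC 0) with (z + - z)%C by ring. apply clim_plus; auto using clim_const.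
Qed.

Lemma is_cderiv_ccont f z d : is_cderiv f z d -> ccont f z.
Proof.
  intros [phi [H1 [H2 _]]] x Hx. pose proof (clim_zero_diff x z Hx) as H0.
  apply clim_ext with (x := fun n => (f z + phi (x n - z) * (x n - z))%C).
  - intros n. rewrite <- H1. replace (z + (x n - z))%C with (x n) by ring. ring.
  - assert (G : clim (fun n => f z + phi (x n - z) * (x n - z))%C (f z + phi 0 * 0)%C).
    { apply clim_plus; [apply clim_const|]. apply clim_mult; [apply (H2 _ H0) | exact H0]. }
    replace (f z + phi 0 * 0)%C with (f z) in G by ring. auto.
Qed.

Lemma clim_translate x z h : clim x h -> clim (fun n => z + x n)%C (z + h)%C.
Proof. apply clim_plus, clim_const. Qed.

Lemma ccont_shift_r f z : ccont f z -> forall x, clim x 0 -> clim (fun n => f (z + x n)%C) (f z).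
Proof.
  intros H x Hx. apply (H (fun n => z + x n)%C).
  pose proof (clim_translate x z 0 Hx) as G. rewrite Cplus_0_r in G. exact G.
Qed.

Lemma is_cderiv_const (c z : C) : is_cderiv (fun _ => c) z 0.
Proof. exists (fun _ => RtoC 0). split; [intros; ring|]. split; auto. intros x _; apply clim_const. Qed.

Lemma is_cderiv_id (z : C) : is_cderiv (fun w => w) z 1.
Proof. exists (fun _ => RtoC 1). split; [intros; ring|]. split; auto. intros x _; apply clim_const. Qed.

Lemma is_cderiv_plus f g z d e : is_cderiv f z d -> is_cderiv g z e ->
  is_cderiv (fun w => f w + g w)%C z (d + e)%C.
Proof.
  intros [p [P1 [P2 <-]]] [q [Q1 [Q2 <-]]]. exists (fun h => p h + q h)%C. split; [|split; auto].
  - intros h. transitivity ((f (z + h) - f z) + (g (z + h) - g z))%C; [ring|]. rewrite P1, Q1. ring.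
  - intros x Hx. apply clim_plus; auto.
Qed.

Lemma is_cderiv_mult f g z d e : is_cderiv f z d -> is_cderiv g z e ->
  is_cderiv (fun w => f w * g w)%C z (d * g z + f z * e)%C.
Proof.
  intros Hf Hg. pose proof (is_cderiv_ccont _ _ _ Hg) as Cg.
  destruct Hf as [p [P1 [P2 <-]]], Hg as [q [Q1 [Q2 <-]]].
  exists (fun h => p h * g (z + h) + f z * q h)%C. split; [|split].
  - intros h. transitivity ((f (z + h) - f z) * g (z + h) + f z * (g (z + h) - g z))%C; [ring|].
    rewrite P1, Q1. ring.
  - intros x Hx. rewrite Cplus_0_r. apply clim_plus; apply clim_mult; auto using clim_const.
    apply ccont_shift_r; auto.
  - rewrite Cplus_0_r. auto.
Qed.

Lemma is_cderiv_comp f g z d e : is_cderiv f z d -> is_cderiv g (f z) e ->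
  is_cderiv (fun w => g (f w)) z (e * d)%C.
Proof.
  intros [p [P1 [P2 <-]]] [q [Q1 [Q2 <-]]]. exists (fun h => q (p h * h) * p h)%C. split; [|split].
  - intros h. replace (f (z + h)%C) with (f z + p h * h)%C by (rewrite <- P1; ring). rewrite Q1. ring.
  - intros x Hx. apply clim_mult; auto.
    assert (G : clim (fun n => p (x n) * x n)%C (p 0 * 0)%C) by (apply clim_mult; auto).
    rewrite Cmult_0_r in *. apply (Q2 _ G).
  - rewrite Cmult_0_r. auto.
Qed.

Lemma is_cderiv_inv (z : C) : z <> 0 -> is_cderiv (fun w => / w)%C z (- / z ^ 2)%C.
Proof.
  intros Hz.
  (* The factorisation must hold for every h; at h = -z the value [/ 0] is 0, and the quotient is (0
     - 1/z) / h. Near h = 0 this case does not occur. *)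
  exists (fun h => if Ceq_dec (z + h) 0 then - / z * / h else - / (z * (z + h)))%C. split; [|split].
  - intros h. destruct (Ceq_dec (z + h) 0) as [E|E].
    + rewrite E, Cinv_0. assert (h <> 0) by (intros ->; apply Hz; rewrite <- E; ring). field. auto.
    + field. auto.
  - intros x Hx. destruct (Ceq_dec (z + 0) 0) as [E|E]; [exfalso; apply Hz; rewrite <- E; ring|].
    assert (L : clim (fun n => z + x n)%C (z + 0)%C) by (apply clim_translate; auto).
    apply clim_ext_loc with (x := fun n => (- 1 * / (z * (z + x n)))%C).
    + destruct (clim_eps _ _ L (Cmod (z + 0) / 2)) as [N HN].
      { pose proof (proj1 (Cmod_gt_0 _) E). lra. }
      exists N. intros n Hn. specialize (HN n Hn). destruct (Ceq_dec (z + x n) 0) as [F|F]; [|ring].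
      rewrite F in HN. pose proof (proj1 (Cmod_gt_0 _) E).
      replace (0 - (z + 0))%C with (- (z + 0))%C in HN by ring. rewrite Cmod_opp in HN. lra.
    + replace (- / (z * (z + 0)))%C with (- 1 * / (z * (z + 0)))%C by ring.
      apply clim_scal, clim_inv; [apply Cmult_neq_0; auto | apply clim_scal; auto].
  - destruct (Ceq_dec (z + 0) 0) as [E|E]; [exfalso; apply Hz; rewrite <- E; ring|].
    rewrite Cplus_0_r. do 2 f_equal. ring.
Qed.

(** Quadratic error bounds are what both [Cexp] and power series provide. *)
Lemma is_cderiv_of_quadratic (f : C -> C) (z d : C) (K del : R) : 0 < del -> 0 <= K ->
  (forall h, Cmod h < del -> Cmod (f (z + h) - f z - d * h)%C <= K * Cmod h ^ 2) -> is_cderiv f z d.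
Proof.
  intros Hd HK H.
  exists (fun h => if Ceq_dec h 0 then d else (f (z + h) - f z) / h)%C. split; [|split].
  - intros h. destruct (Ceq_dec h 0) as [->|E]; [rewrite Cplus_0_r; ring | field; auto].
  - intros x Hx. destruct (Ceq_dec 0 0) as [_|E]; [|contradiction].
    apply clim_of_eps. intros eps He.
    set (del' := Rmin (del / 2) (eps / (K + 1))).
    assert (D0 : 0 < eps / (K + 1)) by (apply Rdiv_lt_0_compat; lra).
    assert (Hd' : 0 < del') by (apply Rmin_pos; lra).
    destruct (clim_eps _ _ Hx _ Hd') as [N HN]. exists N. intros n Hn. specialize (HN n Hn).
    replace (x n - 0)%C with (x n) in HN by ring.
    destruct (Ceq_dec (x n) 0) as [E|E].
    { replace (d - d)%C with (RtoC 0) by ring. rewrite Cmod_0. lra. }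
    pose proof (proj1 (Cmod_gt_0 _) E) as Cp.
    pose proof (Rmin_l (del / 2) (eps / (K + 1)) : del' <= _). pose proof (Rmin_r (del / 2) (eps / (K + 1)) : del' <= _).
    specialize (H (x n) ltac:(lra)).
    replace ((f (z + x n) - f z) / x n - d)%C with ((f (z + x n) - f z - d * x n) / x n)%C by (field; auto).
    unfold Cdiv. rewrite Cmod_mult, Cmod_inv by auto.
    apply Rle_trans with (K * Cmod (x n)).
    + apply Rmult_le_reg_r with (Cmod (x n)); auto. rewrite Rmult_assoc, Rinv_l by lra. lra.
    + apply Rle_trans with ((K + 1) * (eps / (K + 1))); [|apply Req_le; field; lra].
      apply Rmult_le_compat; lra.
  - destruct (Ceq_dec 0 0) as [_|E]; [auto | contradiction].
Qed.

Lemma is_cderiv_Cexp (z : C) : is_cderiv Cexp z (Cexp z).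
Proof.
  apply is_cderiv_of_quadratic with (K := 10 * Cmod (Cexp z)) (del := / 2); [lra| |].
  - pose proof (Cmod_ge_0 (Cexp z)). lra.
  - intros h Hh. rewrite Cexp_plus.
    replace (Cexp z * Cexp h - Cexp z - Cexp z * h)%C with (Cexp z * (Cexp h - 1 - h))%C by ring.
    rewrite Cmod_mult. pose proof (Cexp_minus_affine_le h ltac:(lra)) as P.
    pose proof (Cmod_ge_0 (Cexp z)). apply (Rmult_le_compat_l _ _ _ H) in P. lra.
Qed.

(** * Termwise differentiation of power series *)

Lemma term_le_Series (u : nat -> R) n : (forall k, 0 <= u k) -> ex_series u -> u n <= Series u.
Proof.
  intros Hp Hu. eapply Rle_trans; [|apply (sum_n_le_Series u (S n)); auto].
  cbn [csum]. unfold Re, Cplus. cbn [fst snd].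
  assert (0 <= fst (csum (fun k => RtoC (u k)) n)); [|simpl; lra].
  clear Hu. induction n; simpl; [lra|]. specialize (Hp n). lra.
Qed.

(** At the intermediate radius s = (1 + r) / 2 the terms |c n| s^n are bounded, which leaves a
    polynomial times a power of r / s < 1. *)
Lemma disc_summable_weighted c (k : nat) r : disc_summable c -> 0 <= r < 1 ->
  ex_series (fun n => Cmod (c n) * ((INR n + 1) ^ k * r ^ n)).
Proof.
  intros Hc Hr. set (s := (1 + r) / 2).
  assert (Hs : 0 < s < 1) by (unfold s; lra).
  pose proof (Hc s ltac:(lra)) as Es.
  assert (P0 : forall n, 0 <= Cmod (c n) * s ^ n) by (intros; apply Rmult_le_pos; [apply Cmod_ge_0 | apply pow_le; lra]).
  set (B := Series (fun n => Cmod (c n) * s ^ n)).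
  assert (Hrs : 0 <= r / s < 1).
  { split; [apply Rdiv_le_0_compat; lra|]. apply Rlt_div_l; [lra|]. unfold s; lra. }
  apply ex_series_le_nonneg with (b := fun n => B * ((INR n + 1) ^ k * (r / s) ^ n)).
  - intros n. assert (N0 : 0 <= (INR n + 1) ^ k) by (apply pow_le; pose proof (pos_INR n); lra).
    split; [repeat apply Rmult_le_pos; auto using Cmod_ge_0; apply pow_le; lra|].
    pose proof (term_le_Series _ n P0 Es) as T. fold B in T.
    replace (Cmod (c n) * ((INR n + 1) ^ k * r ^ n)) with (Cmod (c n) * s ^ n * ((INR n + 1) ^ k * (r / s) ^ n)).
    + apply Rmult_le_compat_r; auto. apply Rmult_le_pos; auto. apply pow_le; lra.
    + unfold Rdiv. rewrite Rpow_mult_distr, pow_inv. field. apply pow_nonzero; lra.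
  - apply ex_series_Rscal, ex_series_poly_geom; auto.
Qed.

Definition deriv_coeff (c : nat -> C) (n : nat) : C := (INR (S n) * c (S n))%C.

Lemma disc_summable_deriv c : disc_summable c -> disc_summable (deriv_coeff c).
Proof.
  intros H r Hr. eapply ex_series_ext; [|exact (disc_summable_weighted _ 1 r (disc_summable_shift c H) Hr)].
  intros n. unfold deriv_coeff. cbv beta. rewrite Cmod_mult, Cmod_RtoC_nonneg, S_INR, pow_1 by apply pos_INR.
  match goal with |- ?a = ?b => change (a = b :> R) end. ring.
Qed.

(** The difference A and the second-order remainder B obey A' = (q + h) A + h q^n and B' = q B + h
    A, so both bounds follow by one induction. The factors rho and rho^2 on the left avoid the
    exponents n - 1 and n - 2. *)
Lemma pow_difference_bounds (q h : C) (rho : R) (n : nat) : 0 < rho -> Cmod q <= rho -> Cmod (q + h) <= rho ->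
  rho * Cmod ((q + h) ^ n - q ^ n) <= INR n * rho ^ n * Cmod h /\
  rho ^ 2 * Cmod ((q + h) ^ n - q ^ n - INR n * q ^ (n - 1) * h) <= INR n ^ 2 * rho ^ n * Cmod h ^ 2.
Proof.
  intros Hr Hq Hqh. pose proof (Cmod_ge_0 h) as Hh. induction n as [|n [IA IB]].
  - simpl INR. replace ((q + h) ^ 0 - q ^ 0)%C with (RtoC 0) by (simpl; ring).
    replace (0 - 0 * q ^ (0 - 1) * h)%C with (RtoC 0) by ring. rewrite Cmod_0. simpl. lra.
  - pose proof (pos_INR n) as Pn. assert (Prn : 0 < rho ^ n) by (apply pow_lt; auto).
    set (A := ((q + h) ^ n - q ^ n)%C) in *. set (B := (A - INR n * q ^ (n - 1) * h)%C) in *.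
    assert (EA : ((q + h) ^ S n - q ^ S n = (q + h) * A + h * q ^ n)%C) by (unfold A; simpl; ring).
    assert (EB : ((q + h) ^ S n - q ^ S n - INR (S n) * q ^ (S n - 1) * h = q * B + h * A)%C).
    { unfold B. replace (S n - 1)%nat with n by lia.
      assert (Q : (q * (INR n * q ^ (n - 1)) = INR n * q ^ n)%C).
      { destruct n; [simpl; ring|]. replace (S n - 1)%nat with n by lia. rewrite Cpow_S. ring. }
      replace (q * (A - INR n * q ^ (n - 1) * h))%C with (q * A - q * (INR n * q ^ (n - 1)) * h)%C by ring.
      rewrite Q, EA, S_INR, RtoC_plus. ring. }
    rewrite EB, EA, S_INR. split.
    + pose proof (Cmod_triangle ((q + h) * A) (h * q ^ n)) as T. rewrite !Cmod_mult, Cmod_pow in T.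
      assert (Cmod (q + h) * Cmod A <= rho * Cmod A) by (apply Rmult_le_compat_r; auto using Cmod_ge_0).
      assert (Cmod h * Cmod q ^ n <= Cmod h * rho ^ n).
      { apply Rmult_le_compat_l; auto. apply pow_incr. split; auto using Cmod_ge_0. }
      simpl pow.
      apply Rle_trans with (rho * (rho * Cmod A + Cmod h * rho ^ n)); [apply Rmult_le_compat_l; lra|].
      assert (rho * (rho * Cmod A) <= rho * (INR n * rho ^ n * Cmod h)) by (apply Rmult_le_compat_l; lra). lra.
    + pose proof (Cmod_triangle (q * B) (h * A)) as T. rewrite !Cmod_mult in T.
      assert (Cmod q * Cmod B <= rho * Cmod B) by (apply Rmult_le_compat_r; auto using Cmod_ge_0).
      apply Rle_trans with (rho ^ 2 * (rho * Cmod B + Cmod h * Cmod A)).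
      { apply Rmult_le_compat_l; [apply pow_le|]; lra. }
      assert (X1 : rho * (rho ^ 2 * Cmod B) <= rho * (INR n ^ 2 * rho ^ n * Cmod h ^ 2)) by (apply Rmult_le_compat_l; lra).
      assert (X2 : rho * Cmod h * (rho * Cmod A) <= rho * Cmod h * (INR n * rho ^ n * Cmod h)).
      { apply Rmult_le_compat_l; auto. apply Rmult_le_pos; lra. }
      assert (X3 : 0 <= rho * rho ^ n * Cmod h ^ 2) by (repeat apply Rmult_le_pos; try lra; apply pow_le; auto).
      assert (X4 : 0 <= INR n * (rho * rho ^ n * Cmod h ^ 2)) by (apply Rmult_le_pos; auto).
      replace (rho ^ 2 * (rho * Cmod B + Cmod h * Cmod A)) with (rho * (rho ^ 2 * Cmod B) + rho * Cmod h * (rho * Cmod A)) by ring.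
      replace ((INR n + 1) ^ 2 * rho ^ S n * Cmod h ^ 2) with
        (rho * (INR n ^ 2 * rho ^ n * Cmod h ^ 2) + rho * Cmod h * (INR n * rho ^ n * Cmod h)
         + INR n * (rho * rho ^ n * Cmod h ^ 2) + rho * rho ^ n * Cmod h ^ 2) by (simpl; ring).
      lra.
Qed.

(** With rho halfway between |q| and 1, the remainders of the single powers sum to a multiple of
    |h|^2. *)
Lemma is_cderiv_pser c (q : C) : disc_summable c -> Cmod q < 1 -> is_cderiv (pser c) q (pser (deriv_coeff c) q).
Proof.
  intros Hc Hq. pose proof (Cmod_ge_0 q) as Hq0. set (rho := (1 + Cmod q) / 2).
  assert (Hr : 0 < rho < 1) by (unfold rho; lra).
  set (u := fun n => / rho ^ 2 * (Cmod (c n) * ((INR n + 1) ^ 2 * rho ^ n))).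
  assert (Hu : ex_series u) by (apply ex_series_Rscal, disc_summable_weighted; auto; lra).
  assert (Hrho2 : 0 < / rho ^ 2) by (apply Rinv_0_lt_compat, pow_lt; lra).
  assert (Hu0 : forall n, 0 <= u n).
  { intros n. unfold u. pose proof (pos_INR n).
    repeat apply Rmult_le_pos; try lra; auto using Cmod_ge_0; apply pow_le; lra. }
  apply is_cderiv_of_quadratic with (K := Series u) (del := (1 - Cmod q) / 2); [lra | apply Series_nonneg; auto|].
  intros h Hh.
  assert (Hqh : Cmod (q + h) <= rho) by (eapply Rle_trans; [apply Cmod_triangle | unfold rho; lra]).
  pose proof (cabs_pser c q Hc Hq) as A1.
  pose proof (cabs_pser c (q + h) Hc ltac:(lra)) as A2.
  pose proof (cabs_pser _ q (disc_summable_deriv c Hc) Hq) as A3.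
  assert (A4 : cabs (fun n => c n * (INR n * q ^ (n - 1)))%C).
  { apply cabs_decr_1. eapply cabs_ext; [|exact A3]. intros n. unfold deriv_coeff.
    replace (S n - 1)%nat with n by lia. ring. }
  assert (E3 : pser (deriv_coeff c) q = CSeries (fun n => c n * (INR n * q ^ (n - 1)))%C).
  { rewrite (CSeries_incr_1 _ A4). simpl INR at 1. rewrite Cmult_0_l, Cmult_0_r, Cplus_0_l.
    apply CSeries_ext. intros n. unfold deriv_coeff. replace (S n - 1)%nat with n by lia. ring. }
  replace (pser c (q + h) - pser c q - pser (deriv_coeff c) q * h)%C with
    (CSeries (fun n => (c n * (q + h) ^ n + - 1 * (c n * q ^ n)) + - h * (c n * (INR n * q ^ (n - 1))))%C).
  2: { rewrite !CSeries_plus, !CSeries_scal; auto using cabs_plus, cabs_scal.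
       rewrite E3. unfold pser. ring. }
  rewrite Rmult_comm, <- Series_scal_l. apply Cmod_CSeries_le; [|apply ex_series_Rscal; auto].
  intros n. replace ((c n * (q + h) ^ n + - 1 * (c n * q ^ n)) + - h * (c n * (INR n * q ^ (n - 1))))%C
    with (c n * ((q + h) ^ n - q ^ n - INR n * q ^ (n - 1) * h))%C by ring.
  rewrite Cmod_mult. destruct (pow_difference_bounds q h rho n ltac:(lra) ltac:(unfold rho; lra) Hqh) as [_ P].
  set (X := Cmod ((q + h) ^ n - q ^ n - INR n * q ^ (n - 1) * h)) in *.
  unfold u. pose proof (pos_INR n) as Pn.
  assert (P' : X <= / rho ^ 2 * ((INR n + 1) ^ 2 * rho ^ n * Cmod h ^ 2)).
  { apply Rmult_le_reg_l with (rho ^ 2); [apply pow_lt; lra|].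
    rewrite <- Rmult_assoc, Rinv_r, Rmult_1_l by (apply pow_nonzero; lra).
    eapply Rle_trans; [exact P|]. apply Rmult_le_compat_r; [apply pow_le, Cmod_ge_0|].
    apply Rmult_le_compat_r; [apply pow_le; lra|]. apply pow_incr; lra. }
  apply (Rmult_le_compat_l (Cmod (c n))) in P'; auto using Cmod_ge_0. lra.
Qed.

(** Continuity of the derivative is built in: differentiation under the integral sign requires it,
    and it would otherwise have to come from Goursat's theorem. *)
Definition hol (U : C -> Prop) (f : C -> C) : Prop :=
  exists f', forall z, U z -> is_cderiv f z (f' z) /\ ccont f' z.

Lemma hol_ccont U f z : hol U f -> U z -> ccont f z.
Proof. intros [f' H] Hz. eapply is_cderiv_ccont, H; auto. Qed.

Lemma hol_const U (c : C) : hol U (fun _ => c).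
Proof. exists (fun _ => RtoC 0). intros z _. split; [apply is_cderiv_const | intros x _; apply clim_const]. Qed.

Lemma hol_id U : hol U (fun z => z).
Proof. exists (fun _ => RtoC 1). intros z _. split; [apply is_cderiv_id | intros x _; apply clim_const]. Qed.

Lemma hol_plus U f g : hol U f -> hol U g -> hol U (fun z => f z + g z)%C.
Proof.
  intros [f' Hf] [g' Hg]. exists (fun z => f' z + g' z)%C. intros z Hz.
  destruct (Hf z Hz), (Hg z Hz). split; [apply is_cderiv_plus; auto|].
  intros x Hx. apply clim_plus; auto.
Qed.

Lemma hol_mult U f g : hol U f -> hol U g -> hol U (fun z => f z * g z)%C.
Proof.
  intros Hf Hg. pose proof (fun z => hol_ccont U f z Hf) as Cf. pose proof (fun z => hol_ccont U g z Hg) as Cg.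
  destruct Hf as [f' Hf], Hg as [g' Hg]. exists (fun z => f' z * g z + f z * g' z)%C. intros z Hz.
  destruct (Hf z Hz), (Hg z Hz). split; [apply is_cderiv_mult; auto|].
  intros x Hx. apply clim_plus; apply clim_mult; auto; [apply Cg | apply Cf]; auto.
Qed.

Lemma hol_comp U V f g : hol U f -> hol V g -> (forall z, U z -> V (f z)) -> hol U (fun z => g (f z)).
Proof.
  intros Hf [g' Hg] HV. pose proof (fun z => hol_ccont U f z Hf) as Cf.
  destruct Hf as [f' Hf]. exists (fun z => g' (f z) * f' z)%C. intros z Hz.
  destruct (Hf z Hz), (Hg _ (HV z Hz)) as [G1 G2]. split; [apply is_cderiv_comp; auto|].
  intros x Hx. apply clim_mult; auto. apply (G2 (fun n => f (x n))). apply Cf; auto.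
Qed.

Lemma hol_inv : hol (fun z => z <> 0) (fun z => / z)%C.
Proof.
  exists (fun z => - / z ^ 2)%C. intros z Hz. split; [apply is_cderiv_inv; auto|].
  intros x Hx. replace (- / z ^ 2)%C with (- 1 * / z ^ 2)%C by ring.
  apply clim_ext with (x := fun n => (- 1 * / x n ^ 2)%C); [intros; ring|].
  apply clim_scal, clim_inv; [apply Cpow_nz; auto | apply clim_pow; auto].
Qed.

Lemma hol_div U f g : hol U f -> hol U g -> (forall z, U z -> g z <> 0) -> hol U (fun z => f z / g z)%C.
Proof.
  intros Hf Hg H. apply hol_mult; auto. apply (hol_comp U _ g (fun z => / z)%C Hg hol_inv H).
Qed.

Lemma hol_Cexp U : hol U Cexp.
Proof. exists Cexp. intros z _. split; [apply is_cderiv_Cexp | apply (is_cderiv_ccont _ _ _ (is_cderiv_Cexp z))]. Qed.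

Lemma hol_pser c : disc_summable c -> hol (fun q => Cmod q < 1) (pser c).
Proof.
  intros Hc. exists (pser (deriv_coeff c)). intros q Hq. split; [apply is_cderiv_pser; auto|].
  eapply is_cderiv_ccont, is_cderiv_pser; auto. apply disc_summable_deriv; auto.
Qed.

(** * Moving the segment of integration within the strip *)

Lemma strip_add_R (s : C) (t : R) : strip s -> strip (s + t).
Proof. unfold strip, Im; simpl. rewrite Rplus_0_r. auto. Qed.

Lemma is_cderiv_line (f : C -> C) (p q e : C) (l : R) : is_cderiv f (p + l * q) e ->
  is_derive (fun x : R => Re (f (p + x * q)%C)) l (Re (e * q)).
Proof.
  intros [phi [H1 [H2 <-]]]. apply is_derive_Reals. intros eps He.
  pose proof (Cmod_ge_0 q) as Hq.
  destruct (ccont_eps phi 0 H2 (eps / (Cmod q + 1))) as [del [Hd HD]]; [apply Rdiv_lt_0_compat; lra|].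
  assert (Hd' : 0 < del / (Cmod q + 1)) by (apply Rdiv_lt_0_compat; lra).
  exists (mkposreal _ Hd'). intros h Hh0 Hh. simpl in Hh.
  replace (p + (l + h)%R * q)%C with (p + l * q + h * q)%C by (rewrite RtoC_plus; ring).
  assert (E : Re (f (p + l * q + h * q)%C) - Re (f (p + l * q)%C) = Re (phi (h * q)%C * (h * q))).
  { rewrite <- H1. reflexivity. }
  rewrite E.
  assert (E2 : Re (phi (h * q)%C * (h * q)) / h - Re (phi 0 * q) = Re ((phi (h * q)%C - phi 0) * q)).
  { unfold Re. simpl. field. auto. }
  rewrite E2. eapply Rle_lt_trans; [apply Rabs_Re_le|]. rewrite Cmod_mult.
  specialize (HD (h * q)%C). replace (h * q - 0)%C with (h * q)%C in HD by ring.
  rewrite Cmod_mult, Cmod_R in HD.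
  assert (B : Rabs h * Cmod q < del).
  { apply Rle_lt_trans with (Rabs h * (Cmod q + 1)).
    - apply Rmult_le_compat_l; [apply Rabs_pos | lra].
    - apply Rlt_div_r in Hh; lra. }
  specialize (HD B). apply Rlt_div_r in HD; [|lra].
  pose proof (Cmod_ge_0 (phi (h * q)%C - phi 0)). lra.
Qed.

Lemma ccont_line (f : C -> C) (p : C) (t : R) : ccont f (p + t) ->
  continuous (fun x : R => Re (f (p + x)%C)) t.
Proof.
  intros H. apply continuity_pt_filterlim. intros eps He.
  destruct (ccont_eps _ _ H eps He) as [del [Hd HD]].
  exists del. split; auto. intros x [_ Hx]. unfold dist in *; simpl in *. unfold R_dist in *.
  eapply Rle_lt_trans; [|apply (HD (p + x)%C)].
  - apply (Rabs_Re_le (f (p + x)%C - f (p + t)%C)).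
  - replace (p + x - (p + t))%C with (RtoC (x - t)) by (rewrite RtoC_minus; ring). rewrite Cmod_R. auto.
Qed.

Lemma ccont_2d (f : C -> C) (p q : C) (l t : R) : ccont f (p + l * q + t) ->
  continuity_2d_pt (fun u v => Re (f (p + u * q + v)%C)) l t.
Proof.
  intros H eps. destruct (ccont_eps _ _ H eps (cond_pos eps)) as [del [Hd HD]].
  pose proof (Cmod_ge_0 q) as Hq.
  assert (Hd' : 0 < del / (Cmod q + 1)) by (apply Rdiv_lt_0_compat; lra).
  exists (mkposreal _ Hd'). simpl. intros u v Hu Hv.
  eapply Rle_lt_trans; [|apply (HD (p + u * q + v)%C)].
  - apply (Rabs_Re_le (f (p + u * q + v)%C - f (p + l * q + t)%C)).
  - replace (p + u * q + v - (p + l * q + t))%C with (RtoC (u - l) * q + RtoC (v - t))%C by (rewrite !RtoC_minus; ring).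
    eapply Rle_lt_trans; [apply Cmod_triangle|]. rewrite Cmod_mult, !Cmod_R.
    apply Rlt_div_r in Hu; [|lra]. apply Rlt_div_r in Hv; [|lra].
    assert (Rabs (u - l) * Cmod q + Rabs (v - t) < del); [|auto].
    pose proof (Rabs_pos (u - l)). pose proof (Rabs_pos (v - t)).
    assert (M : Rmax (Rabs (u - l)) (Rabs (v - t)) * (Cmod q + 1) < del) by (apply Rmax_case; auto).
    pose proof (Rmax_l (Rabs (u - l)) (Rabs (v - t))). pose proof (Rmax_r (Rabs (u - l)) (Rabs (v - t))).
    assert (Rabs (u - l) * Cmod q <= Rmax (Rabs (u - l)) (Rabs (v - t)) * Cmod q) by (apply Rmult_le_compat_r; auto).
    lra.
Qed.

Lemma ex_RInt_Re_line (f : C -> C) (s : C) (a b : R) : (forall z, strip z -> ccont f z) -> strip s ->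
  ex_RInt (fun t : R => Re (f (s + t)%C)) a b.
Proof.
  intros H Hs. apply (ex_RInt_continuous (V := R_CompleteNormedModule)).
  intros t _. apply ccont_line, H, strip_add_R; auto.
Qed.

(* Differentiating under the integral sign turns the derivative in the base point into the
   integral of F', which vanishes over a period. *)
Lemma RInt_Re_base_point (F : C -> C) (L : R) (s0 s1 : C) : hol strip F -> 0 < L ->
  (forall s, strip s -> F (s + L)%C = F s) -> strip s0 -> strip s1 ->
  RInt (fun t : R => Re (F (s0 + t)%C)) 0 L = RInt (fun t : R => Re (F (s1 + t)%C)) 0 L.
Proof.
  intros HF HL Hper Hs0 Hs1.
  assert (HC : forall z, strip z -> ccont F z) by (intros; eapply hol_ccont; eauto).
  destruct HF as [F' HF]. set (d := (s1 - s0)%C).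
  set (K := fun l : R => RInt (fun t : R => Re (F (s0 + l * d + t)%C)) 0 L).
  assert (Hseg : forall l : R, 0 <= l <= 1 -> strip (s0 + l * d)).
  { intros l Hl. unfold strip, d, Im in *. simpl.
    replace (snd s0 + (l * (snd s1 + - snd s0) + 0 * (fst s1 + - fst s0)))
      with ((1 - l) * snd s0 + l * snd s1) by ring.
    destruct (Rle_lt_dec l (/ 2)); nra. }
  (* Derivatives here are two-sided, so at l = 0 and l = 1 the prolonged segment must stay in the
     strip for a while. *)
  assert (Hopen : forall l : R, strip (s0 + l * d) -> locally l (fun u : R => strip (s0 + u * d))).
  { intros l Hl.
    assert (Cn : forall u : R, Im (s0 + u * d) = Im s0 + u * Im d) by (intros; unfold Im; simpl; ring).
    assert (Cc : continuous (fun u : R => Im s0 + u * Im d) l).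
    { apply (ex_derive_continuous (K := R_AbsRing) (V := R_NormedModule) (fun u : R => Im s0 + u * Im d)).
      auto_derive. auto. }
    unfold strip in *. rewrite Cn in Hl.
    assert (O : open (fun x : R => 0 < x < PI)) by (apply open_and; [apply open_gt | apply open_lt]).
    specialize (Cc _ (O _ Hl)). unfold filtermap in Cc.
    eapply filter_imp; [|exact Cc]. intros u Hu. rewrite Cn. exact Hu. }
  assert (HdF : forall u t : R, strip (s0 + u * d) ->
    is_derive (fun x : R => Re (F (s0 + x * d + t)%C)) u (Re (F' (s0 + u * d + t)%C * d))).
  { intros u t Hu. apply is_derive_ext with (f := fun x : R => Re (F ((s0 + t) + x * d)%C)).
    - intros x. do 2 f_equal. ring.
    - replace (s0 + u * d + t)%C with (s0 + t + u * d)%C by ring. apply is_cderiv_line.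
      apply HF. replace (s0 + t + u * d)%C with (s0 + u * d + t)%C by ring. apply strip_add_R; auto. }
  assert (HK : forall l : R, 0 <= l <= 1 -> is_derive K l 0).
  { intros l Hl. pose proof (Hseg l Hl) as Sl.
    (* The derivative in u is Re (F' d), which is also the t-derivative of Re (F d); the latter has
       equal values at both ends of a period. *)
    assert (E : RInt (fun t : R => Derive (fun u : R => Re (F (s0 + u * d + t)%C)) l) 0 L = 0).
    { rewrite (RInt_ext _ (fun t : R => Re (F' (s0 + l * d + t)%C * d)))
        by (intros t _; apply is_derive_unique, HdF; auto).
      apply (is_RInt_unique (V := R_CompleteNormedModule)).
      assert (A := is_RInt_derive (V := R_CompleteNormedModule) (fun t : R => Re (F (s0 + l * d + t)%C * d))
        (fun t : R => Re (F' (s0 + l * d + t)%C * d)) 0 L).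
      replace 0 with (minus (Re (F (s0 + l * d + L)%C * d)) (Re (F (s0 + l * d + 0)%C * d))) at 2.
      - apply A.
        + intros t _. set (f := fun z => (F z * d)%C).
          assert (Q : is_cderiv f ((s0 + l * d) + t * 1)%C (F' (s0 + l * d + t)%C * d)).
          { replace ((s0 + l * d) + t * 1)%C with (s0 + l * d + t)%C by ring.
            replace (F' (s0 + l * d + t)%C * d)%C with (F' (s0 + l * d + t)%C * d + F (s0 + l * d + t)%C * 0)%C by ring.
            apply (is_cderiv_mult F (fun _ => d)); [apply HF, strip_add_R; auto | apply is_cderiv_const]. }
          apply is_cderiv_line in Q. rewrite Cmult_1_r in Q.
          eapply is_derive_ext; [|exact Q]. intros x. unfold f. rewrite Cmult_1_r. auto.
        + intros t _. apply (ccont_line (fun z => F' z * d)%C). intros x Hx.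
          apply clim_mult; [|apply clim_const]. apply (HF (s0 + l * d + t)%C); auto. apply strip_add_R; auto.
      - rewrite Hper by auto. rewrite Cplus_0_r. unfold minus, plus, opp; simpl. ring. }
    rewrite <- E. apply (is_derive_RInt_param (fun (u : R) (t : R) => Re (F (s0 + u * d + t)%C)) 0 L l).
    - eapply filter_imp; [|exact (Hopen l Sl)]. intros u Hu t _. exact (ex_intro _ _ (HdF u t Hu)).
    - intros t _. apply continuity_2d_pt_ext_loc with (f := fun u v => Re (F' (s0 + u * d + v)%C * d)).
      + destruct (Hopen l Sl) as [e He]. exists e. intros u v Hu _. symmetry.
        apply is_derive_unique, HdF, He, Hu.
      + apply (ccont_2d (fun z => F' z * d)%C). intros x Hx.
        apply clim_mult; [|apply clim_const]. apply (HF (s0 + l * d + t)%C); auto. apply strip_add_R; auto.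
    - eapply filter_imp; [|exact (Hopen l Sl)]. intros u Hu. apply (ex_RInt_Re_line F (s0 + u * d)); auto. }
  assert (EK : K 0 = K 1) by (apply (eq_is_derive (V := R_NormedModule) K 0 1 HK); lra).
  unfold K in EK.
  rewrite (RInt_ext (fun t : R => Re (F (s0 + t)%C)) (fun t : R => Re (F (s0 + 0 * d + t)%C)))
    by (intros; do 2 f_equal; ring).
  rewrite EK. apply RInt_ext. intros t _. do 2 f_equal. unfold d. ring.
Qed.

Definition CRInt (f : R -> C) (a b : R) : C := (RInt (fun t => Re (f t)) a b, RInt (fun t => Im (f t)) a b).

(** [val] integrates in C as a normed space over R; existence of both component integrals reduces
    that integral to real ones. *)
Lemma RInt_CRInt (f : C -> C) (s : C) (a b : R) : (forall z, strip z -> ccont f z) -> strip s ->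
  RInt (V := C_R_CompleteNormedModule) (fun t : R => f (s + t)%C) a b = CRInt (fun t : R => f (s + t)%C) a b.
Proof.
  intros H Hs. apply (is_RInt_unique (V := C_R_CompleteNormedModule)).
  apply (is_RInt_fct_extend_pair (U := R_NormedModule) (V := R_NormedModule) (fun t : R => f (s + t)%C)).
  - apply (RInt_correct (V := R_CompleteNormedModule)), ex_RInt_Re_line; auto.
  - apply (RInt_correct (V := R_CompleteNormedModule)).
    (* Imaginary parts are covered by the statements on real parts through Im f = Re (- i f). *)
    eapply ex_RInt_ext; [|apply (ex_RInt_Re_line (fun z => - Ci * f z)%C s a b)]; auto.
    + intros t _. match goal with |- ?a = ?b => change (a = b :> R) end. unfold Re, Im; simpl. ring.
    + intros z Hz x Hx. apply clim_scal, H; auto.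
Qed.

Lemma RInt_base_point (F : C -> C) (L : R) (s0 s1 : C) : hol strip F -> 0 < L ->
  (forall s, strip s -> F (s + L)%C = F s) -> strip s0 -> strip s1 ->
  CRInt (fun t : R => F (s0 + t)%C) 0 L = CRInt (fun t : R => F (s1 + t)%C) 0 L.
Proof.
  intros HF HL Hper H0 H1. unfold CRInt. f_equal; [apply RInt_Re_base_point; auto|].
  assert (E : forall s, RInt (fun t : R => Im (F (s + t)%C)) 0 L = RInt (fun t : R => Re (- Ci * F (s + t)%C)) 0 L).
  { intros s. apply RInt_ext. intros t _. unfold Re, Im; simpl. ring. }
  rewrite !E. apply (RInt_Re_base_point (fun z => - Ci * F z)%C L s0 s1); auto.
  - apply (hol_mult strip (fun _ => - Ci)%C F); [apply hol_const | auto].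
  - intros s Hs. rewrite Hper; auto.
Qed.

(** * Quadratic irrationalities *)

Lemma irrational_linear (w : R) (p q : Z) : irrational w -> IZR p * w + IZR q = 0 -> p = 0%Z /\ q = 0%Z.
Proof.
  intros Hw E. destruct (Z.eq_dec p 0) as [->|Hp].
  - split; auto. apply eq_IZR. lra.
  - exfalso. apply (Hw (- q)%Z p Hp). assert (IZR p <> 0) by (apply not_0_IZR; auto).
    apply Rmult_eq_reg_l with (IZR p); auto. rewrite opp_IZR. field_simplify; auto. lra.
Qed.

Lemma irrational_linear_nz (w : R) (p q : Z) : irrational w -> (p <> 0 \/ q <> 0)%Z -> IZR p * w + IZR q <> 0.
Proof. intros Hw H E. destruct (irrational_linear w p q Hw E). lia. Qed.

Lemma primitive_lead_nz (w : R) (A B C : Z) : irrational w -> primitive_poly w A B C -> A <> 0%Z.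
Proof.
  intros Hw [Hg Hr] ->. unfold quad_root in Hr.
  destruct (irrational_linear w B C Hw) as [-> ->]; [lra|]. discriminate.
Qed.

Lemma primitive_exists (w : R) : quad_irr w -> exists A B C, primitive_poly w A B C.
Proof.
  intros [Hw [A [B [C [HA Hr]]]]]. set (g := Z.gcd (Z.gcd A B) C).
  assert (GA : (g | A)%Z).
  { eapply Z.divide_trans; [apply Z.gcd_divide_l|]. apply Z.gcd_divide_l. }
  assert (GB : (g | B)%Z).
  { eapply Z.divide_trans; [apply Z.gcd_divide_l|]. apply Z.gcd_divide_r. }
  assert (GC : (g | C)%Z) by apply Z.gcd_divide_r.
  assert (Hg0 : (0 <= g)%Z) by apply Z.gcd_nonneg.
  destruct GA as [a Ea], GB as [b Eb], GC as [c Ec].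
  assert (Hg : (0 < g)%Z) by (assert (g <> 0)%Z by (intros E; rewrite E in Ea; lia); lia).
  exists a, b, c. split.
  - assert (E : g = (Z.gcd (Z.gcd a b) c * g)%Z).
    { unfold g at 1. rewrite Ea, Eb, Ec, !Z.gcd_mul_mono_r_nonneg by lia. auto. }
    apply Z.mul_reg_r with g; lia.
  - unfold quad_root in *. rewrite Ea, Eb, Ec, !mult_IZR in Hr.
    assert (IZR g <> 0) by (apply not_0_IZR; lia).
    apply Rmult_eq_reg_r with (IZR g); auto. lra.
Qed.

Lemma divide_mul_gcd (k n x y : Z) : (k | n * x)%Z -> (k | n * y)%Z -> (k | n * Z.gcd x y)%Z.
Proof.
  intros H1 H2. destruct (Z.gcd_bezout x y _ eq_refl) as [u [v E]]. rewrite <- E.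
  replace (n * (u * x + v * y))%Z with (u * (n * x) + v * (n * y))%Z by ring.
  apply Z.divide_add_r; apply Z.divide_mul_r; auto.
Qed.

(** Eliminating w^2 leaves a linear relation for the irrational w, so the triples are proportional;
    since each has gcd 1, the leading coefficients divide each other. *)
Lemma primitive_unique (w : R) (A B C A2 B2 C2 : Z) : irrational w ->
  primitive_poly w A B C -> primitive_poly w A2 B2 C2 ->
  (A2 = A /\ B2 = B /\ C2 = C)%Z \/ (A2 = - A /\ B2 = - B /\ C2 = - C)%Z.
Proof.
  intros Hw H1 H2. pose proof (primitive_lead_nz _ _ _ _ Hw H1) as N1.
  pose proof (primitive_lead_nz _ _ _ _ Hw H2) as N2.
  destruct H1 as [G1 R1], H2 as [G2 R2]. unfold quad_root in *.
  destruct (irrational_linear w (A2 * B - A * B2) (A2 * C - A * C2) Hw) as [E1 E2].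
  { rewrite !minus_IZR, !mult_IZR.
    transitivity (IZR A2 * (IZR A * w ^ 2 + IZR B * w + IZR C) - IZR A * (IZR A2 * w ^ 2 + IZR B2 * w + IZR C2)); [ring|].
    rewrite R1, R2. ring. }
  assert (D1 : (A | A2)%Z).
  { replace A2 with (A2 * Z.gcd (Z.gcd A B) C)%Z by (rewrite G1; ring).
    repeat apply divide_mul_gcd; [exists A2 | exists B2 | exists C2]; lia. }
  assert (D2 : (A2 | A)%Z).
  { replace A with (A * Z.gcd (Z.gcd A2 B2) C2)%Z by (rewrite G2; ring).
    repeat apply divide_mul_gcd; [exists A | exists B | exists C]; lia. }
  destruct (Z.divide_antisym _ _ D1 D2) as [E|E]; [left | right]; rewrite E in *.
  - repeat split; apply Z.mul_reg_l with A2; lia.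
  - repeat split; try lia; apply Z.mul_reg_l with A2; lia.
Qed.

(** The choice of [epsilon] is forced, because the common sign of the triple cancels in B^2 - 4 A
    C. *)
Lemma disc_unique (w : R) (A B C : Z) : irrational w -> primitive_poly w A B C -> Defs.disc w = (B * B - 4 * A * C)%Z.
Proof.
  intros Hw H. unfold Defs.disc.
  pose proof (epsilon_spec (inhabits 0%Z) (fun D => exists A B C : Z, primitive_poly w A B C /\ D = (B * B - 4 * A * C)%Z)) as S.
  destruct S as [A2 [B2 [C2 [H2 E]]]]; [exists (B * B - 4 * A * C)%Z, A, B, C; auto|].
  rewrite E. destruct (primitive_unique w A B C A2 B2 C2 Hw H H2) as [[-> [-> ->]]|[-> [-> ->]]]; ring.
Qed.

Lemma quad_root_pair (A B C : Z) (w x : R) : A <> 0%Z -> quad_root A B C w -> quad_root A B C x -> x <> w ->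
  x = - IZR B / IZR A - w.
Proof.
  intros HA Hw Hx Hne. unfold quad_root in *. assert (IZR A <> 0) by (apply not_0_IZR; auto).
  assert (E : (x - w) * (IZR A * (x + w) + IZR B) = 0) by nra.
  apply Rmult_integral in E. destruct E as [E|E]; [exfalso; apply Hne; lra|].
  apply Rmult_eq_reg_l with (IZR A); auto. field_simplify; auto. lra.
Qed.

Lemma conjugate_root_exists (w : R) (A B C : Z) : irrational w -> primitive_poly w A B C ->
  quad_root A B C (- IZR B / IZR A - w) /\ - IZR B / IZR A - w <> w.
Proof.
  intros Hw H. pose proof (primitive_lead_nz _ _ _ _ Hw H) as N. destruct H as [_ Hr].
  assert (IZR A <> 0) by (apply not_0_IZR; auto). unfold quad_root in *. split.
  - transitivity (IZR A * w ^ 2 + IZR B * w + IZR C); auto. field; auto.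
  - intros E. destruct (irrational_linear w (2 * A) B Hw) as [F _]; [|lia].
    rewrite mult_IZR. apply Rmult_eq_reg_r with (/ IZR A); [|apply Rinv_neq_0_compat; auto].
    field_simplify; auto. field_simplify in E; auto.
    apply Rmult_eq_reg_l with (IZR A); auto. field_simplify; auto.
    apply (f_equal (fun z => IZR A * z)) in E. field_simplify in E; auto. lra.
Qed.

Lemma conjugate_unique (w : R) (A B C : Z) (x : R) : irrational w -> primitive_poly w A B C ->
  quad_root A B C x -> x <> w -> conjugate w = x.
Proof.
  intros Hw H Hx Hne. pose proof (primitive_lead_nz _ _ _ _ Hw H) as N.
  destruct (epsilon_spec (inhabits 0) (fun w' => w' <> w /\ exists A B C : Z, primitive_poly w A B C /\ quad_root A B C w'))
    as [S1 [A2 [B2 [C2 [H2 S2]]]]]; [exists x; split; eauto|].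
  fold (conjugate w) in S1, S2.
  assert (S3 : quad_root A B C (conjugate w)).
  { unfold quad_root in *.
    destruct (primitive_unique w A B C A2 B2 C2 Hw H H2) as [[-> [-> ->]]|[-> [-> ->]]]; auto.
    rewrite !opp_IZR in S2. lra. }
  rewrite (quad_root_pair A B C w x), (quad_root_pair A B C w (conjugate w)); auto; apply H.
Qed.

Lemma conjugate_facts (w : R) (A B C : Z) : irrational w -> primitive_poly w A B C ->
  let w' := conjugate w in
  w' <> w /\ IZR A * (w + w') = - IZR B /\ IZR A * (w * w') = IZR C /\ primitive_poly w' A B C /\ irrational w'.
Proof.
  intros Hw H w'. pose proof (primitive_lead_nz _ _ _ _ Hw H) as N.
  assert (HA : IZR A <> 0) by (apply not_0_IZR; auto).
  destruct (conjugate_root_exists w A B C Hw H) as [R1 R2].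
  assert (E : w' = - IZR B / IZR A - w) by (apply (conjugate_unique w A B C); auto).
  assert (E1 : IZR A * (w + w') = - IZR B) by (rewrite E; field; auto).
  split; [rewrite E; auto|]. split; auto. split; [|split].
  - destruct H as [_ Hr]. unfold quad_root in Hr.
    assert (IZR A * w * (w + w') = - IZR B * w) by (rewrite <- E1; ring). lra.
  - split; [apply H | rewrite E; auto].
  - intros p q Hq Ep. assert (Q : IZR q <> 0) by (apply not_0_IZR; auto).
    apply (Hw (- B * q - A * p)%Z (A * q)%Z); [lia|].
    rewrite minus_IZR, !mult_IZR, opp_IZR. rewrite Ep in E.
    replace w with (- IZR B / IZR A - IZR p / IZR q) by lra. field. auto.
Qed.

Lemma quad_irr_conjugate (w : R) : quad_irr w ->
  irrational (conjugate w) /\ quad_irr (conjugate w) /\ conjugate (conjugate w) = w /\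
  Defs.disc (conjugate w) = Defs.disc w /\ conjugate w <> w.
Proof.
  intros Hq. destruct (primitive_exists w Hq) as [A [B [C H]]]. destruct Hq as [Hw _].
  destruct (conjugate_facts w A B C Hw H) as [F1 [F2 [F3 [F4 F5]]]].
  split; auto. split; [|split; [|split]]; auto.
  - split; auto. exists A, B, C. split; [apply (primitive_lead_nz _ _ _ _ Hw H) | apply F4].
  - apply (conjugate_unique _ A B C); auto. apply H.
  - rewrite (disc_unique _ A B C F5 F4), (disc_unique _ A B C Hw H). auto.
Qed.

Lemma quad_irr_opp (w : R) : quad_irr w ->
  quad_irr (- w) /\ conjugate (- w) = - conjugate w /\ Defs.disc (- w) = Defs.disc w.
Proof.
  intros Hq. destruct (primitive_exists w Hq) as [A [B [C H]]]. destruct Hq as [Hw _].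
  destruct (conjugate_facts w A B C Hw H) as [F1 [F2 [F3 [F4 F5]]]].
  assert (Hwo : irrational (- w)).
  { intros p q Hq E. apply (Hw (- p)%Z q Hq). rewrite opp_IZR. lra. }
  assert (Hp : primitive_poly (- w) A (- B) C).
  { destruct H as [G1 G2]. split; [rewrite Z.gcd_opp_r; auto|]. unfold quad_root in *. rewrite opp_IZR. lra. }
  split; [|split].
  - split; auto. exists A, (- B)%Z, C. split; [apply (primitive_lead_nz _ _ _ _ Hw H) | apply Hp].
  - apply (conjugate_unique _ A (- B) C); auto.
    + destruct F4 as [_ G]. unfold quad_root in *. rewrite opp_IZR. lra.
    + lra.
  - rewrite (disc_unique _ _ _ _ Hwo Hp), (disc_unique _ _ _ _ Hw H). ring.
Qed.

(** * Primitive polynomials under the modular group *)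

Lemma gcd3_divide (g A B C : Z) : (g | A)%Z -> (g | B)%Z -> (g | C)%Z -> Z.gcd (Z.gcd A B) C = 1%Z -> (0 <= g)%Z -> g = 1%Z.
Proof.
  intros HA HB HC H Hg. apply Z.divide_1_r_nonneg; auto. rewrite <- H.
  apply Z.gcd_greatest; auto. apply Z.gcd_greatest; auto.
Qed.

(** The triple A1, B1, C1 is the quadratic form transformed by the inverse matrix. Transforming back
    writes A, B, C as integral combinations of it, so it is again primitive; its second root is the
    image of w'. *)
Lemma Gamma_equiv_facts (w w1 : R) (a b c d : Z) : quad_irr w -> quad_irr w1 -> (a * d - b * c = 1)%Z ->
  w1 = (IZR a * w + IZR b) / (IZR c * w + IZR d) ->
  conjugate w1 = (IZR a * conjugate w + IZR b) / (IZR c * conjugate w + IZR d) /\ Defs.disc w1 = Defs.disc w.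
Proof.
  intros Hq [Hw1 _] Hdet E. destruct (primitive_exists w Hq) as [A [B [C H]]]. destruct Hq as [Hw _].
  destruct (conjugate_facts w A B C Hw H) as [F1 [F2 [F3 [F4 F5]]]]. set (w' := conjugate w) in *.
  assert (Hcd : (c <> 0 \/ d <> 0)%Z) by (destruct (Z.eq_dec c 0); [right; lia | left; auto]).
  pose proof (irrational_linear_nz w c d Hw Hcd) as N. pose proof (irrational_linear_nz w' c d F5 Hcd) as N'.
  set (A1 := (A * (d * d) - B * (d * c) + C * (c * c))%Z).
  set (B1 := (- (2 * A * (b * d)) + B * (a * d + b * c) - 2 * C * (a * c))%Z).
  set (C1 := (A * (b * b) - B * (a * b) + C * (a * a))%Z).
  assert (Hdet' : IZR a * IZR d - IZR b * IZR c = 1) by (rewrite <- !mult_IZR, <- minus_IZR, Hdet; auto).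
  assert (Root : forall x, quad_root A B C x -> IZR c * x + IZR d <> 0 ->
    quad_root A1 B1 C1 ((IZR a * x + IZR b) / (IZR c * x + IZR d))).
  { intros x Hx Nx. unfold quad_root in *. unfold A1, B1, C1.
    rewrite ?plus_IZR, ?minus_IZR, ?plus_IZR, ?opp_IZR, !mult_IZR, ?plus_IZR, !mult_IZR.
    apply Rmult_eq_reg_r with ((IZR c * x + IZR d) ^ 2); [|apply pow_nonzero; auto]. rewrite Rmult_0_l.
    transitivity ((IZR a * IZR d - IZR b * IZR c) ^ 2 * (IZR A * x ^ 2 + IZR B * x + IZR C)).
    - field. auto.
    - rewrite Hx. ring. }
  assert (P1 : primitive_poly w1 A1 B1 C1).
  { split; [|rewrite E; apply Root; auto; apply H].
    set (g := Z.gcd (Z.gcd A1 B1) C1).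
    assert (GA : (g | A1)%Z) by (eapply Z.divide_trans; [apply Z.gcd_divide_l|]; apply Z.gcd_divide_l).
    assert (GB : (g | B1)%Z) by (eapply Z.divide_trans; [apply Z.gcd_divide_l|]; apply Z.gcd_divide_r).
    assert (GC : (g | C1)%Z) by apply Z.gcd_divide_r.
    assert (Comb : forall x y z, (g | x * A1 + y * B1 + z * C1)%Z).
    { intros. repeat apply Z.divide_add_r; apply Z.divide_mul_r; auto. }
    apply (gcd3_divide g A B C); try apply H; try apply Z.gcd_nonneg.
    - replace A with ((a * a) * A1 + (a * c) * B1 + (c * c) * C1)%Z; auto.
      transitivity (A * ((a * d - b * c) * (a * d - b * c)))%Z; [unfold A1, B1, C1; ring | rewrite Hdet; ring].
    - replace B with ((2 * a * b) * A1 + (a * d + b * c) * B1 + (2 * c * d) * C1)%Z; auto.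
      transitivity (B * ((a * d - b * c) * (a * d - b * c)))%Z; [unfold A1, B1, C1; ring | rewrite Hdet; ring].
    - replace C with ((b * b) * A1 + (b * d) * B1 + (d * d) * C1)%Z; auto.
      transitivity (C * ((a * d - b * c) * (a * d - b * c)))%Z; [unfold A1, B1, C1; ring | rewrite Hdet; ring]. }
  split.
  - apply (conjugate_unique w1 A1 B1 C1); auto.
    + apply Root; auto. apply F4.
    + rewrite E. intros Eq. apply F1.
      assert (X : (IZR a * w' + IZR b) * (IZR c * w + IZR d) = (IZR a * w + IZR b) * (IZR c * w' + IZR d)).
      { apply (f_equal (fun z => z * ((IZR c * w' + IZR d) * (IZR c * w + IZR d)))) in Eq. field_simplify in Eq; auto. lra. }
      assert (Y : (IZR a * IZR d - IZR b * IZR c) * (w' - w) = 0) by lra. rewrite Hdet' in Y. lra.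
  - rewrite (disc_unique _ _ _ _ Hw1 P1), (disc_unique _ _ _ _ Hw H).
    transitivity ((B * B - 4 * A * C) * ((a * d - b * c) * (a * d - b * c)))%Z; [unfold A1, B1, C1; ring | rewrite Hdet; ring].
Qed.

(** By Vieta; if D were a square, 2 A w + B = A (w - w') would be an integer and w rational. *)
Lemma disc_sqrt (w : R) (A B C : Z) : irrational w -> primitive_poly w A B C ->
  (IZR A * (w - conjugate w)) ^ 2 = IZR (Defs.disc w) /\ (0 < Defs.disc w)%Z /\
  (forall n : Z, (n * n <> Defs.disc w)%Z).
Proof.
  intros Hw H. destruct (conjugate_facts w A B C Hw H) as [F1 [F2 [F3 _]]].
  pose proof (primitive_lead_nz _ _ _ _ Hw H) as N.
  assert (HA : IZR A <> 0) by (apply not_0_IZR; auto).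
  assert (E : (IZR A * (w - conjugate w)) ^ 2 = IZR (Defs.disc w)).
  { rewrite (disc_unique _ _ _ _ Hw H), minus_IZR, !mult_IZR.
    transitivity ((IZR A * (w + conjugate w)) ^ 2 - 4 * IZR A * (IZR A * (w * conjugate w))); [ring|].
    rewrite F2, F3. ring. }
  split; auto. split.
  - apply lt_IZR. rewrite <- E. apply pow2_gt_0. apply Rmult_integral_contrapositive_currified; auto. lra.
  - intros n Hn. rewrite <- Hn, mult_IZR in E.
    assert (G : forall m : Z, IZR A * (w - conjugate w) = IZR m -> False).
    { intros m Hm. destruct (irrational_linear w (2 * A) (B - m) Hw) as [F _]; [|lia].
      rewrite minus_IZR, mult_IZR. lra. }
    assert (Z : (IZR A * (w - conjugate w) - IZR n) * (IZR A * (w - conjugate w) + IZR n) = 0) by lra.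
    apply Rmult_integral in Z. destruct Z as [Z|Z]; [apply (G n); lra | apply (G (- n)%Z); rewrite opp_IZR; lra].
Qed.

(** * Units *)

Lemma pigeonhole (T : Type) (l : list T) (f : nat -> T) (n : nat) : (length l < n)%nat ->
  (forall i, (i < n)%nat -> In (f i) l) -> exists i k, (i < k < n)%nat /\ f i = f k.
Proof.
  intros Hn Hf. apply NNPP. intros G.
  assert (ND : NoDup (map f (seq 0 n))).
  { apply NoDup_map_NoDup_ForallPairs; [|apply seq_NoDup].
    intros x y Hx Hy E. apply in_seq in Hx, Hy.
    destruct (Nat.lt_trichotomy x y) as [h|[h|h]]; auto; exfalso; apply G.
    - exists x, y. split; auto; lia.
    - exists y, x. split; auto; lia. }
  assert (I : incl (map f (seq 0 n)) l).
  { intros z Hz. apply in_map_iff in Hz. destruct Hz as [i [<- Hi]]. apply in_seq in Hi. apply Hf. lia. }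
  pose proof (NoDup_incl_length ND I) as L. rewrite length_map, length_seq in L. lia.
Qed.

(** The N + 1 fractional parts of i x, 0 <= i <= N, fall into N boxes of length 1/N; two in one box
    give p and q as differences. *)
Lemma dirichlet_approximation (x : R) (N : nat) : (0 < N)%nat ->
  exists p q : Z, (1 <= q <= Z.of_nat N)%Z /\ Rabs (IZR p - IZR q * x) < / INR N.
Proof.
  intros HN. assert (PN : 0 < INR N) by (apply lt_0_INR; auto).
  set (fl := fun y : R => (up y - 1)%Z).
  assert (Hfl : forall y, IZR (fl y) <= y < IZR (fl y) + 1).
  { intros y. unfold fl. destruct (archimed y). rewrite minus_IZR. lra. }
  set (fr := fun i : nat => INR i * x - IZR (fl (INR i * x))).
  assert (Hfr : forall i, 0 <= fr i < 1) by (intros i; unfold fr; specialize (Hfl (INR i * x)); lra).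
  set (box := fun i => Z.to_nat (fl (INR N * fr i))).
  assert (Hbox : forall i, INR (box i) <= INR N * fr i < INR (box i) + 1 /\ (box i < N)%nat).
  { intros i. pose proof (Hfl (INR N * fr i)) as B. pose proof (Hfr i) as F.
    assert (0 <= INR N * fr i < INR N) by (split; [apply Rmult_le_pos; lra | nra]).
    assert (P1 : (-1 < fl (INR N * fr i)%R)%Z) by (apply lt_IZR; lra).
    assert (P2 : (fl (INR N * fr i)%R < Z.of_nat N)%Z) by (apply lt_IZR; rewrite <- INR_IZR_INZ; lra).
    unfold box. split; [|lia]. rewrite INR_IZR_INZ, Z2Nat.id by lia. auto. }
  destruct (pigeonhole nat (seq 0 N) box (S N)) as [i [k [Hik E]]].
  { rewrite length_seq. lia. }
  { intros i _. apply in_seq. destruct (Hbox i). lia. }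
  exists (fl (INR k * x)%R - fl (INR i * x)%R)%Z, (Z.of_nat k - Z.of_nat i)%Z.
  split; [lia|]. rewrite !minus_IZR, <- !INR_IZR_INZ.
  replace (IZR (fl (INR k * x)) - IZR (fl (INR i * x)) - (INR k - INR i) * x) with (fr i - fr k)
    by (unfold fr; ring).
  destruct (Hbox i) as [B1 _], (Hbox k) as [B2 _]. rewrite E in B1.
  apply Rmult_lt_reg_l with (INR N); auto. rewrite Rinv_r by lra.
  rewrite <- (Rabs_pos_eq (INR N)) at 1 by lra. rewrite <- Rabs_mult. apply Rabs_def1; lra.
Qed.

Definition pell_approx (D : Z) (pq : Z * Z) : Prop :=
  (1 <= snd pq)%Z /\ Rabs (IZR (fst pq * fst pq - D * (snd pq * snd pq))) <= 2 * sqrt (IZR D) + 1.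

Definition pell_error (D : Z) (pq : Z * Z) : R := Rabs (IZR (fst pq) - IZR (snd pq) * sqrt (IZR D)).

(** With s = sqrt D and e = |p - q s| one has e <= 1 and e q <= 1, so |p^2 - D q^2| <= e (e + 2 q s)
    <= 1 + 2 s, a bound independent of eps. *)
Lemma pell_approx_exists (D : Z) (eps : R) : (0 < D)%Z -> 0 < eps ->
  exists pq, pell_approx D pq /\ pell_error D pq < eps.
Proof.
  intros HD He. assert (HD' : 0 < IZR D) by (apply IZR_lt; auto).
  destruct (archimed (/ eps)) as [A _]. set (N := Z.to_nat (up (/ eps))).
  assert (Hie : 0 < / eps) by (apply Rinv_0_lt_compat; auto).
  assert (HN : INR N = IZR (up (/ eps))).
  { unfold N. rewrite INR_IZR_INZ, Z2Nat.id; auto. apply le_IZR. lra. }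
  assert (PN : 0 < INR N) by lra.
  assert (HN0 : (0 < N)%nat) by (apply INR_lt; auto).
  destruct (dirichlet_approximation (sqrt (IZR D)) N HN0) as [p [q [[Hq1 Hq2] Hpq]]].
  set (s := sqrt (IZR D)) in *.
  assert (Hs : 0 < s) by (apply sqrt_lt_R0; auto).
  assert (Hss : s * s = IZR D) by (apply sqrt_sqrt; lra).
  exists (p, q). unfold pell_approx, pell_error. cbn [fst snd]. fold s. split; [split; auto|].
  - assert (Q1 : 1 <= IZR q) by (apply IZR_le; auto).
    assert (QN : IZR q <= INR N) by (rewrite INR_IZR_INZ; apply IZR_le; auto).
    replace (IZR (p * p - D * (q * q))) with ((IZR p - IZR q * s) * (IZR p + IZR q * s))
      by (rewrite minus_IZR, !mult_IZR, <- Hss; ring).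
    rewrite Rabs_mult. set (e := Rabs (IZR p - IZR q * s)) in *.
    assert (T : Rabs (IZR p + IZR q * s) <= e + 2 * (IZR q * s)).
    { replace (IZR p + IZR q * s) with ((IZR p - IZR q * s) + 2 * (IZR q * s)) by ring.
      eapply Rle_trans; [apply Rabs_triang|]. fold e. rewrite (Rabs_pos_eq (2 * _)); [lra|].
      repeat apply Rmult_le_pos; lra. }
    assert (e0 : 0 <= e) by apply Rabs_pos.
    assert (eq : e * IZR q <= 1).
    { apply Rle_trans with (/ INR N * INR N); [apply Rmult_le_compat; lra | rewrite Rinv_l; lra]. }
    assert (e1 : e <= 1) by nra.
    apply Rle_trans with (e * (e + 2 * (IZR q * s))); [apply Rmult_le_compat_l; auto|].
    replace (e * (e + 2 * (IZR q * s))) with (e * e + 2 * ((e * IZR q) * s)) by ring.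
    assert (e * IZR q * s <= 1 * s) by (apply Rmult_le_compat_r; lra). nra.
  - eapply Rlt_trans; [exact Hpq|]. rewrite <- (Rinv_inv eps). apply Rinv_lt_contravar; [|lra].
    apply Rmult_lt_0_compat; lra.
Qed.

Lemma sqrt_nonsquare_irrational (D : Z) : (0 < D)%Z -> (forall n : Z, (n * n <> D)%Z) ->
  forall p q : Z, q <> 0%Z -> IZR p - IZR q * sqrt (IZR D) <> 0.
Proof.
  intros HD Hns p q Hq E. assert (HD' : 0 < IZR D) by (apply IZR_lt; auto).
  assert (Hss : sqrt (IZR D) * sqrt (IZR D) = IZR D) by (apply sqrt_sqrt; lra).
  assert (E2 : (p * p = D * (q * q))%Z).
  { apply eq_IZR. rewrite !mult_IZR, <- Hss. replace (IZR p) with (IZR q * sqrt (IZR D)) by lra. ring. }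
  destruct (Z.gcd_divide_l p q) as [p' Ep]. destruct (Z.gcd_divide_r p q) as [q' Eq].
  assert (Hg : (0 < Z.gcd p q)%Z).
  { pose proof (Z.gcd_nonneg p q). assert (Z.gcd p q <> 0)%Z by (intros G; apply Z.gcd_eq_0_r in G; auto). lia. }
  set (g := Z.gcd p q) in *.
  assert (Hc : Z.gcd q' p' = 1%Z).
  { apply Z.mul_reg_r with g; [lia|]. rewrite <- Z.gcd_mul_mono_r_nonneg by lia.
    rewrite <- Ep, <- Eq, Z.gcd_comm. fold g. lia. }
  assert (E3 : (p' * p' = D * (q' * q'))%Z).
  { apply Z.mul_reg_r with (g * g)%Z; [nia|].
    transitivity (p * p)%Z; [rewrite Ep; ring|]. rewrite E2, Eq. ring. }
  assert (Hd : (q' | p')%Z).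
  { apply (Z.gauss _ p'); auto. exists (D * q')%Z. rewrite E3. ring. }
  assert (H1 : (q' | 1)%Z) by (rewrite <- Hc; apply Z.gcd_greatest; auto; apply Z.divide_refl).
  apply (Hns p'). rewrite E3. apply Z.divide_1_r in H1. destruct H1 as [->| ->]; ring.
Qed.

(** Successively better approximations have norms in a fixed finite range; two of them with equal
    norm r and congruent modulo r have an integral quotient, of norm 1. *)
Theorem pell_solvable (D : Z) : (0 < D)%Z -> (forall n : Z, (n * n <> D)%Z) ->
  exists x y : Z, (y <> 0 /\ x * x - D * (y * y) = 1)%Z.
Proof.
  intros HD Hns. assert (HD' : 0 < IZR D) by (apply IZR_lt; auto).
  assert (Hpos : forall pq, pell_approx D pq -> 0 < pell_error D pq).
  { intros [p q] [Hq _]. apply Rabs_pos_lt. apply sqrt_nonsquare_irrational; auto. cbn [fst snd] in *. lia. }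
  assert (Step : forall pq, exists pq', pell_approx D pq -> pell_approx D pq' /\ pell_error D pq' < pell_error D pq).
  { intros pq. destruct (classic (pell_approx D pq)) as [G|G].
    - destruct (pell_approx_exists D (pell_error D pq) HD (Hpos pq G)) as [pq' H]. exists pq'; auto.
    - exists pq; tauto. }
  set (next := fun pq => proj1_sig (constructive_indefinite_description _ (Step pq))).
  assert (Hnext : forall pq, pell_approx D pq -> pell_approx D (next pq) /\ pell_error D (next pq) < pell_error D pq).
  { intros pq. unfold next. destruct (constructive_indefinite_description _ (Step pq)). auto. }
  destruct (pell_approx_exists D 1 HD Rlt_0_1) as [pq0 [H0 _]].
  set (u := fun n => Nat.iter n next pq0).
  assert (Hu : forall n, pell_approx D (u n)).
  { induction n; auto. apply (Hnext _ IHn). }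
  assert (Hlt : forall i k, (i < k)%nat -> pell_error D (u k) < pell_error D (u i)).
  { intros i k H. induction H as [|k H IH].
    - apply (Hnext _ (Hu i)).
    - eapply Rlt_trans; [apply (Hnext _ (Hu k)) | exact IH]. }
  set (nrm := fun pq : Z * Z => (fst pq * fst pq - D * (snd pq * snd pq))%Z).
  set (M := up (2 * sqrt (IZR D) + 1)).
  assert (HM : forall n, (Z.abs (nrm (u n)) < M)%Z).
  { intros n. destruct (Hu n) as [_ B]. apply lt_IZR. rewrite abs_IZR. unfold M.
    destruct (archimed (2 * sqrt (IZR D) + 1)). unfold nrm. lra. }
  assert (Hn0 : forall n, nrm (u n) <> 0%Z).
  { intros n E. destruct (Hu n) as [Q _]. pose proof (Hpos _ (Hu n)) as P. destruct (u n) as [p q].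
    unfold nrm, pell_error in *. cbn [fst snd] in *.
    assert (Hss : sqrt (IZR D) * sqrt (IZR D) = IZR D) by (apply sqrt_sqrt; lra).
    assert (F : (IZR p - IZR q * sqrt (IZR D)) * (IZR p - IZR (- q) * sqrt (IZR D)) = 0).
    { transitivity (IZR p * IZR p - (sqrt (IZR D) * sqrt (IZR D)) * (IZR q * IZR q)); [rewrite opp_IZR; ring|].
      rewrite Hss, <- !mult_IZR, <- minus_IZR, E. auto. }
    apply Rmult_integral in F. destruct F as [F|F]; revert F; apply sqrt_nonsquare_irrational; auto; lia. }
  set (range := map (fun i => (Z.of_nat i - M)%Z) (seq 0 (Z.to_nat (2 * M)))).
  assert (Hrange : forall z, (Z.abs z < M)%Z -> In z range).
  { intros z Hz. apply in_map_iff. exists (Z.to_nat (z + M)). split; [lia|]. apply in_seq. lia. }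
  (* The residues too have absolute value below M, whatever the sign of r, so the keys lie in a
     finite list. *)
  set (key := fun n => let r := nrm (u n) in (r, (fst (u n) mod r, snd (u n) mod r)%Z)).
  set (l := list_prod range (list_prod range range)).
  destruct (pigeonhole _ l key (S (length l))) as [i [k [Hik E]]]; [lia| |].
  { intros n _. unfold key, l. pose proof (HM n) as B. pose proof (Hn0 n) as N. set (r := nrm (u n)) in *.
    assert (Mod : forall z, (Z.abs (z mod r) < M)%Z).
    { intros z. pose proof (Z.mod_pos_bound z r). pose proof (Z.mod_neg_bound z r). lia. }
    cbv zeta. apply in_prod; [|apply in_prod]; apply Hrange; auto. }
  unfold key in E. injection E as E1 E2 E3.
  pose proof (Hn0 i) as N. destruct (Hu i) as [Q1 _], (Hu k) as [Q2 _].
  pose proof (Hlt i k ltac:(lia)) as L.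
  destruct (u i) as [p1 q1], (u k) as [p2 q2]. unfold nrm in *. cbn [fst snd] in *.
  rewrite <- E1 in E2, E3.
  set (r := (p1 * p1 - D * (q1 * q1))%Z) in *.
  assert (C1 : (r | p1 - p2)%Z).
  { exists (p1 / r - p2 / r)%Z. pose proof (Z.div_mod p1 r N). pose proof (Z.div_mod p2 r N). lia. }
  assert (C2 : (r | q1 - q2)%Z).
  { exists (q1 / r - q2 / r)%Z. pose proof (Z.div_mod q1 r N). pose proof (Z.div_mod q2 r N). lia. }
  destruct C1 as [m1 C1], C2 as [m2 C2].
  assert (DX : (p1 * p2 - D * (q1 * q2) = (1 - p1 * m1 + D * (q1 * m2)) * r)%Z).
  { replace p2 with (p1 - m1 * r)%Z by lia. replace q2 with (q1 - m2 * r)%Z by lia.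
    transitivity (r - p1 * m1 * r + D * (q1 * m2) * r)%Z; [unfold r at 3; ring | ring]. }
  assert (DY : (p1 * q2 - p2 * q1 = (q1 * m1 - p1 * m2) * r)%Z).
  { replace p2 with (p1 - m1 * r)%Z by lia. replace q2 with (q1 - m2 * r)%Z by lia. ring. }
  (* X + Y sqrt D is (p1 - q1 sqrt D)(p2 + q2 sqrt D) / r. *)
  set (X := (1 - p1 * m1 + D * (q1 * m2))%Z) in *. set (Y := (q1 * m1 - p1 * m2)%Z) in *.
  exists X, Y. split.
  (* Y = 0 would make the two pairs equal, against the strict decrease of the error. *)
  - intros HY. rewrite HY in DY.
    assert (E4 : (p1 * q2 = p2 * q1)%Z) by lia.
    assert (E5 : (r * (q2 * q2) = r * (q1 * q1))%Z).
    { rewrite E1 at 2. unfold r. 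
      transitivity ((p1 * q2) * (p1 * q2) - D * (q1 * q1) * (q2 * q2))%Z; [ring|]. rewrite E4. ring. }
    apply Z.mul_reg_l in E5; auto. assert (E6 : q2 = q1) by nia. subst q2.
    apply Z.mul_reg_r in E4; [|lia]. subst p2. lra.
  - apply Z.mul_reg_r with (r * r)%Z; [nia|].
    transitivity ((X * r) * (X * r) - D * ((Y * r) * (Y * r)))%Z; [ring|].
    rewrite <- DX, <- DY. transitivity (r * (p2 * p2 - D * (q2 * q2)))%Z; [unfold r; ring|]. rewrite <- E1. ring.
Qed.

(** * The group of norm-one units *)

Lemma norm_one_unit_1 (D : Z) : norm_one_unit D 1.
Proof. exists 1%Z, 0%Z. split; ring. Qed.

Lemma norm_one_unit_opp (D : Z) (x : R) : norm_one_unit D x -> norm_one_unit D (- x).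
Proof. intros [a [b [-> H]]]. exists (- a)%Z, (- b)%Z. rewrite !opp_IZR. split; [ring|]. rewrite <- H. ring. Qed.

Lemma norm_one_unit_inv (D : Z) (x : R) : norm_one_unit D x -> norm_one_unit D (/ x).
Proof.
  intros [a [b [E H]]].
  assert (Hx : x <> 0) by (intros F; rewrite F in H; lra).
  exists (a + b * D)%Z, (- b)%Z. rewrite plus_IZR, mult_IZR, opp_IZR.
  assert (I : / x = IZR a + IZR b * ((IZR D - sqrt (IZR D)) / 2)).
  { apply Rmult_eq_reg_l with x; auto. rewrite H. field. auto. }
  split; [rewrite I; field|].
  replace (IZR a + IZR b * IZR D + - IZR b * ((IZR D - sqrt (IZR D)) / 2)) with x by (rewrite E; field).
  field. auto.
Qed.

(** For omega = (D + t) / 2 with t^2 = D one has omega^2 = D omega - M. The product formula is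
    proved for both signs of t, so that it covers the conjugates. *)
Lemma norm_one_unit_mult (D : Z) (x y : R) : (0 < D)%Z -> (exists M, D * D - D = 4 * M)%Z ->
  norm_one_unit D x -> norm_one_unit D y -> norm_one_unit D (x * y).
Proof.
  intros HD [M HM] [a [b [Ex Hx]]] [c [d [Ey Hy]]].
  assert (HD' : 0 < IZR D) by (apply IZR_lt; auto).
  assert (Hss : sqrt (IZR D) * sqrt (IZR D) = IZR D) by (apply sqrt_sqrt; lra).
  assert (HM' : IZR D * IZR D - IZR D = 4 * IZR M) by (rewrite <- !mult_IZR, <- minus_IZR, HM, mult_IZR; auto).
  set (s := sqrt (IZR D)) in *.
  assert (W : forall t, t * t = IZR D -> (IZR a + IZR b * ((IZR D + t) / 2)) * (IZR c + IZR d * ((IZR D + t) / 2))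
    = IZR (a * c - M * (b * d)) + IZR (a * d + b * c + D * (b * d)) * ((IZR D + t) / 2)).
  { intros t Ht. rewrite minus_IZR, !plus_IZR, !mult_IZR.
    assert (Q : ((IZR D + t) / 2) * ((IZR D + t) / 2) = IZR D * ((IZR D + t) / 2) - IZR M).
    { replace (IZR M) with ((IZR D * IZR D - IZR D) / 4) by lra. rewrite <- Ht at 7. field. }
    set (om := (IZR D + t) / 2) in *.
    transitivity (IZR a * IZR c + (IZR a * IZR d + IZR b * IZR c) * om + IZR b * IZR d * (om * om)); [ring|].
    rewrite Q. ring. }
  exists (a * c - M * (b * d))%Z, (a * d + b * c + D * (b * d))%Z. fold s. split.
  - rewrite <- W by auto. rewrite Ex, Ey. auto.
  - replace ((IZR D - s) / 2) with ((IZR D + - s) / 2) by (unfold Rminus; auto).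
    rewrite <- W by (rewrite <- Hss; ring).
    replace ((IZR D + - s) / 2) with ((IZR D - s) / 2) by (unfold Rminus; auto).
    transitivity ((x * (IZR a + IZR b * ((IZR D - s) / 2))) * (y * (IZR c + IZR d * ((IZR D - s) / 2)))); [ring|].
    rewrite Hx, Hy. ring.
Qed.

Lemma norm_one_unit_exists_gt_1 (D : Z) : (0 < D)%Z -> (forall n : Z, (n * n <> D)%Z) ->
  exists x, 1 < x /\ norm_one_unit D x.
Proof.
  intros HD Hns. destruct (pell_solvable D HD Hns) as [p [q [Hq E]]].
  assert (HD' : 0 < IZR D) by (apply IZR_lt; auto).
  assert (Hss : sqrt (IZR D) * sqrt (IZR D) = IZR D) by (apply sqrt_sqrt; lra).
  assert (Hs : 0 < sqrt (IZR D)) by (apply sqrt_lt_R0; auto).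
  set (s := sqrt (IZR D)) in *. set (P := Z.abs p). set (Q := Z.abs q).
  assert (E' : (P * P - D * (Q * Q) = 1)%Z) by (unfold P, Q; nia).
  assert (HP : 1 <= IZR P) by (apply IZR_le; unfold P, Q in *; nia).
  assert (HQ : 1 <= IZR Q) by (apply IZR_le; unfold Q; lia).
  assert (ER : IZR P * IZR P - s * s * (IZR Q * IZR Q) = 1).
  { rewrite Hss, <- !mult_IZR, <- minus_IZR, E'. auto. }
  exists (IZR P + IZR Q * s). split.
  - assert (0 < IZR Q * s) by (apply Rmult_lt_0_compat; lra). lra.
  (* P + Q sqrt D rewritten through sqrt D = 2 omega - D. *)
  - exists (P - Q * D)%Z, (2 * Q)%Z. fold s. rewrite minus_IZR, !mult_IZR. split; [field|].
    rewrite <- ER. field.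
Qed.

Definition unit_coord (D : Z) (x : R) : R := (x - / x) / sqrt (IZR D).

Lemma unit_coord_integer (D : Z) (x : R) : (0 < D)%Z -> norm_one_unit D x ->
  exists b : Z, unit_coord D x = IZR b.
Proof.
  intros HD [a [b [E H]]]. exists b. unfold unit_coord.
  assert (Hs : 0 < sqrt (IZR D)) by (apply sqrt_lt_R0, IZR_lt; auto).
  assert (Hx : x <> 0) by (intros F; rewrite F in H; lra).
  assert (I : / x = IZR a + IZR b * ((IZR D - sqrt (IZR D)) / 2)).
  { apply Rmult_eq_reg_l with x; auto. rewrite H. field. auto. }
  rewrite I, E. field. lra.
Qed.

Lemma unit_coord_lt (D : Z) (x y : R) : (0 < D)%Z -> 0 < x < y -> unit_coord D x < unit_coord D y.
Proof.
  intros HD H. unfold unit_coord. apply Rmult_lt_compat_r.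
  - apply Rinv_0_lt_compat, sqrt_lt_R0, IZR_lt; auto.
  - assert (/ y < / x) by (apply Rinv_lt_contravar; [apply Rmult_lt_0_compat|]; lra). lra.
Qed.

(* A norm-one unit x > 1 is an increasing function of its integral coordinate
   (x - 1/x)/sqrt D, so there is a least one. *)
Lemma least_unit (D : Z) : (0 < D)%Z -> (forall n : Z, (n * n <> D)%Z) ->
  exists e, 1 < e /\ norm_one_unit D e /\ forall x, 1 < x -> norm_one_unit D x -> e <= x.
Proof.
  intros HD Hns.
  assert (Hb : forall x, 1 < x -> norm_one_unit D x -> exists n : nat, unit_coord D x = INR n).
  { intros x Hx Ux. destruct (unit_coord_integer D x HD Ux) as [b E].
    pose proof (unit_coord_lt D 1 x HD ltac:(lra)) as L. rewrite E in *.
    unfold unit_coord in L. rewrite Rinv_1 in L. replace ((1 - 1) / sqrt (IZR D)) with 0 in L by (unfold Rdiv; ring).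
    apply lt_IZR in L. exists (Z.to_nat b). rewrite INR_IZR_INZ, Z2Nat.id by lia. auto. }
  assert (W : forall n : nat, forall x, 1 < x -> norm_one_unit D x -> unit_coord D x = INR n ->
    exists e, 1 < e /\ norm_one_unit D e /\ forall x, 1 < x -> norm_one_unit D x -> e <= x).
  { induction n as [n IH] using lt_wf_ind. intros x Hx Ux En.
    destruct (classic (exists y, 1 < y < x /\ norm_one_unit D y)) as [[y [Hy Uy]]|G].
    - destruct (Hb y ltac:(lra) Uy) as [m Em]. apply (IH m) with (x := y); auto; try lra.
      apply INR_lt. rewrite <- En, <- Em. apply unit_coord_lt; auto. lra.
    - exists x. split; auto. split; auto. intros y Hy Uy. apply Rnot_lt_le. intros Hlt. apply G. exists y. split; auto. }
  destruct (norm_one_unit_exists_gt_1 D HD Hns) as [x [Hx Ux]]. destruct (Hb x Hx Ux) as [n En].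
  apply (W n x); auto.
Qed.

(** The least unit e > 1 generates: a unit x > 1 is at least e, and dividing by e lowers the
    exponent n in x < e^n. Units in (0, 1) and negative units reduce to these by inversion and sign.
    Hence the predicate in [fund_unit] is satisfiable and [epsilon] obeys it. *)
Lemma fund_unit_spec (D : Z) : (0 < D)%Z -> (forall n : Z, (n * n <> D)%Z) -> (exists M, D * D - D = 4 * M)%Z ->
  1 < fund_unit D /\ norm_one_unit D (fund_unit D).
Proof.
  intros HD Hns HM.
  assert (S : 1 < fund_unit D /\ forall x : R, norm_one_unit D x <->
      exists n : Z, x = powerRZ (fund_unit D) n \/ x = - powerRZ (fund_unit D) n).
  { unfold fund_unit. apply epsilon_spec. destruct (least_unit D HD Hns) as [e [He [Ue Hmin]]].
    exists e. split; auto.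
    assert (Un : forall n : nat, norm_one_unit D (e ^ n)).
    { induction n; [apply norm_one_unit_1 | simpl; apply norm_one_unit_mult; auto]. }
    assert (Uz : forall n : Z, norm_one_unit D (powerRZ e n)).
    { intros [|p|p]; simpl; [apply norm_one_unit_1 | auto | apply norm_one_unit_inv; auto]. }
    assert (Ge : forall n : nat, forall x, 1 <= x -> x < e ^ n -> norm_one_unit D x -> exists m : nat, x = e ^ m).
    { induction n; intros x H1 H2 Ux; [simpl in H2; lra|].
      destruct H1 as [H1|<-]; [|exists 0%nat; auto].
      pose proof (Hmin x H1 Ux) as L.
      destruct (IHn (x * / e)) as [m Em].
      - apply Rmult_le_reg_r with e; [lra|]. rewrite Rmult_assoc, Rinv_l by lra. lra.
      - simpl in H2. apply Rmult_lt_reg_r with e; [lra|]. rewrite Rmult_assoc, Rinv_l by lra. lra.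
      - apply norm_one_unit_mult; auto. apply norm_one_unit_inv; auto.
      - exists (S m). simpl. rewrite <- Em. field. lra. }
    assert (Ge1 : forall x, 1 <= x -> norm_one_unit D x -> exists m : nat, x = e ^ m).
    { intros x Hx Ux. destruct (Pow_x_infinity e ltac:(rewrite Rabs_pos_eq; lra) (x + 1)) as [n Hn].
      specialize (Hn n (Nat.le_refl _)). rewrite Rabs_pos_eq in Hn by (apply pow_le; lra).
      apply (Ge n); auto; lra. }
    assert (Gp : forall x, 0 < x -> norm_one_unit D x -> exists n : Z, x = powerRZ e n).
    { intros x Hx Ux. destruct (Rle_lt_dec 1 x) as [h|h].
      - destruct (Ge1 x h Ux) as [m ->]. exists (Z.of_nat m). apply pow_powerRZ.
      - destruct (Ge1 (/ x)) as [m Em].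
        + rewrite <- Rinv_1. apply Rinv_le_contravar; lra.
        + apply norm_one_unit_inv; auto.
        + exists (- Z.of_nat m)%Z. rewrite powerRZ_neg', <- pow_powerRZ, <- Em, Rinv_inv by lra. auto. }
    intros x. split.
    - intros Ux. assert (Hx : x <> 0) by (destruct Ux as [a [b [_ H]]]; intros F; rewrite F in H; lra).
      destruct (Rlt_le_dec 0 x) as [h|h].
      + destruct (Gp x h Ux) as [n Hn]. exists n; auto.
      + destruct (Gp (- x)) as [n Hn]; [lra | apply norm_one_unit_opp; auto|]. exists n. right. lra.
    - intros [n [->| ->]]; auto. apply norm_one_unit_opp; auto. }
  destruct S as [S1 S2]. split; auto. apply S2. exists 1%Z. left. simpl. ring.
Qed.

(** * The value of j *)

Definition upper (tau : C) : Prop := 0 < Im tau.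

(** j as a quotient of two power series in q, the shape that the lemmas on [hol] can treat;
    [j_series_eq] identifies the two on the upper half-plane. *)
Definition j_series (tau : C) : C := (1728 * pser E4_cube_coeff (nome tau) / pser disc_coeff (nome tau))%C.

Lemma j_series_eq (tau : C) : upper tau -> j tau = j_series tau.
Proof.
  intros H. unfold j, j_series. rewrite <- E4_cube_pser, <- discriminant_pser by auto. reflexivity.
Qed.

Lemma hol_j_series : hol upper j_series.
Proof.
  assert (Hn : hol upper nome).
  { apply (hol_comp upper (fun _ => True) (fun z => 2 * PI * Ci * z)%C Cexp); auto using hol_Cexp.
    apply hol_mult; [apply hol_const | apply hol_id]. }
  assert (Hp : forall c, disc_summable c -> hol upper (fun z => pser c (nome z))).
  { intros c Hc. apply (hol_comp upper (fun q => Cmod q < 1) nome (pser c) Hn (hol_pser c Hc)).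
    apply Cmod_nome_lt_1. }
  apply hol_div.
  - apply (hol_mult upper (fun _ => RtoC 1728) (fun z => pser E4_cube_coeff (nome z))); [apply hol_const|].
    apply Hp, disc_summable_E4_cube.
  - apply Hp, disc_summable_disc_coeff.
  - intros z Hz. rewrite <- discriminant_pser by auto. apply discriminant_nz; auto.
Qed.

(** * Geodesics and their automorphs *)

Lemma sign_unique (x d : R) : d = 1 \/ d = -1 -> 0 < d * x -> sign x = d.
Proof. intros [->| ->] H; [apply sign_eq_1 | apply sign_eq_m1]; lra. Qed.

Lemma delta_spec (w : R) : conjugate w <> w ->
  (delta w = 1 \/ delta w = -1) /\ 0 < delta w * (w - conjugate w).
Proof.
  intros H. unfold delta. destruct (Rlt_le_dec 0 (w - conjugate w)) as [h|h].
  - rewrite sign_eq_1 by auto. split; auto; lra.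
  - rewrite sign_eq_m1 by lra. split; auto; lra.
Qed.

Lemma Im_Cexp_pos (u : C) : strip u -> 0 < Im (Cexp u).
Proof.
  intros [H1 H2]. simpl. apply Rmult_lt_0_compat; [apply exp_pos | apply sin_gt_0; auto].
Qed.

Lemma geodesic_denom_nz (d : R) (E : C) : d <> 0 -> 0 < Im E -> (1 - d * E)%C <> 0.
Proof.
  intros Hd HE F. apply (f_equal Im) in F. unfold Im in *. simpl in F.
  assert (G : d * snd E = 0) by lra. apply Rmult_integral in G. destruct G; lra.
Qed.

(** The imaginary part is d (w - w') Im E / |1 - d E|^2, which explains the sign [delta] in the
    parametrisation. *)
Lemma geodesic_upper (d w w' : R) (E : C) : 0 < d * (w - w') -> 0 < Im E ->
  upper ((w - d * w' * E) / (1 - d * E)).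
Proof.
  intros Hw HE. assert (Hd : d <> 0) by (intros F; rewrite F in Hw; lra).
  pose proof (Cnorm_sq_nz _ (geodesic_denom_nz d E Hd HE)) as N.
  unfold upper. destruct E as [x y]. unfold Im in *. simpl in HE. simpl in N. simpl.
  match goal with |- 0 < ?g => replace g with (d * (w - w') * y / ((1 - (d * x - 0 * y)) ^ 2 + (- (d * y + 0 * x)) ^ 2)) end.
  - apply Rdiv_lt_0_compat; [apply Rmult_lt_0_compat; auto|].
    assert (d * y <> 0) by (apply Rmult_integral_contrapositive_currified; lra).
    pose proof (pow2_ge_0 (1 - (d * x - 0 * y))). pose proof (pow2_gt_0 (d * y) H).
    replace (- (d * y + 0 * x)) with (- (d * y)) by ring. replace ((- (d * y)) ^ 2) with ((d * y) ^ 2) by ring. lra.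
  - field. repeat split; intros F; apply N; (eapply eq_trans; [|exact F]); ring.
Qed.

Lemma geodesic_in_upper (w : R) (u : C) : quad_irr w -> strip u -> upper (geodesic w u).
Proof.
  intros Hq Hu. destruct (quad_irr_conjugate w Hq) as [_ [_ [_ [_ Hne]]]].
  destruct (delta_spec w Hne) as [_ Hd]. unfold geodesic. apply geodesic_upper; auto. apply Im_Cexp_pos; auto.
Qed.

Lemma hol_geodesic (w : R) : quad_irr w -> hol strip (fun u => j_series (geodesic w u)).
Proof.
  intros Hq. destruct (quad_irr_conjugate w Hq) as [_ [_ [_ [_ Hne]]]].
  destruct (delta_spec w Hne) as [_ Hd].
  apply (hol_comp strip upper (geodesic w) j_series); [|apply hol_j_series | intros; apply geodesic_in_upper; auto].
  unfold geodesic. apply hol_div.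
  - apply (hol_plus strip (fun _ => RtoC w) (fun u => - (delta w * conjugate w * Cexp u))%C); [apply hol_const|].
    apply (hol_comp strip (fun _ => True) Cexp (fun z => - (delta w * conjugate w * z))%C); auto using hol_Cexp.
    exists (fun _ => (- (delta w * conjugate w))%C). intros z _. split; [|intros x _; apply clim_const].
    exists (fun _ => (- (delta w * conjugate w))%C). repeat split; try (intros; ring); try apply is_lim_seq_const.
  - apply (hol_plus strip (fun _ => RtoC 1) (fun u => - (delta w * Cexp u))%C); [apply hol_const|].
    apply (hol_comp strip (fun _ => True) Cexp (fun z => - (delta w * z))%C); auto using hol_Cexp.
    exists (fun _ => (- delta w)%C). intros z _. split; [|intros x _; apply clim_const].
    exists (fun _ => (- delta w)%C). repeat split; try (intros; ring); try apply is_lim_seq_const.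
  - intros z Hz. apply geodesic_denom_nz; [|apply Im_Cexp_pos; auto]. intros F; rewrite F in Hd; lra.
Qed.

(* The Moebius image of the point z with (z - w)/(z - w') = d E again lies on a geodesic, with
   d E multiplied by (c w' + d)/(c w + d). *)
Lemma j_geodesic_moebius (a b c e : Z) (d w w' : R) (E : C) : (a * e - b * c = 1)%Z ->
  0 < d * (w - w') -> 0 < Im E -> IZR c * w + IZR e <> 0 -> IZR c * w' + IZR e <> 0 ->
  let w1 := (IZR a * w + IZR b) / (IZR c * w + IZR e) in
  let w1' := (IZR a * w' + IZR b) / (IZR c * w' + IZR e) in
  let l := (IZR c * w' + IZR e) / (IZR c * w + IZR e) in
  forall (d1 : R) (E1 : C), (d1 * E1 = d * l * E)%C ->
  j ((w1 - d1 * w1' * E1) / (1 - d1 * E1)) = j ((w - d * w' * E) / (1 - d * E)).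
Proof.
  intros Hdet Hw HE N N' w1 w1' l d1 E1 HE1. assert (Hd : d <> 0) by (intros F; rewrite F in Hw; lra).
  pose proof (geodesic_denom_nz d E Hd HE) as D0.
  pose proof (geodesic_upper d w w' E Hw HE) as Hup.
  rewrite <- (j_SL2 a b c e _ Hdet Hup). f_equal.
  assert (NC : (IZR c * w + IZR e)%C <> 0).
  { rewrite <- RtoC_mult, <- RtoC_plus. apply C_of_R_nz; auto. }
  assert (NC' : (IZR c * w' + IZR e)%C <> 0).
  { rewrite <- RtoC_mult, <- RtoC_plus. apply C_of_R_nz; auto. }
  assert (M : ((IZR c * w + IZR e) - d * E * (IZR c * w' + IZR e))%C <> 0).
  { intros F. apply (f_equal Im) in F. unfold Im in *. destruct E as [x y]. simpl in *.
    assert (G : d * y * (IZR c * w' + IZR e) = 0) by lra.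
    apply Rmult_integral in G. destruct G as [G|G]; auto. apply Rmult_integral in G. destruct G; lra. }
  replace (w1 - d1 * w1' * E1)%C with (w1 - w1' * (d1 * E1))%C by ring. rewrite HE1.
  unfold w1, w1', l. rewrite !RtoC_div, !RtoC_plus, !RtoC_mult by auto.
  assert (M1 : ((1 - d * ((IZR c * w' + IZR e) / (IZR c * w + IZR e)) * E))%C <> 0).
  { intros F. apply M. replace (IZR c * w + IZR e - d * E * (IZR c * w' + IZR e))%C
      with ((IZR c * w + IZR e) * (1 - d * ((IZR c * w' + IZR e) / (IZR c * w + IZR e)) * E))%C by (field; auto).
    rewrite F. ring. }
  assert (M2 : (IZR c * ((w - d * w' * E) / (1 - d * E)) + IZR e)%C <> 0).
  { intros F. apply M. replace (IZR c * w + IZR e - d * E * (IZR c * w' + IZR e))%C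
      with ((1 - d * E) * (IZR c * ((w - d * w' * E) / (1 - d * E)) + IZR e))%C by (field; auto).
    rewrite F. ring. }
  transitivity (((IZR a * w + IZR b) - d * E * (IZR a * w' + IZR b)) / ((IZR c * w + IZR e) - d * E * (IZR c * w' + IZR e)))%C.
  - field; repeat split; auto; intros F; apply M; (eapply eq_trans; [|exact F]); ring.
  - field; repeat split; auto; intros F; apply M; (eapply eq_trans; [|exact F]); ring.
Qed.

(** The unit e acts on the vectors (w, 1) and (w', 1) by an integral matrix with eigenvalues c w + d
    and c w' + d. As A (w - w') may be sqrt D or its negative, it is not known which of the two is
    e. *)
Lemma unit_automorph (w : R) (e : R) : quad_irr w -> norm_one_unit (Defs.disc w) e ->
  let w' := conjugate w in
  exists a b c d : Z, (a * d - b * c = 1)%Z /\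
    (IZR a * w + IZR b) / (IZR c * w + IZR d) = w /\ (IZR a * w' + IZR b) / (IZR c * w' + IZR d) = w' /\
    ((IZR c * w + IZR d = e /\ IZR c * w' + IZR d = / e) \/ (IZR c * w + IZR d = / e /\ IZR c * w' + IZR d = e)).
Proof.
  intros Hq [x [y [Ex Hn]]] w'. destruct (primitive_exists w Hq) as [A [B [C H]]]. destruct Hq as [Hw _].
  destruct (conjugate_facts w A B C Hw H) as [F1 [F2 [F3 [F4 F5]]]]. fold w' in F1, F2, F3, F4, F5.
  destruct (disc_sqrt w A B C Hw H) as [Sq [Dpos _]]. fold w' in Sq.
  pose proof (disc_unique w A B C Hw H) as ED.
  set (D := Defs.disc w) in *. set (k := IZR A * (w - w')) in *.
  assert (HD : 0 < IZR D) by (apply IZR_lt; auto).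
  assert (Hss : sqrt (IZR D) * sqrt (IZR D) = IZR D) by (apply sqrt_sqrt; lra).
  set (s := sqrt (IZR D)) in *.
  assert (Hk : k = s \/ k = - s).
  { assert (Z : (k - s) * (k + s) = 0) by nra. apply Rmult_integral in Z. destruct Z; [left | right]; lra. }
  assert (He : e <> 0) by (intros F; rewrite F in Hn; lra).
  assert (Ie : / e = IZR x + IZR y * ((IZR D - s) / 2)).
  { apply Rmult_eq_reg_l with e; auto. rewrite Hn. field. auto. }
  assert (Hh : exists h, (D - B = 2 * h)%Z).
  { destruct (Z.Even_or_Odd B) as [[m Hm]|[m Hm]].
    - exists (2 * m * m - m - 2 * A * C)%Z. rewrite ED, Hm. ring.
    - exists (2 * m * m + m - 2 * A * C)%Z. rewrite ED, Hm. ring. }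
  destruct Hh as [h Hh].
  assert (HhR : IZR D - IZR B = 2 * IZR h) by (rewrite <- minus_IZR, Hh, mult_IZR; auto).
  assert (EDR : IZR D = IZR B * IZR B - 4 * IZR A * IZR C) by (rewrite ED, minus_IZR, !mult_IZR; auto).
  (* Multiplication by x + y (D + k) / 2, where k = A (w - w') = 2 A w + B; h = (D - B) / 2 is
     integral because D and B have the same parity. The determinant is the norm of e. *)
  exists (x + y * h)%Z, (- (C * y))%Z, (A * y)%Z, (x + y * (h + B))%Z.
  rewrite ?opp_IZR, ?plus_IZR, ?mult_IZR, ?plus_IZR.
  assert (Lw : IZR A * IZR y * w + (IZR x + IZR y * (IZR h + IZR B)) = IZR x + IZR y * ((IZR D + k) / 2)).
  { replace (IZR A * IZR y * w) with (IZR y * ((IZR A * (w + w') + k) / 2)) by (unfold k; field).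
    rewrite F2. replace (IZR h) with ((IZR D - IZR B) / 2) by lra. field. }
  assert (Lw' : IZR A * IZR y * w' + (IZR x + IZR y * (IZR h + IZR B)) = IZR x + IZR y * ((IZR D - k) / 2)).
  { replace (IZR A * IZR y * w') with (IZR y * ((IZR A * (w + w') - k) / 2)) by (unfold k; field).
    rewrite F2. replace (IZR h) with ((IZR D - IZR B) / 2) by lra. field. }
  assert (Cases : (IZR A * IZR y * w + (IZR x + IZR y * (IZR h + IZR B)) = e /\
     IZR A * IZR y * w' + (IZR x + IZR y * (IZR h + IZR B)) = / e) \/
    (IZR A * IZR y * w + (IZR x + IZR y * (IZR h + IZR B)) = / e /\
     IZR A * IZR y * w' + (IZR x + IZR y * (IZR h + IZR B)) = e)).
  { rewrite Lw, Lw', Ie, Ex. destruct Hk as [-> | ->]; [left; auto | right].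
    split; [unfold Rminus; auto|]. replace (IZR D - - s) with (IZR D + s) by ring. auto. }
  assert (Hie : / e <> 0) by (apply Rinv_neq_0_compat; auto).
  assert (N : IZR A * IZR y * w + (IZR x + IZR y * (IZR h + IZR B)) <> 0) by (destruct Cases as [[-> _]|[-> _]]; auto).
  assert (N' : IZR A * IZR y * w' + (IZR x + IZR y * (IZR h + IZR B)) <> 0) by (destruct Cases as [[_ ->]|[_ ->]]; auto).
  split; [|split; [|split; [|exact Cases]]].
  - apply eq_IZR. rewrite minus_IZR, !mult_IZR, opp_IZR, !plus_IZR, !mult_IZR, plus_IZR.
    rewrite <- Hn, Ex. fold s. replace (IZR h) with ((IZR D - IZR B) / 2) by lra.
    transitivity (IZR x * IZR x + IZR x * IZR y * IZR D + IZR y * IZR y * ((IZR D * IZR D - (IZR B * IZR B - 4 * IZR A * IZR C)) / 4)); [field|].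
    rewrite <- EDR. rewrite <- Hss at 4. field.
  - destruct H as [_ Hr]. unfold quad_root in Hr.
    apply Rmult_eq_reg_r with (IZR A * IZR y * w + (IZR x + IZR y * (IZR h + IZR B))); auto.
    unfold Rdiv. rewrite Rmult_assoc, Rinv_l by auto.
    assert (IZR y * (IZR A * w ^ 2 + IZR B * w + IZR C) = 0) by (rewrite Hr; ring). lra.
  - destruct F4 as [_ Hr]. unfold quad_root in Hr.
    apply Rmult_eq_reg_r with (IZR A * IZR y * w' + (IZR x + IZR y * (IZR h + IZR B))); auto.
    unfold Rdiv. rewrite Rmult_assoc, Rinv_l by auto.
    assert (IZR y * (IZR A * w' ^ 2 + IZR B * w' + IZR C) = 0) by (rewrite Hr; ring). lra.
Qed.

Lemma fund_unit_facts (w : R) : quad_irr w ->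
  1 < fund_unit (Defs.disc w) /\ norm_one_unit (Defs.disc w) (fund_unit (Defs.disc w)).
Proof.
  intros Hq. destruct (primitive_exists w Hq) as [A [B [C H]]]. destruct Hq as [Hw _].
  destruct (disc_sqrt w A B C Hw H) as [_ [Dpos Dns]]. apply fund_unit_spec; auto.
  rewrite (disc_unique w A B C Hw H).
  (* D is 4 n or 4 n + 1 according to the parity of B, so 4 divides D^2 - D. *)
  destruct (Z.Even_or_Odd B) as [[m Hm]|[m Hm]]; rewrite Hm.
  - exists ((m * m - A * C) * (4 * (m * m - A * C) - 1))%Z. ring.
  - exists ((m * m + m - A * C) * (4 * (m * m + m - A * C) + 1))%Z. ring.
Qed.

Definition period (w : R) : R := 2 * ln (fund_unit (Defs.disc w)).

Lemma period_pos (w : R) : quad_irr w -> 0 < period w.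
Proof.
  intros H. destruct (fund_unit_facts w H) as [He _]. unfold period.
  assert (0 < ln (fund_unit (Defs.disc w))) by (rewrite <- ln_1; apply ln_increasing; lra). lra.
Qed.

Lemma Cexp_add_period (w : R) (u : C) : quad_irr w ->
  Cexp (u + period w) = (RtoC (fund_unit (Defs.disc w) ^ 2) * Cexp u)%C.
Proof.
  intros H. destruct (fund_unit_facts w H) as [He _]. rewrite Cexp_plus, Cexp_RtoC, Cmult_comm. do 2 f_equal.
  unfold period. replace (2 * ln (fund_unit (Defs.disc w))) with (ln (fund_unit (Defs.disc w)) + ln (fund_unit (Defs.disc w))) by ring.
  rewrite exp_plus, exp_ln by lra. ring.
Qed.

(** The automorph fixes w and w' and multiplies exp u by e^-2 or e^2; in the first case it is
    applied at u + [period w] and read backwards. *)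
Lemma j_geodesic_periodic (w : R) (u : C) : quad_irr w -> strip u ->
  j (geodesic w (u + period w)) = j (geodesic w u).
Proof.
  intros Hq Hu. destruct (fund_unit_facts w Hq) as [He Ue]. unfold geodesic. rewrite Cexp_add_period by auto.
  set (e := fund_unit _) in *. destruct (quad_irr_conjugate w Hq) as [_ [_ [_ [_ Hne]]]].
  destruct (delta_spec w Hne) as [_ Hd].
  destruct (unit_automorph w e Hq Ue) as [a [b [c [d [Hdet [Ew [Ew' Hc]]]]]]].
  pose proof (Im_Cexp_pos u Hu) as HE. set (E := Cexp u) in *. clearbody E.
  assert (Hie : 0 < / e) by (apply Rinv_0_lt_compat; lra).
  set (w' := conjugate w) in *. set (dl := delta w) in *.
  assert (HE2 : 0 < Im (RtoC (e ^ 2) * E)).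
  { unfold Im in *. simpl. rewrite Rmult_0_l, Rplus_0_r. repeat apply Rmult_lt_0_compat; lra. }
  assert (Hec : RtoC e <> 0) by (apply C_of_R_nz; lra).
  assert (Nw : IZR c * w + IZR d <> 0) by (destruct Hc as [[-> _]|[-> _]]; apply Rgt_not_eq; lra).
  assert (Nw' : IZR c * w' + IZR d <> 0) by (destruct Hc as [[_ ->]|[_ ->]]; apply Rgt_not_eq; lra).
  destruct Hc as [[C1 C2]|[C1 C2]].
  - pose proof (j_geodesic_moebius a b c d dl w w' _ Hdet Hd HE2 Nw Nw') as G.
    cbv zeta in G. rewrite Ew, Ew', C1, C2 in G. symmetry. apply G.
    rewrite RtoC_div, RtoC_inv, RtoC_pow by lra. field. auto.
  - pose proof (j_geodesic_moebius a b c d dl w w' _ Hdet Hd HE Nw Nw') as G.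
    cbv zeta in G. rewrite Ew, Ew', C1, C2 in G. apply G.
    rewrite RtoC_div, RtoC_inv, RtoC_pow by lra. field. auto.
Qed.

(** * Integrals over one period and the three identities *)

Definition cycle_integral (s : C) (w : R) : C := CRInt (fun t : R => j (geodesic w (s + t))) 0 (period w).

Lemma CRInt_ext (f g : R -> C) (a b : R) : (forall t, f t = g t) -> CRInt f a b = CRInt g a b.
Proof. intros H. unfold CRInt. f_equal; apply RInt_ext; intros t _; rewrite H; auto. Qed.

Lemma j_geodesic_series (w : R) (s : C) (t : R) : quad_irr w -> strip s ->
  j (geodesic w (s + t)) = j_series (geodesic w (s + t)).
Proof. intros Hq Hs. apply j_series_eq, geodesic_in_upper, strip_add_R; auto. Qed.

Lemma val_cycle_integral (s : C) (w : R) : quad_irr w -> strip s ->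
  val s w = (/ RtoC (period w) * cycle_integral s w)%C.
Proof.
  intros Hq Hs. unfold val. fold (period w). f_equal. unfold cycle_integral.
  rewrite (RInt_ext (V := C_R_CompleteNormedModule) _ (fun t : R => j_series (geodesic w (s + t))))
    by (intros t _; apply j_geodesic_series; auto).
  rewrite (CRInt_ext (fun t : R => j (geodesic w (s + t))) (fun t : R => j_series (geodesic w (s + t)))) by (intros; apply j_geodesic_series; auto).
  apply (RInt_CRInt (fun u => j_series (geodesic w u))); auto.
  intros z Hz. apply (hol_ccont strip _ z (hol_geodesic w Hq) Hz).
Qed.

Lemma cycle_integral_base_point (s s1 : C) (w : R) : quad_irr w -> strip s -> strip s1 ->
  cycle_integral s w = cycle_integral s1 w.
Proof.
  intros Hq Hs Hs1. unfold cycle_integral.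
  rewrite (CRInt_ext (fun t : R => j (geodesic w (s + t))) (fun t : R => j_series (geodesic w (s + t)))) by (intros; apply j_geodesic_series; auto).
  rewrite (CRInt_ext (fun t : R => j (geodesic w (s1 + t))) (fun t : R => j_series (geodesic w (s1 + t)))) by (intros; apply j_geodesic_series; auto).
  apply (RInt_base_point (fun u => j_series (geodesic w u))); auto using hol_geodesic, period_pos.
  intros u Hu. rewrite <- !j_series_eq by (apply geodesic_in_upper; auto using strip_add_R).
  apply j_geodesic_periodic; auto.
Qed.

Lemma ex_RInt_cycle (s : C) (w : R) : quad_irr w -> strip s ->
  ex_RInt (fun t : R => Re (j (geodesic w (s + t)))) 0 (period w) /\
  ex_RInt (fun t : R => Im (j (geodesic w (s + t)))) 0 (period w).
Proof.
  intros Hq Hs. pose proof (fun z => hol_ccont strip _ z (hol_geodesic w Hq)) as Hc. cbv beta in Hc. split.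
  - eapply ex_RInt_ext; [|apply (ex_RInt_Re_line (fun u => j_series (geodesic w u)) s 0 (period w) Hc Hs)].
    intros t _. cbv beta. rewrite j_geodesic_series; auto.
  - eapply ex_RInt_ext; [|apply (ex_RInt_Re_line (fun u => - Ci * j_series (geodesic w u))%C s 0 (period w))]; auto.
    + intros t _. cbv beta. rewrite j_geodesic_series by auto.
      match goal with |- ?a = ?b => change (a = b :> R) end. unfold Re, Im; simpl. ring.
    + intros z Hz x Hx. apply clim_scal. apply Hc; auto.
Qed.

Lemma RInt_reflect (f : R -> R) (L : R) : ex_RInt f 0 L -> RInt (fun t => f (L - t)) 0 L = RInt f 0 L.
Proof.
  intros H.
  assert (Hs : ex_RInt f (-1 * 0 + L) (-1 * L + L)).
  { replace (-1 * 0 + L) with L by ring. replace (-1 * L + L) with 0 by ring. apply ex_RInt_swap. auto. }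
  assert (Hx : ex_RInt (fun t => f (-1 * t + L)) 0 L).
  { pose proof (ex_RInt_comp_lin (V := R_NormedModule) f (-1) L 0 L Hs) as H1.
    apply (ex_RInt_scal (V := R_NormedModule) _ _ _ (-1)) in H1.
    eapply ex_RInt_ext; [|exact H1]. intros t _. unfold scal; simpl; unfold mult; simpl.
    match goal with |- ?a = ?b => change (a = b :> R) end. ring. }
  pose proof (RInt_comp_lin (V := R_CompleteNormedModule) f (-1) L 0 L Hs) as E.
  rewrite (RInt_scal (V := R_CompleteNormedModule) (fun t => f (-1 * t + L)) 0 L (-1) Hx) in E.
  replace (-1 * 0 + L) with L in E by ring. replace (-1 * L + L) with 0 in E by ring.
  rewrite <- (opp_RInt_swap (V := R_CompleteNormedModule) f 0 L H) in E.
  unfold scal, opp in E; simpl in E; unfold mult in E; simpl in E.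
  transitivity (RInt (fun t => f (-1 * t + L)) 0 L); [|lra].
  apply RInt_ext. intros t _. f_equal. ring.
Qed.

Lemma cycle_integral_reflect (s : C) (w : R) : quad_irr w -> strip s ->
  CRInt (fun t : R => j (geodesic w (s + RtoC (period w - t)))) 0 (period w) = cycle_integral s w.
Proof.
  intros Hq Hs. destruct (ex_RInt_cycle s w Hq Hs) as [H1 H2].
  exact (f_equal2 pair (RInt_reflect _ _ H1) (RInt_reflect _ _ H2)).
Qed.

(** The factor l = (c w' + d) / (c w + d) splits into its modulus, a real translation of u by ln
    |l|, and its sign, the quotient of the two values of [delta]. *)
Lemma val_Gamma_equiv (w w1 : R) (s s1 : C) : quad_irr w -> quad_irr w1 -> Gamma_equiv w w1 ->
  strip s -> strip s1 -> val s w = val s1 w1.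
Proof.
  intros Hq Hq1 [a [b [c [d [Hdet E]]]]] Hs Hs1.
  destruct (Gamma_equiv_facts w w1 a b c d Hq Hq1 Hdet E) as [E' HD].
  assert (HL : period w1 = period w) by (unfold period; rewrite HD; auto).
  destruct (quad_irr_conjugate w Hq) as [Hw' [_ [_ [_ Hne]]]].
  destruct (quad_irr_conjugate w1 Hq1) as [_ [_ [_ [_ Hne1]]]].
  destruct (delta_spec w Hne) as [_ Hd].
  assert (Hcd : (c <> 0 \/ d <> 0)%Z) by (destruct (Z.eq_dec c 0); [right; lia | left; auto]).
  pose proof (irrational_linear_nz w c d (proj1 Hq) Hcd) as N.
  pose proof (irrational_linear_nz _ c d Hw' Hcd) as N'.
  set (w' := conjugate w) in *. set (X := IZR c * w + IZR d) in *. set (X' := IZR c * w' + IZR d) in *.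
  set (l := X' / X).
  assert (Hl : l <> 0) by (apply Rmult_integral_contrapositive_currified; auto; apply Rinv_neq_0_compat; auto).
  (* w1 - w1' = (w - w') / (X X'), and X X' = X^2 l has the sign of l. *)
  assert (Hd1 : delta w1 = delta w * sign l).
  { unfold delta at 1. apply sign_unique.
    - destruct (delta_spec w Hne) as [[-> | ->] _]; destruct (Rlt_le_dec 0 l) as [h|h];
        rewrite ?(sign_eq_1 l), ?(sign_eq_m1 l) by lra; lra.
    - rewrite E', E.
      replace ((IZR a * w + IZR b) / X - (IZR a * w' + IZR b) / X') with ((w - w') * / (X ^ 2 * l)).
      + replace (delta w * sign l * ((w - w') * / (X ^ 2 * l))) with (delta w * (w - w') * (sign l * / (X ^ 2 * l))) by ring.
        apply Rmult_lt_0_compat; auto. assert (0 < X ^ 2) by (apply pow2_gt_0; auto).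
        destruct (Rlt_le_dec 0 l) as [h|h].
        * rewrite sign_eq_1 by auto. rewrite Rmult_1_l. apply Rinv_0_lt_compat, Rmult_lt_0_compat; auto.
        * rewrite sign_eq_m1 by lra.
          assert (/ (X ^ 2 * l) < 0); [|lra]. apply Rinv_lt_0_compat. nra.
      + unfold l. assert (Hdet' : IZR a * IZR d - IZR b * IZR c = 1) by (rewrite <- !mult_IZR, <- minus_IZR, Hdet; auto).
        transitivity (((IZR a * IZR d - IZR b * IZR c) * (w - w')) / (X * X')); [rewrite Hdet'; field; auto|].
        unfold X, X'. field. auto. }
  assert (Habs : sign l * Rabs l = l).
  { destruct (Rlt_le_dec 0 l) as [h|h].
    - rewrite sign_eq_1, Rabs_pos_eq by lra. ring.
    - rewrite sign_eq_m1, Rabs_left by lra. ring. }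
  assert (Hsg : sign l * sign l = 1).
  { destruct (Rlt_le_dec 0 l) as [h|h]; [rewrite sign_eq_1 | rewrite sign_eq_m1]; lra. }
  rewrite !val_cycle_integral, HL by auto. f_equal.
  transitivity (cycle_integral (s + RtoC (ln (Rabs l))) w1).
  2: { apply cycle_integral_base_point; auto using strip_add_R. }
  unfold cycle_integral. rewrite HL. apply CRInt_ext. intros t. symmetry.
  pose proof (Im_Cexp_pos _ (strip_add_R s t Hs)) as HE.
  pose proof (j_geodesic_moebius a b c d (delta w) w w' _ Hdet Hd HE N N') as G. cbv zeta in G.
  fold X X' in G. fold l in G. rewrite <- E, <- E' in G. unfold geodesic. apply G.
  replace (s + ln (Rabs l) + t)%C with (ln (Rabs l) + (s + t))%C by ring.
  rewrite (Cexp_plus (ln (Rabs l))), Cexp_RtoC, exp_ln by (apply Rabs_pos_lt; auto).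
  rewrite Hd1, !Cmult_assoc, <- !RtoC_mult. do 2 f_equal. rewrite Rmult_assoc, Habs. auto.
Qed.

(** Multiply numerator and denominator by - d and use d^2 = 1: passing from E to 1 / E exchanges the
    endpoints. *)
Lemma geodesic_swap (d w w' : R) (E : C) : d * d = 1 -> E <> 0 -> (1 - d * E)%C <> 0 ->
  ((w - d * w' * E) / (1 - d * E) = (w' - d * w * / E) / (1 - d * / E))%C.
Proof.
  intros Hd NE N1. assert (D2 : (d * d)%C = 1) by (rewrite <- RtoC_mult, Hd; auto).
  assert (Hdc : RtoC d <> 0) by (apply C_of_R_nz; intros F; rewrite F in Hd; lra).
  assert (E1 : (E - d = - d * (1 - d * E))%C).
  { transitivity ((d * d) * E - d)%C; [rewrite D2|]; ring. }
  assert (E2 : (w' * E - d * w = - d * (w - d * w' * E))%C).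
  { transitivity (w' * ((d * d) * E) - d * w)%C; [rewrite D2|]; ring. }
  assert (N2 : (E - d)%C <> 0).
  { rewrite E1. apply Cmult_neq_0; auto. intros F. apply Hdc.
    replace (RtoC d) with (- - d)%C by ring. rewrite F. ring. }
  transitivity ((w' * E - d * w) / (E - d))%C.
  - rewrite E1, E2. field. auto.
  - field. auto.
Qed.

Lemma strip_reflect (s : C) (L : R) : strip s -> strip (PI * Ci - s - RtoC L).
Proof. unfold strip, Im. simpl. lra. Qed.

(** The map u -> i PI - u sends the segment from s to s + L to the one that starts at i PI - s - L,
    run backwards; [cycle_integral_reflect] restores the direction. It turns exp u into - 1 / exp u,
    and [delta] of w' absorbs the minus sign. *)
Lemma val_conjugate (w : R) (s s1 : C) : quad_irr w -> strip s -> strip s1 ->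
  val s w = val s1 (conjugate w).
Proof.
  intros Hq Hs Hs1. destruct (quad_irr_conjugate w Hq) as [_ [Hq' [Ecc [ED Hne]]]].
  assert (HL : period (conjugate w) = period w) by (unfold period; rewrite ED; auto).
  assert (Hd' : delta (conjugate w) = - delta w).
  { destruct (delta_spec w Hne) as [D1 D2]. unfold delta at 1. rewrite Ecc. apply sign_unique; lra. }
  rewrite !val_cycle_integral, HL by auto. f_equal.
  pose proof (strip_reflect s (period w) Hs) as Hr.
  rewrite (cycle_integral_base_point s1 _ (conjugate w) Hq' Hs1 Hr).
  rewrite <- (cycle_integral_reflect _ (conjugate w) Hq' Hr). unfold cycle_integral. rewrite HL.
  apply CRInt_ext. intros t. f_equal. unfold geodesic. rewrite Ecc, Hd'.
  replace (PI * Ci - s - period w + RtoC (period w - t))%C with (PI * Ci + - (s + t))%C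
    by (rewrite RtoC_minus; ring).
  rewrite (Cexp_plus (PI * Ci)), Cexp_iPI, (Cexp_opp (s + t)).
  destruct (delta_spec w Hne) as [Dv _].
  rewrite geodesic_swap.
  - rewrite RtoC_opp. f_equal; [|f_equal]; ring.
  - destruct Dv as [-> | ->]; ring.
  - apply Cexp_nz.
  - apply geodesic_denom_nz; [destruct Dv as [-> | ->]; lra | apply Im_Cexp_pos, strip_add_R; auto].
Qed.

Lemma Cconj_CRInt (f : R -> C) (a b : R) : ex_RInt (fun t => Im (f t)) a b ->
  Cconj (CRInt f a b) = CRInt (fun t => Cconj (f t)) a b.
Proof.
  intros H. apply C_ext; [reflexivity|]. symmetry.
  apply (RInt_opp (V := R_CompleteNormedModule) (fun t => Im (f t))). auto.
Qed.

Lemma val_opp_conjugate (w : R) (s s1 : C) : quad_irr w -> strip s -> strip s1 ->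
  Cconj (val s w) = val s1 (- conjugate w).
Proof.
  intros Hq Hs Hs1. destruct (quad_irr_conjugate w Hq) as [_ [Hq' [Ecc [ED Hne]]]].
  destruct (quad_irr_opp (conjugate w) Hq') as [Hqo [Eco EDo]]. rewrite Ecc in Eco.
  assert (HL : period (- conjugate w) = period w) by (unfold period; rewrite EDo, ED; auto).
  assert (Hd' : delta (- conjugate w) = delta w).
  { destruct (delta_spec w Hne) as [D1 D2]. unfold delta at 1. rewrite Eco. apply sign_unique; auto. lra. }
  pose proof (period_pos w Hq) as HLp.
  rewrite !val_cycle_integral, HL, Cmult_conj by auto. f_equal.
  { rewrite <- RtoC_inv by lra. apply C_ext; simpl; ring. }
  (* The map u -> - conj u also reverses the segment; its image starts at - conj s - L. *)
  assert (Hr : strip (- Cconj s - RtoC (period w))) by (unfold strip, Im in *; simpl; lra).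
  rewrite (cycle_integral_base_point s1 _ (- conjugate w) Hqo Hs1 Hr).
  rewrite <- (cycle_integral_reflect _ (- conjugate w) Hqo Hr). unfold cycle_integral. rewrite HL.
  rewrite Cconj_CRInt by (apply ex_RInt_cycle; auto).
  apply CRInt_ext. intros t. rewrite <- j_conj. f_equal. unfold geodesic. rewrite Eco, Hd'.
  replace (- Cconj s - period w + RtoC (period w - t))%C with (- Cconj (s + t))%C
    by (rewrite RtoC_minus, Cplus_conj; replace (Cconj t) with (RtoC t) by (apply C_ext; simpl; ring); ring).
  rewrite (Cexp_opp (Cconj (s + t))), Cexp_conj.
  destruct (delta_spec w Hne) as [Dv _].
  assert (Hdn : delta w <> 0) by (destruct Dv as [-> | ->]; lra).
  pose proof (geodesic_denom_nz _ _ Hdn (Im_Cexp_pos _ (strip_add_R s t Hs))) as N1.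
  assert (HR : forall x : R, Cconj x = x) by (intros; apply C_ext; simpl; ring).
  assert (Hz : forall z : C, z <> 0 -> Cconj z <> 0).
  { intros z Hz F. apply Hz. rewrite <- (Cconj_conj z), F, HR. auto. }
  pose proof (Hz _ N1) as N2. rewrite Cminus_conj, Cmult_conj, !HR in N2.
  rewrite Cdiv_conj, !Cminus_conj, !Cmult_conj, !HR by auto.
  rewrite geodesic_swap.
  - rewrite !RtoC_opp. unfold Cdiv. ring.
  - destruct Dv as [-> | ->]; ring.
  - apply Hz, Cexp_nz.
  - exact N2.
Qed.

Theorem mainTheorem1 :
  (forall w w1 : R, quad_irr w -> quad_irr w1 -> Gamma_equiv w w1 ->
     forall s s1 : C, strip s -> strip s1 -> val s w = val s1 w1) /\
  (forall w : R, quad_irr w ->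
     forall s s1 : C, strip s -> strip s1 ->
       val s w = val s1 (conjugate w)) /\
  (forall w : R, quad_irr w ->
     forall s s1 : C, strip s -> strip s1 ->
       Cconj (val s w) = val s1 (- conjugate w)).
Proof.
  split; [|split].
  - intros w w1 Hq Hq1 HG s s1 Hs Hs1. apply val_Gamma_equiv; auto.
  - intros w Hq s s1 Hs Hs1. apply val_conjugate; auto.
  - intros w Hq s s1 Hs Hs1. apply val_opp_conjugate; auto.
Qed.
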